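(* Let $\alpha(x)$ be a sub-polynomial such that $\lim_{x\to+\infty}\alpha(x)=+\infty$ and such that, for every $p\in\mathbb{Q}[x]$ and every $c\in\mathbb{R}$, $$\lim_{x\to+\infty}\frac{|\alpha(x)-c\,p(x)|}{\log x}=+\infty.$$ Then, for any $A_1,A_2\subseteq\mathbb{N}$ satisfying $\overline{d}(A_1,A_2)>0$, there exist $n\in\mathbb{N}$ and distinct $x\in A_1$ and $y\in A_2$ such that $x+y=\lfloor\alpha(n)\rfloor$.
   Context: $\mathbb{N}=\{1,2,\dots\}$. For $A_1,A_2\subseteq\mathbb{N}$ the joint upper density is $\overline{d}(A_1,A_2):=\limsup_{N\to\infty}\min_{1\leq i\leq 2}\frac{|A_i\cap[1,N]|}{N}$. Let $\mathcal{G}$ be the ring (under pointwise addition and multiplication) of germs at $+\infty$ of continuous real-valued functions defined on half-lines $(a,+\infty)$; two functions have the same germ if they agree for all sufficiently large $x$. A Hardy field is a subfield of $\mathcal{G}$ closed under differentiation (each element is eventually differentiable and its derivative's germ lies in the field). A sub-polynomial is a function $\alpha$ whose germ belongs to some Hardy field and which satisfies $\lim_{x\to+\infty}\alpha(x)/x^l=0$ for some $l>0$. Functions and germs are not distinguished; when values $\alpha(n)$, $n\in\mathbb{N}$, appear, $\alpha$ denotes a fixed real-valued representative defined on $[1,+\infty)$. *)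

(* Defs.v *)
From HB Require Import structures.
From mathcomp Require Import all_boot all_order all_algebra.
From mathcomp Require Import finmap.
From mathcomp Require Import all_classical all_reals all_analysis.
Set Implicit Arguments.
Unset Strict Implicit.
Unset Printing Implicit Defensive.
Import Order.TTheory GRing.Theory Num.Theory numFieldNormedType.Exports.

Local Open Scope classical_set_scope.
Local Open Scope ring_scope.

Definition same_germ (R : realType) (f g : R -> R) : Prop :=
  \forall x \near +oo_ R, f x = g x.

(* A set of germs at +oo is represented by the set of all representatives of
   its elements.  A function on a half-line is represented by an arbitrary
   extension to R, hence the saturation condition [hardy_germ]. *)
Record hardy_field (R : realType) (H : set (R -> R)) : Prop := HardyField {
  hardy_germ : forall f g, same_germ f g -> H f -> H g;
  hardy_continuous : forall f, H f ->
    exists a : R, forall x, a < x -> {for x, continuous f};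
  hardy_one : H (fun=> 1);
  hardy_sub : forall f g, H f -> H g -> H (fun x => f x - g x);
  hardy_mul : forall f g, H f -> H g -> H (fun x => f x * g x);
  hardy_inv : forall f, H f -> ~ same_germ f (fun=> 0) ->
    exists2 g, H g & same_germ (fun x => f x * g x) (fun=> 1);
  hardy_derivable : forall f, H f -> \forall x \near +oo_ R, derivable f x 1;
  hardy_deriv : forall f, H f -> H (derive1 f) }.

Definition sub_polynomial (R : realType) (alpha : R -> R) : Prop :=
  (exists2 H : set (R -> R), hardy_field H & H alpha) /\
  (exists2 l : R, 0 < l & alpha x / x `^ l @[x --> +oo_ R] --> (0 : R)).

Definition count_upto (A : set nat) (N : nat) : nat :=
  #|` fset_set (A `&` [set k | (1 <= k <= N)%N]) |%fset.

(* The term at N = 0 is 0 and does not affect the upper limit. *)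
Definition joint_upper_density (R : realType) (A1 A2 : set nat) : \bar R :=
  limn_esup (fun N : nat =>
    (Num.min ((count_upto A1 N)%:R / N%:R)
             ((count_upto A2 N)%:R / N%:R))%:E).

(* Main.v *)
(* Let F_j be the j-th derivative of alpha and k the largest order whose derivative does not tend to 0. An inverse Weyl
   theorem, proved by van der Corput differencing, shows that if a sum of e(lam alpha(n)) over n < N with lam F_1(N)
   bounded below is not o(N), then lam alpha(n) is within O(1) of a polynomial with coefficients of bounded denominator along
   a progression of length >> N. As alpha lies in a Hardy field, this propagates to infinity and forces
   alpha = c p + O(log x) with p rational, which is excluded. By partial summation, with the weights
   w_n = alpha(n+1) - alpha(n) the values alpha(n) < M are equidistributed modulo M at all scales down to 1: the sum of
   w_n e(t alpha(n) / M) is o(M) uniformly for 0 < |t| <= 2M.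

   Let A and B be disjoint parts of A1 and A2 in [1, N], both of size >> N, and M = 2N + 2. A Fejer-type kernel Phi of degree
   less than 2M, positive only for v within 1/2 of M Z, is summed over v = alpha(n) - x - y - 1/2 with weights w_n,
   x in A, y in B. By Parseval on Z/M its nonzero frequencies contribute less than the zero one, so the sum is positive, and
   some v satisfies |v| < 1/2, that is floor(alpha(n)) = x + y. *)
Require Import Defs.
From HB Require Import structures.
From mathcomp Require Import all_boot all_order all_algebra.
From mathcomp Require Import finmap.
From mathcomp Require Import all_classical all_reals all_analysis.
From mathcomp Require Import complex ring lra zify.
Set Implicit Arguments.
Unset Strict Implicit.
Unset Printing Implicit Defensive.
Import Order.TTheory GRing.Theory Num.Theory numFieldNormedType.Exports.

Local Open Scope classical_set_scope.
Local Open Scope ring_scope.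

(** Positive joint density is only known along some sequence of scales [N], and sums [x + y] are
    single integers, so the values of [alpha] below [M] must be controlled down to intervals of
    length 1. This calls for all frequencies [lam = t / M] with [0 < |t| <= 2 M], uniformly; Weyl
    sums at a fixed [lam] do not suffice. Frequencies with [|lam| F 1 N] small are harmless, since
    consecutive phases hardly move and the weighted sum is a Riemann sum of a vanishing integral.
    The others need an inverse theorem whose constants do not depend on [lam]. The logarithm comes
    from repeated integration: resonances at arbitrarily large [N] give [F k.+1 = O(x^-(k+1))],
    every integration leaves a constant and a smaller power, and the last one integrates [1 / x].
    Rationality of the polynomial comes from multiplying the resonance at [N] by an integer that
    makes its frequency nearly independent of [N]. *)

(** * The real modulus and the exponential [e a = exp(2 i pi a)] *)

Section Exponential.
Variable R : realType.
Implicit Types (a th : R) (z w : R[i]).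

(** The norm of [R[i]] has values in [R[i]]; this one is real and can be compared with real
    bounds. *)
Definition nrm z : R := Normc.normc z.
Arguments nrm : simpl never.

Lemma nrm_def z : nrm z = Num.sqrt (complex.Re z ^+ 2 + complex.Im z ^+ 2).
Proof. by case: z. Qed.

Lemma nrm_ge0 z : 0 <= nrm z.
Proof. by rewrite nrm_def sqrtr_ge0. Qed.

Lemma nrmM z w : nrm (z * w) = nrm z * nrm w.
Proof. exact: Normc.normcM. Qed.

Lemma nrmD z w : nrm (z + w) <= nrm z + nrm w.
Proof. exact: (le_normcD z w). Qed.

Lemma nrmN z : nrm (- z) = nrm z.
Proof. exact: (normcN z). Qed.

Lemma nrm0 : nrm 0 = 0.
Proof. exact: Normc.normc0. Qed.

Lemma nrmC a : nrm (a%:C)%C = `|a|.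
Proof. by rewrite nrm_def /= expr0n /= addr0 sqrtr_sqr. Qed.

Lemma nrmJ z : nrm (z^*)%C = nrm z.
Proof. by case: z => x y; rewrite !nrm_def /= sqrrN. Qed.

Lemma nrmB z w : nrm (z - w) <= nrm z + nrm w.
Proof. by apply: le_trans (nrmD _ _) _; rewrite nrmN. Qed.

Lemma nrmBC z w : nrm (z - w) = nrm (w - z).
Proof. by rewrite -nrmN opprB. Qed.

Lemma nrm_triB z w : nrm z <= nrm (z - w) + nrm w.
Proof. by apply: le_trans (nrmD _ _); rewrite subrK. Qed.

Lemma nrm_sum (I : Type) (r : seq I) (P : pred I) (F : I -> R[i]) :
  nrm (\sum_(i <- r | P i) F i) <= \sum_(i <- r | P i) nrm (F i).
Proof.
elim/big_rec2: _ => [|i y x _ IH]; first by rewrite nrm0.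
exact: le_trans (nrmD _ _) (lerD (lexx _) IH).
Qed.

Lemma nrm_sum_le (N : nat) (F : nat -> R[i]) K :
  (forall n, (n < N)%N -> nrm (F n) <= K) -> nrm (\sum_(n < N) F n) <= N%:R * K.
Proof.
move=> h; apply: le_trans (nrm_sum _ _ _) _.
apply: le_trans (ler_sum _ (fun (i : 'I_N) _ => h i (ltn_ord i))) _.
by rewrite sumr_const card_ord mulr_natl.
Qed.

Lemma nrm_ReIm z : nrm z <= `|complex.Re z| + `|complex.Im z|.
Proof.
case: z => x y /=.
rewrite -(@ler_pXn2r _ 2) ?nnegrE ?nrm_ge0 ?addr_ge0 //.
rewrite nrm_def /= sqr_sqrtr ?addr_ge0 ?sqr_ge0 // sqrrD !real_normK ?num_real //.
by rewrite lerD2r lerDl mulrn_wge0 // mulr_ge0.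
Qed.

Lemma Re_le_nrm z : `|complex.Re z| <= nrm z.
Proof.
case: z => x y /=.
rewrite -(@ler_pXn2r _ 2) ?nnegrE ?nrm_ge0 // nrm_def /= sqr_sqrtr ?addr_ge0 ?sqr_ge0 //.
by rewrite real_normK ?num_real // lerDl sqr_ge0.
Qed.

Lemma mulJ_nrm z : z * (z^*)%C = ((nrm z ^+ 2)%:C)%C.
Proof.
case: z => x y; rewrite nrm_def /= sqr_sqrtr ?addr_ge0 ?sqr_ge0 //.
by apply/eqP; rewrite eq_complex /=; apply/andP; split; apply/eqP; ring.
Qed.

Definition e a : R[i] := (cos (2 * pi * a) +i* sin (2 * pi * a))%C.

Arguments e : simpl never.

Lemma e0 : e 0 = 1.
Proof. by rewrite /e mulr0 cos0 sin0. Qed.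

Lemma eD a (b : R) : e (a + b) = e a * e b.
Proof.
rewrite /e mulrDr cosD sinD; apply/eqP; rewrite eq_complex /=.
by rewrite eqxx /=; apply/eqP; ring.
Qed.

Lemma eN a : e (- a) = ((e a)^*)%C.
Proof. by rewrite /e mulrN cosN sinN. Qed.

Lemma eB a (b : R) : e (a - b) = e a * ((e b)^*)%C.
Proof. by rewrite eD eN. Qed.

Lemma nrm_e a : nrm (e a) = 1.
Proof. by rewrite nrm_def /= cos2Dsin2 sqrtr1. Qed.

Lemma e1 : e 1 = 1.
Proof.
have -> : e 1 = (cos (pi *+ 2) +i* sin (pi *+ 2))%C.
  by rewrite /e mulr1 mulr_natl.
by rewrite cos2pi sin2pi.
Qed.

Lemma e_nat (k : nat) : e k%:R = 1.
Proof. by elim: k => [|k IH]; rewrite ?e0 // -natr1 eD IH e1 mulr1. Qed.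

Lemma e_int (m : int) : e m%:~R = 1.
Proof.
case: m => k; first exact: e_nat.
by rewrite NegzE mulrNz eN e_nat conjc1.
Qed.

Lemma sin_le_abs a : `|sin a| <= `|a|.
Proof.
wlog a0 : a / 0 <= a.
  move=> h; have [/h//|/ltW a0] := leP 0 a.
  by rewrite -normrN -sinN -(normrN a); apply: h; rewrite oppr_ge0.
have [c _ h] := @MVT_segment R sin cos 0 a a0
  (fun x _ => is_derive_sin x) (continuous_subspaceT (@continuous_sin R)).
move: h; rewrite sin0 !subr0 => ->.
by rewrite normrM ler_piMl // cos_max.
Qed.

Lemma one_sub_cos a : 1 - cos a = 2 * sin (a / 2) ^+ 2.
Proof.
have h : cos a = cos (a / 2 + a / 2) by congr cos; lra.
by rewrite h cosD; have := cos2Dsin2 (a / 2); lra.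
Qed.

Lemma cos_abs a : `|cos a - 1| <= `|a|.
Proof.
rewrite distrC one_sub_cos ger0_norm; last by rewrite mulr_ge0 ?sqr_ge0.
have h := sin_le_abs (a / 2); have h1 := sin_max (a / 2).
rewrite -real_normK ?num_real //.
move: h; rewrite normrM (ger0_norm (_ : 0 <= 2^-1)) ?invr_ge0 //.
have := normr_ge0 (sin (a / 2)); nra.
Qed.

Lemma cos_sqr a : `|cos a - 1| <= a ^+ 2.
Proof.
rewrite distrC one_sub_cos ger0_norm; last by rewrite mulr_ge0 ?sqr_ge0.
have h := sin_le_abs (a / 2).
have : sin (a / 2) ^+ 2 <= (a / 2) ^+ 2 by rewrite -ler_sqrt ?sqr_ge0 // !sqrtr_sqr.
by have := sqr_ge0 a; nra.
Qed.

Lemma sin_taylor a : `|sin a - a| <= a ^+ 2.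
Proof.
wlog a0 : a / 0 <= a.
  move=> h; have [/h//|/ltW a0] := leP 0 a.
  by rewrite -normrN opprD opprK -sinN -sqrrN; have := h (- a); rewrite opprK; apply; rewrite oppr_ge0.
have hd (x : R) : x \in `]0, a[ -> is_derive x 1 (fun y => sin y - y) (cos x - 1).
  by move=> _; apply: is_deriveB.
have hc : {within `[0, a], continuous (fun y : R => sin y - y)}.
  apply: continuous_subspaceT => x; apply: continuousB; first exact: continuous_sin.
  exact: cvg_id.
have [c + h] := MVT_segment a0 hd hc.
rewrite in_itv /= => /andP[c0 ca].
move: h; rewrite sin0 !subr0 => ->.
rewrite normrM (ger0_norm a0) expr2 ler_wpM2r //.
by apply: le_trans (cos_abs c) _; rewrite ger0_norm.
Qed.

Lemma e_lip a : nrm (e a - 1) <= 2 * pi * `|a|.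
Proof.
have p0 := @pi_gt0 R.
have -> : 2 * pi * `|a| = `|2 * pi * a|.
  by rewrite !normrM (ger0_norm (ltW p0)) (ger0_norm (ler0n _ 2)).
set x := 2 * pi * a.
rewrite -(@ler_pXn2r _ 2) ?nnegrE ?nrm_ge0 //.
rewrite nrm_def sqr_sqrtr ?addr_ge0 ?sqr_ge0 //= -/x real_normK ?num_real // oppr0 addr0.
have -> : (cos x - 1) ^+ 2 + sin x ^+ 2 = 2 * (1 - cos x).
  have h := cos2Dsin2 x; have -> : sin x ^+ 2 = 1 - cos x ^+ 2 by lra.
  by ring.
rewrite one_sub_cos.
have : sin (x / 2) ^+ 2 <= (x / 2) ^+ 2 by rewrite -ler_sqrt ?sqr_ge0 // !sqrtr_sqr sin_le_abs.
nra.
Qed.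

Lemma e_lip2 a (b : R) : nrm (e a - e b) <= 2 * pi * `|a - b|.
Proof.
have -> : e a - e b = e b * (e (a - b) - 1).
  by rewrite mulrBr mulr1 -eD (addrC b) subrK.
by rewrite nrmM nrm_e mul1r e_lip.
Qed.

Lemma e_taylor a : nrm (e a - 1 - (0 +i* (2 * pi * a))%C) <= 2 * (2 * pi * a) ^+ 2.
Proof.
apply: le_trans (nrm_ReIm _) _ => /=.
by rewrite oppr0 !addr0; have := cos_sqr (2 * pi * a); have := sin_taylor (2 * pi * a); lra.
Qed.

(** Since [|e x - 1|^2 = 2 (1 - cos (2 pi x))] and the cosine decreases strictly on [[0, pi]], the
    left side controls the distance from [x] to the nearest integer. The cap 1/4 on the tolerance
    keeps [2 pi t] inside that interval. *)
Lemma e_near (tau : R) : 0 < tau ->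
  exists2 kap, 0 < kap & forall th, nrm (e th - 1) <= kap -> exists m : int, `|th - m%:~R| <= tau.
Proof.
move=> tau0; have p0 := @pi_gt0 R.
pose t := Num.min tau 4^-1.
have t0 : 0 < t by rewrite lt_min tau0 /= invr_gt0.
have th2 : t <= 4^-1 by rewrite ge_min lexx orbT.
pose k2 := 2 * (1 - cos (2 * pi * t)).
have nsq x : nrm (e x - 1) ^+ 2 = 2 * (1 - cos (2 * pi * x)).
  rewrite nrm_def sqr_sqrtr ?addr_ge0 ?sqr_ge0 //= oppr0 addr0.
  have h := cos2Dsin2 (2 * pi * x).
  have -> : sin (2 * pi * x) ^+ 2 = 1 - cos (2 * pi * x) ^+ 2 by lra.
  by ring.
have k20 : 0 < k2.
  have h1 : 0 < 2 * pi * t by rewrite !mulr_gt0.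
  have h2 : 2 * pi * t <= pi by nra.
  by rewrite /k2 mulr_gt0 // subr_gt0 -[ltRHS]cos0 ltr_cos ?in_itv /= ?lexx ?h2 ?(ltW h1) ?(ltW p0).
(* [sqrt k2] is [|e t - 1|]; halving it makes the later comparison with [k2] strict. *)
exists (Num.sqrt k2 / 2); first by rewrite divr_gt0 // sqrtr_gt0.
move=> th hth; exists (Num.floor (th + 2^-1)).
set m := Num.floor _; set x := th - _.
have hx : `|x| <= 2^-1.
  have := floor_itv (th + 2^-1); rewrite -/m intrD rmorph1 => /andP[h1 h2].
  by rewrite ler_norml /x; apply/andP; split; lra.
rewrite leNgt; apply/negP => htx.
have htx' : t < `|x| by rewrite gt_min htx.
have : nrm (e `|x| - 1) ^+ 2 < k2.
  have -> : nrm (e `|x| - 1) = nrm (e th - 1).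
    have -> : th = x + m%:~R by rewrite /x subrK.
    rewrite eD e_int mulr1; case: (ger0P x) => // _.
    have -> : e (- x) - 1 = ((e x - 1)^*)%C 
      by rewrite eN; case: (e x) => p q; apply/eqP; rewrite eq_complex /= !oppr0 !addr0 !eqxx.
    by rewrite nrmJ.
  have : nrm (e th - 1) ^+ 2 <= (Num.sqrt k2 / 2) ^+ 2.
    by rewrite ler_pXn2r // nnegrE ?nrm_ge0 // divr_ge0 ?sqrtr_ge0.
  rewrite exprMn (sqr_sqrtr (ltW k20)) => h; apply: le_lt_trans h _.
  by rewrite expr2; lra.
rewrite nsq /k2 => h.
have : cos (2 * pi * t) < cos (2 * pi * `|x|) by lra.
have h1 : 2 * pi * t < 2 * pi * `|x| by rewrite ltr_pM2l // mulr_gt0.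
have h2 : 2 * pi * `|x| <= pi by nra.
have h3 : 0 < 2 * pi * t by rewrite !mulr_gt0.
rewrite ltr_cos ?in_itv /= ?(ltW h3) ?(le_trans (ltW h1) h2) ?(ltW (lt_trans h3 h1)) //.
by rewrite ltNge ltW.
Qed.


(** * Van der Corput differencing *)

Implicit Types (N H L D : nat) (Z W : nat -> R[i]).

(** Each unit shift drops one term and gains one, both of modulus at most 1. *)
Lemma nrm_sum_shift N Z h : (forall n, nrm (Z n) <= 1) ->
  nrm (\sum_(n < N) Z (n + h)%N - \sum_(n < N) Z n) <= 2 * h%:R.
Proof.
move=> hZ; elim: h => [|h IH].
  under eq_bigr do rewrite addn0.
  by rewrite subrr nrm0 mulr0.
have -> : \sum_(n < N) Z (n + h.+1)%N - \sum_(n < N) Z n =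
    (Z (N + h)%N - Z h) + (\sum_(n < N) Z (n + h)%N - \sum_(n < N) Z n).
  rewrite addrA; congr (_ - _).
  have := @telescope_sumr _ 0 N (fun n => Z (n + h)%N) (leq0n _).
  rewrite big_mkord sumrB add0n => <-.
  by rewrite subrK; apply: eq_bigr => i _; rewrite addSnnS.
apply: le_trans (nrmD _ _) _; rewrite -natr1.
have := nrmB (Z (N + h)%N) (Z h); have := hZ (N + h)%N; have := hZ h; lra.
Qed.

(** Averaging over [H] shifts turns the sum into a sum of window sums [w m], whose squares expand
    into correlations at lags below [H]. In place of Cauchy-Schwarz, [x <= x^2 / (2 c) + c / 2] with
    [c = delta * H] keeps the bound free of square roots. *)
Lemma vdc_ineq N H Z (K delta : R) : (0 < H)%N -> (forall n, nrm (Z n) <= 1) -> 0 < delta ->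
  (forall h, (0 < h < H)%N -> nrm (\sum_(n < N) Z (n + h)%N * ((Z n)^*)%C) <= K) -> 0 <= K ->
  nrm (\sum_(n < N) Z n) <=
    2 * H%:R + (N%:R + H%:R * (K + 2 * H%:R)) / (2 * (delta * H%:R)) + N%:R * delta / 2.
Proof.
move=> H0 hZ d0 hK K0.
have HR : 0 < H%:R :> R by rewrite ltr0n.
pose w m := \sum_(h < H) Z (m + h)%N.
have hT : H%:R * nrm (\sum_(n < N) Z n) <= nrm (\sum_(m < N) w m) + H%:R * (2 * H%:R).
  have -> : H%:R * nrm (\sum_(n < N) Z n) = nrm (\sum_(h < H) \sum_(n < N) Z n).
    rewrite sumr_const card_ord -[in RHS]mulr_natl nrmM; congr (_ * _).
    by rewrite -(rmorph_nat (real_complex R)) nrmC ger0_norm.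
  have hw : \sum_(m < N) w m = \sum_(h < H) \sum_(n < N) Z (n + h)%N by rewrite exchange_big.
  rewrite hw addrC.
  apply: le_trans (nrm_triB _ (\sum_(h < H) \sum_(n < N) Z (n + h)%N)) _.
  rewrite lerD2r -sumrB.
  apply: (@nrm_sum_le H (fun h => \sum_(n < N) Z n - \sum_(n < N) Z (n + h)%N)) => h hH.
  rewrite nrmBC; apply: le_trans (nrm_sum_shift _ _ hZ) _.
  by rewrite ler_wpM2l // ler_nat ltnW.
have hsq : \sum_(m < N) nrm (w m) ^+ 2 <= H%:R * N%:R + H%:R * (H%:R * (K + 2 * H%:R)).
  have -> : \sum_(m < N) nrm (w m) ^+ 2 =
      nrm (\sum_(h < H) \sum_(h' < H) \sum_(m < N) Z (m + h)%N * ((Z (m + h')%N)^*)%C).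
    have -> : \sum_(h < H) \sum_(h' < H) \sum_(m < N) Z (m + h)%N * ((Z (m + h')%N)^*)%C
        = \sum_(m < N) w m * ((w m)^*)%C.
      under eq_bigr do rewrite exchange_big /=.
      rewrite exchange_big /=; apply: eq_bigr => m _.
      rewrite /w rmorph_sum mulr_suml; apply: eq_bigr => h _.
      by rewrite mulr_sumr.
    under eq_bigr do rewrite -/(nrm _ ^+ 2).
    under [in RHS]eq_bigr do rewrite mulJ_nrm.
    by rewrite -rmorph_sum nrmC ger0_norm // sumr_ge0 // => m _; rewrite sqr_ge0.
  (* A diagonal pair costs [N]; any other pair is the correlation at lag [|h - h'|] translated by
     less than [H], hence the extra [2 * H]. *)
  have hb h h' : (h < H)%N -> (h' < H)%N ->
     nrm (\sum_(m < N) Z (m + h)%N * ((Z (m + h')%N)^*)%C) <= (if h == h' then N%:R else 0) + (K + 2 * H%:R).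
    move=> hH hH'; have hf d n : nrm (Z (n + d)%N * ((Z n)^*)%C) <= 1.
      by rewrite nrmM nrmJ mulr_ile1 ?nrm_ge0.
    have K2 : 0 <= K + 2 * H%:R by rewrite addr_ge0 // mulr_ge0.
    have hlt i j : (i < j)%N -> (j < H)%N ->
        nrm (\sum_(m < N) Z (m + j)%N * ((Z (m + i)%N)^*)%C) <= K + 2 * H%:R.
      move=> ab bH; have := @nrm_sum_shift N _ i (hf (j - i)%N).
      under [in X in X - _]eq_bigr do rewrite -addnA subnKC ?(ltnW ab) //.
      have := hK (j - i)%N; rewrite subn_gt0 ab /= => /(_ (leq_ltn_trans (leq_subr _ _) bH)).
      have : i%:R <= H%:R :> R by rewrite ler_nat (leq_trans (ltnW ab) (ltnW bH)).
      set A := \sum_(m < N) _; set B := \sum_(m < N) _.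
      by have := nrm_triB B A; lra.
    case: (ltngtP h h') => [l|l|<-].
    - rewrite add0r -nrmJ rmorph_sum; apply: le_trans (hlt _ _ l hH').
      rewrite le_eqVlt; apply/orP; left; apply/eqP; congr nrm; apply: eq_bigr => m _.
      by rewrite rmorphM /= conjcK mulrC.
    - by rewrite add0r hlt.
    - apply: le_trans (_ : N%:R * 1 <= _); last by rewrite mulr1; lra.
      apply: (@nrm_sum_le N (fun m => Z (m + h)%N * ((Z (m + h)%N)^*)%C)) => n _.
      by rewrite nrmM nrmJ mulr_ile1 ?nrm_ge0.
  apply: le_trans (nrm_sum _ _ _) _.
  apply: le_trans (_ : \sum_(h < H) (N%:R + H%:R * (K + 2 * H%:R)) <= _); last first.
    by rewrite sumr_const card_ord -(mulr_natl (_ + _)) mulrDr.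
  apply: ler_sum => h _; apply: le_trans (nrm_sum _ _ _) _.
  apply: le_trans (ler_sum _ (fun (h' : 'I_H) _ => hb h h' (ltn_ord h) (ltn_ord h'))) _.
  rewrite big_split /= [X in _ + X <= _]sumr_const card_ord -[X in _ + X <= _]mulr_natl lerD2r.
  rewrite (bigD1 h) //= eqxx big1 ?addr0 // => i ih.
  by rewrite eq_sym (inj_eq val_inj) (negbTE ih).
have hc : 0 < delta * H%:R by rewrite mulr_gt0.
have hw : nrm (\sum_(m < N) w m) <= (\sum_(m < N) nrm (w m) ^+ 2) / (2 * (delta * H%:R)) + N%:R * (delta * H%:R / 2).
  apply: le_trans (nrm_sum _ _ _) _.
  have -> : N%:R * (delta * H%:R / 2) = \sum_(m < N) (delta * H%:R / 2).
    by rewrite sumr_const card_ord mulr_natl.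
  rewrite mulr_suml -big_split; apply: ler_sum => m _ /=.
  set c := delta * H%:R in hc *; set x := nrm _.
  have -> : x ^+ 2 / (2 * c) + c / 2 = x + (x - c) ^+ 2 / (2 * c).
    by field; rewrite lt0r_neq0.
  by rewrite lerDl divr_ge0 ?sqr_ge0 // mulr_ge0 // ltW.
rewrite -(ler_pM2l HR).
apply: le_trans hT _; apply: le_trans (lerD hw (lexx _)) _.
have : (\sum_(m < N) nrm (w m) ^+ 2) / (2 * (delta * H%:R)) <=
   (H%:R * N%:R + H%:R * (H%:R * (K + 2 * H%:R))) / (2 * (delta * H%:R)).
  by rewrite ler_wpM2r // invr_ge0 mulr_ge0 // ltW.
set T := _ / _; set A := (_ + _) / _; move=> hTA.
rewrite (mulrDr H%:R (_ + _)) (mulrDr H%:R (2 * H%:R)).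
have -> : H%:R * ((N%:R + H%:R * (K + 2 * H%:R)) / (2 * (delta * H%:R))) = A.
  by rewrite /A mulrA mulrDr.
have -> : N%:R * (delta * H%:R / 2) = H%:R * (N%:R * delta / 2) by ring.
lra.
Qed.

(** Take [delta = eps / 2] and [K = eps^2 / 8 * N] in [vdc_ineq]. With [H > 8 / eps^2] the terms
    linear in [N] are at most [eps / 8], [eps / 8] and [eps / 4] times [N]; the rest is [B], below
    [eps / 8 * N] once [N >= L]. The total is less than [eps * N]. *)
Lemma vdc_step (eps : R) : 0 < eps ->
  exists H, exists2 eps2, 0 < eps2 & exists L, forall N Z, (L <= N)%N ->
    (forall n, nrm (Z n) <= 1) -> eps * N%:R <= nrm (\sum_(n < N) Z n) ->
    exists2 h, (0 < h <= H)%N & eps2 * N%:R <= nrm (\sum_(n < N) Z (n + h)%N * ((Z n)^*)%C).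
Proof.
move=> e0.
pose H := (Num.truncn (8 / eps ^+ 2)).+1.
have hH : 8 / eps ^+ 2 < H%:R by rewrite truncnS_gt.
have HR : 0 < H%:R :> R by rewrite ltr0n.
pose B := 2 * H%:R + H%:R * (2 * H%:R) / (eps * H%:R).
pose L := (Num.truncn (8 * B / eps)).+1.
have hL : 8 * B / eps < L%:R by rewrite truncnS_gt.
exists H, (eps ^+ 2 / 8); first by rewrite divr_gt0 ?exprn_gt0.
exists L => N Z LN hZ hS; apply: contrapT => hn.
have N0 : 0 < N%:R :> R by rewrite ltr0n (leq_trans _ LN).
have hK h : (0 < h < H)%N -> nrm (\sum_(n < N) Z (n + h)%N * ((Z n)^*)%C) <= eps ^+ 2 / 8 * N%:R.
  move=> /andP[h0 hh]; rewrite leNgt; apply/negP => hc; apply: hn; exists h; last exact: ltW.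
  by rewrite h0 ltnW.
have K0 : 0 <= eps ^+ 2 / 8 * N%:R by rewrite mulr_ge0 // divr_ge0 // exprn_ge0 // ltW.
have := @vdc_ineq N H Z _ (eps / 2) (ltn0Sn _) hZ (divr_gt0 e0 (ltr0n _ 2)) hK K0.
have -> : 2 * (eps / 2 * H%:R) = eps * H%:R by field.
have -> : (N%:R + H%:R * (eps ^+ 2 / 8 * N%:R + 2 * H%:R)) / (eps * H%:R) =
    N%:R / (eps * H%:R) + eps / 8 * N%:R + H%:R * (2 * H%:R) / (eps * H%:R).
  by field; rewrite !lt0r_neq0.
have h1 : N%:R / (eps * H%:R) <= eps / 8 * N%:R.
  rewrite ler_pdivrMr ?mulr_gt0 //.
  have : 8 / eps ^+ 2 * eps ^+ 2 <= H%:R * eps ^+ 2 by rewrite ler_wpM2r ?sqr_ge0 // ltW.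
  by rewrite mulfVK ?lt0r_neq0 ?exprn_gt0 //; nra.
have h2 : B < eps * N%:R / 8.
  have : L%:R <= N%:R :> R by rewrite ler_nat.
  move=> /(lt_le_trans hL); rewrite ltr_pdivrMr // => h; lra.
move: h2; rewrite /B; have := mulr_gt0 e0 N0.
set u := _ / (_ * _) in h1 *; set v := _ / (_ * _).
lra.
Qed.

Implicit Types (u v b : nat -> R).

Definition dif u n : R := u n.+1 - u n.
Definition difh h u n : R := u (n + h)%N - u n.
Definition difhs (hs : seq nat) u : nat -> R := foldr difh u hs.

(** [H], [eps2] and [L] are chosen before the phase [u], which is the source of all later uniformity
    in the frequency. *)
Lemma vdc_iter j (eps : R) : 0 < eps ->
  exists H, exists2 eps2, 0 < eps2 & exists L, forall N (u : nat -> R), (L <= N)%N ->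
    eps * N%:R <= nrm (\sum_(n < N) e (u n : R)) ->
    exists hs, [/\ size hs = j, all (fun h => 0 < h <= H)%N hs &
      eps2 * N%:R <= nrm (\sum_(n < N) e (difhs hs u n))].
Proof.
elim: j eps => [|j IH] eps e0.
  by exists 0%N, eps => //; exists 0%N => N u _ h; exists [::].
have ge1 a : nrm (e a) <= 1 by rewrite nrm_e.
have [H1 [eps1 e1 [L1 h1]]] := IH _ e0.
have [H2 [eps2 e2 [L2 h2]]] := vdc_step e1.
exists (maxn H1 H2), eps2 => //; exists (maxn L1 L2) => N u; rewrite geq_max => /andP[l1 l2] hs.
have [s [hs1 hs2 hs3]] := h1 N u l1 hs.
have [h /andP[hh1 hh2] hh] := h2 N (fun n => e (difhs s u n)) l2 (fun n => ge1 _) hs3.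
exists (h :: s); split; first by rewrite /= hs1.
- rewrite /= hh1 /= leq_max hh2 orbT /=; apply: sub_all hs2 => x /andP[-> x2] /=.
  by rewrite leq_max x2.
- apply: le_trans hh _; rewrite le_eqVlt; apply/orP; left; apply/eqP; congr nrm.
  by apply: eq_bigr => i _; rewrite /= /difh eB.
Qed.

Lemma difh_sum h u n : difh h u n = \sum_(t < h) dif u (n + t)%N.
Proof.
have := @telescope_sumr _ 0 h (fun t => u (n + t)%N) (leq0n _).
rewrite big_mkord addn0 /difh => <-.
by apply: eq_bigr => t _; rewrite /dif addnS.
Qed.

Lemma iter_dif_difh i h u : iter i dif (difh h u) = difh h (iter i dif u).
Proof.
elim: i => //= i ->; apply/funext => n; rewrite /dif /difh addSn; ring.
Qed.

(** A difference of step [h] is a sum of [h] translated unit differences ([difh_sum]), so the bound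
    is multiplied by the product of the steps, while the translates reach [sumn hs] further to the
    right. *)
Lemma difhs_ge hs i u N (A : R) :
  (forall n, (n < N)%N -> A <= iter (i + size hs) dif u n) ->
  forall n, (n + sumn hs < N)%N -> (\prod_(h <- hs) h)%N%:R * A <= iter i dif (difhs hs u) n.
Proof.
elim: hs i => [|h hs IH] i /=.
  by move=> hA n; rewrite addn0 big_nil mul1r => /hA; rewrite addn0.
rewrite addnS -addSn => /IH{}IH n hn; rewrite iter_dif_difh difh_sum big_cons natrM -mulrA.
have -> : h%:R * ((\prod_(h0 <- hs) h0)%N%:R * A) = \sum_(t < h) ((\prod_(h0 <- hs) h0)%N%:R * A).
  by rewrite sumr_const card_ord mulr_natl.
apply: ler_sum => t _; apply: (IH (n + t)%N).
by apply: leq_ltn_trans hn; rewrite -addnA leq_add2l leq_add2r ltnW.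
Qed.

Lemma difhsN hs u : difhs hs (fun n => - u n) = (fun n => - difhs hs u n).
Proof. by elim: hs => //= h hs ->; apply/funext => n; rewrite /difh opprD. Qed.

Lemma iter_difN i u : iter i dif (fun n => - u n) = (fun n => - iter i dif u n).
Proof. by elim: i => //= i ->; apply/funext => n; rewrite /dif opprD. Qed.

Lemma difhs_le hs i u N (A : R) :
  (forall n, (n < N)%N -> iter (i + size hs) dif u n <= A) ->
  forall n, (n + sumn hs < N)%N -> iter i dif (difhs hs u) n <= (\prod_(h <- hs) h)%N%:R * A.
Proof.
move=> hA n hn; have : (\prod_(h <- hs) h)%N%:R * - A <= iter i dif (difhs hs (fun k => - u k)) n.
  apply: (@difhs_ge hs i (fun k => - u k) N) => // m hm.
  by rewrite iter_difN lerN2 hA.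
by rewrite difhsN iter_difN mulrN lerN2.
Qed.

(** * Elementary estimates and pigeonhole for exponential sums *)

Lemma abel_sum N (w : nat -> R) Z (K B : R) : 0 <= B ->
  (forall n, (n < N)%N -> 0 <= w n <= K) -> (forall n, (n <= N)%N -> nrm (Z n) <= B) ->
  ((forall n, (n.+1 < N)%N -> w n <= w n.+1) \/ (forall n, (n.+1 < N)%N -> w n.+1 <= w n)) ->
  0 <= K -> nrm (\sum_(n < N) ((w n)%:C)%C * (Z n.+1 - Z n)) <= 2 * K * B.
Proof.
case: N => [|N] B0 hw hZ hm K0; first by rewrite big_ord0 nrm0 !mulr_ge0.
(* Summation by parts with the last boundary term moved to the left. For monotone weights the total
   variation is [|w N - w 0|], and [w 0 + |w N - w 0| + w N] is at most [2 * K]. *)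
suff h : nrm (\sum_(n < N.+1) ((w n)%:C)%C * (Z n.+1 - Z n) - ((w N)%:C)%C * Z N.+1) <= B * (w 0%N + `|w N - w 0%N|).
  have := nrm_triB (\sum_(n < N.+1) ((w n)%:C)%C * (Z n.+1 - Z n)) (((w N)%:C)%C * Z N.+1).
  rewrite nrmM nrmC.
  have /andP[a1 a2] := hw 0%N isT; have /andP[b1 b2] := hw N (leqnn _).
  have zN := hZ N.+1 (leqnn _); rewrite (ger0_norm b1) => h2.
  have h3 : w 0%N + `|w N - w 0%N| + w N <= 2 * K by case: (ger0P (w N - w 0%N)) => _; lra.
  have h4 : w N * nrm (Z N.+1) <= B * w N by rewrite mulrC ler_wpM2r.
  have h5 : B * (w 0%N + `|w N - w 0%N| + w N) <= B * (2 * K) by rewrite ler_wpM2l.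
  rewrite mulrC; apply: le_trans h2 _; apply: le_trans (lerD h h4) _.
  by rewrite -mulrDr.
have : (N < N.+1)%N by [].
move: {-2}N => n; elim: n => [|n IH] nN.
  rewrite big_ord_recl big_ord0 addr0 mulrBr addrC addKr nrmN nrmM nrmC subrr normr0 addr0.
  have /andP[a1 _] := hw 0%N isT; rewrite ger0_norm // mulrC ler_wpM2r //; exact: hZ.
rewrite big_ord_recr /=.
have -> : \sum_(i < n.+1) ((w i)%:C)%C * (Z i.+1 - Z i) + ((w n.+1)%:C)%C * (Z n.+2 - Z n.+1) - ((w n.+1)%:C)%C * Z n.+2
  = (\sum_(i < n.+1) ((w i)%:C)%C * (Z i.+1 - Z i) - ((w n)%:C)%C * Z n.+1) + ((w n - w n.+1)%:C)%C * Z n.+1.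
  by rewrite rmorphB /=; ring.
apply: le_trans (nrmD _ _) _; apply: le_trans (lerD (IH (ltnW nN)) (lexx _)) _.
rewrite nrmM nrmC; have zn := hZ n.+1 (ltnW nN).
have : `|w n - w n.+1| * nrm (Z n.+1) <= B * `|w n - w n.+1| by rewrite mulrC ler_wpM2r.
suff : `|w n - w 0%N| + `|w n - w n.+1| <= `|w n.+1 - w 0%N| by nra.
case: hm => hm.
  have : w 0%N <= w n.
    elim: n nN {IH zn} => // n IH nN; apply: le_trans (IH (ltnW nN)) (hm _ (ltnW nN)).
  have := hm n nN => a1 a2; rewrite (ger0_norm (_ : 0 <= w n - w 0%N)) ?subr_ge0 //.
  rewrite ler0_norm ?subr_le0 // ger0_norm ?subr_ge0 ?(le_trans a2) //; lra.
have : w n <= w 0%N.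
  elim: n nN {IH zn} => // n IH nN; apply: le_trans (hm _ (ltnW nN)) (IH (ltnW nN)).
have := hm n nN => a1 a2; rewrite (ler0_norm (_ : w n - w 0%N <= 0)) ?subr_le0 //.
rewrite ger0_norm ?subr_ge0 // ler0_norm ?subr_le0 ?(le_trans a1) //; lra.
Qed.

(* Up to the error in Taylor's formula, [e (b n)] is the increment of [e \o b] divided by [2 i pi dif b n]. *)
Lemma slow_sum N (b : nat -> R) (d0 eta : R) : 0 < d0 ->
  (forall n, (n < N)%N -> d0 <= dif b n <= eta) ->
  ((forall n, (n < N)%N -> 0 <= dif (dif b) n) \/ (forall n, (n < N)%N -> dif (dif b) n <= 0)) ->
  nrm (\sum_(n < N) e (b n)) <= 2 / d0 + 4 * pi * eta * N%:R.
Proof.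
move=> d00 hd hm; have p0 := @pi_gt0 R; have p2 := @pi_ge2 R.
pose w n := (dif b n)^-1.
have h1 : nrm (\sum_(n < N) ((w n)%:C)%C * (e (b n.+1) - e (b n))) <= 2 * d0^-1 * 1.
  apply: (@abel_sum N w (fun n => e (b n)) d0^-1 1) => //.
  - move=> n /hd /andP[h _]; rewrite /w invr_ge0 (le_trans (ltW d00) h) /=.
    by rewrite lef_pV2 // posrE ?(lt_le_trans d00 h).
  - by move=> n _; rewrite nrm_e.
  - case: hm => hm; [right|left] => n nN; have /andP[a _] := hd _ nN;
      have /andP[a' _] := hd _ (ltnW nN); rewrite /w lef_pV2 ?posrE ?(lt_le_trans d00) //;
      have := hm _ (ltnW nN); rewrite {1}/dif; lra.
  - by rewrite invr_ge0 ltW.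
have h2 : nrm (\sum_(n < N) ((0 +i* (2 * pi))%C * e (b n) - ((w n)%:C)%C * (e (b n.+1) - e (b n)))) <= N%:R * (8 * pi ^+ 2 * eta).
  apply: (@nrm_sum_le N (fun n => (0 +i* (2 * pi))%C * e (b n) - ((w n)%:C)%C * (e (b n.+1) - e (b n)))) => n nN.
  have /andP[a1 a2] := hd n nN.
  set d := dif b n in a1 a2 *.
  have dp : 0 < d := lt_le_trans d00 a1.
  have -> : (0 +i* (2 * pi))%C * e (b n) - ((w n)%:C)%C * (e (b n.+1) - e (b n)) =
      - (((w n)%:C)%C * e (b n) * (e d - 1 - (0 +i* (2 * pi * d))%C)).
    have -> : e (b n.+1) = e (b n) * e d by rewrite -eD /d /dif addrC subrK.
    have -> : (0 +i* (2 * pi * d))%C = (d%:C)%C * (0 +i* (2 * pi))%C.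
      by apply/eqP; rewrite eq_complex /=; apply/andP; split; apply/eqP; ring.
    have hwd : ((w n)%:C)%C * (d%:C)%C = 1 by rewrite -rmorphM /= /w mulVf ?lt0r_neq0.
    have -> : ((w n)%:C)%C * e (b n) * (e d - 1 - (d%:C)%C * (0 +i* (2 * pi))%C)
     = ((w n)%:C)%C * e (b n) * (e d - 1) - ((w n)%:C)%C * (d%:C)%C * (e (b n) * (0 +i* (2 * pi))%C) by ring.
    by rewrite hwd; ring.
  rewrite nrmN !nrmM nrm_e nrmC mulr1 /w gtr0_norm ?invr_gt0 // mulrC ler_pdivrMr //.
  apply: le_trans (e_taylor d) _; rewrite !exprMn.
  have -> : 2 * (2 ^+ 2 * pi ^+ 2 * d ^+ 2) = 8 * pi ^+ 2 * d * d by ring.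
  by rewrite ler_wpM2r ?(ltW dp) // ler_wpM2l // mulr_ge0 // sqr_ge0.
have h3 : 2 * pi * nrm (\sum_(n < N) e (b n)) <= N%:R * (8 * pi ^+ 2 * eta) + 2 * d0^-1.
  have -> : 2 * pi * nrm (\sum_(n < N) e (b n)) = nrm (\sum_(n < N) (0 +i* (2 * pi))%C * e (b n)).
    rewrite -mulr_sumr nrmM; congr (_ * _).
    by rewrite nrm_def /= expr0n /= add0r sqrtr_sqr ger0_norm // mulr_ge0 // ltW.
  move: h1 h2; rewrite mulr1 sumrB => h1 h2.
  by apply: le_trans (nrm_triB _ _) _; apply: lerD h2 h1.
rewrite -(ler_pM2l (_ : 0 < 2 * pi)) ?mulr_gt0 //; apply: le_trans h3 _.
have : 0 < d0^-1 by rewrite invr_gt0.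
set x := d0^-1; nra.
Qed.

(** As [e (b n.+1)] is close to [e (b n + th)], multiplying by [e th - 1] makes the sum telescope up
    to [2 pi kap] per term. A large sum thus forces [e th] close to 1. *)
Lemma near_const_sum N (b : nat -> R) th (kap : R) :
  (forall n, (n < N)%N -> `|dif b n - th| <= kap) ->
  nrm (\sum_(n < N) e (b n)) * nrm (e th - 1) <= 2 + 2 * pi * kap * N%:R.
Proof.
move=> h; rewrite -nrmM mulr_suml.
have -> : \sum_(n < N) e (b n) * (e th - 1) =
   (e (b N) - e (b 0%N)) - \sum_(n < N) (e (b n.+1) - e (b n + th)).
  have := @telescope_sumr _ 0 N (fun t => e (b t)) (leq0n _).
  rewrite big_mkord => <-; rewrite -sumrB; apply: eq_bigr => n _.
  rewrite eD; ring.
apply: le_trans (nrmB _ _) (lerD _ _).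
  by apply: le_trans (nrmB _ _) _; rewrite !nrm_e.
rewrite mulrC; apply: (@nrm_sum_le N (fun n => e (b n.+1) - e (b n + th))) => n hn.
apply: le_trans (e_lip2 _ _) _.
rewrite ler_wpM2l ?mulr_ge0 ?(ltW (pi_gt0 R)) //.
by have := h n hn; rewrite /dif opprD addrA.
Qed.

Lemma sum_block (F : nat -> R[i]) q k :
  \sum_(n < q * k) F n = \sum_(c < q) \sum_(j < k) F (c * k + j)%N.
Proof.
elim: q => [|q IH]; first by rewrite !big_ord0.
by rewrite mulSnr big_split_ord /= IH big_ord_recr.
Qed.

(** Pigeonhole: [[0, N)] is cut into blocks of length [l * D], each made of [D] progressions of step
    [D] and length [l]. The remainder is shorter than [D * l] and takes less than half of the
    sum. *)
Lemma large_subsum N D l Z (eps : R) : (0 < D)%N -> (0 < l)%N -> (forall n, nrm (Z n) <= 1) ->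
  0 < eps -> (0 < N)%N ->
  eps * N%:R <= nrm (\sum_(n < N) Z n) -> (D * l)%:R <= eps / 2 * N%:R ->
  exists2 r, (forall m, (m < l)%N -> (r + D * m < N)%N) &
     eps / 2 * l%:R <= nrm (\sum_(m < l) Z (r + D * m)%N).
Proof.
move=> D0 l0 hZ e0 N0 hS hl; apply: contrapT => hn.
pose q := (N %/ (l * D))%N.
have hN := divn_eq N (l * D)%N; rewrite -/q in hN.
have hr : (N %% (l * D) < l * D)%N by rewrite ltn_mod muln_gt0 l0.
have hb c s : (c < q)%N -> (s < D)%N ->
    nrm (\sum_(m < l) Z (c * (l * D) + s + D * m)%N) <= eps / 2 * l%:R.
  move=> cq sD; rewrite leNgt; apply/negP => hc; apply: hn.
  exists (c * (l * D) + s)%N; last exact: ltW.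
  move=> m ml.
  have h1 : ((c.+1) * (l * D) <= q * (l * D))%N by rewrite leq_mul2r cq orbT.
  have h2 : ((m.+1) * D <= l * D)%N by rewrite leq_mul2r ml orbT.
  move: h1 h2; rewrite !mulSn => h1 h2.
  have h3 : (q * (l * D) <= N)%N by rewrite leq_divM.
  by apply: leq_trans h3; apply: leq_trans h1; rewrite (mulnC D m); lia.
have : nrm (\sum_(n < N) Z n) < eps * N%:R.
  rewrite hN big_split_ord /= sum_block.
  apply: le_lt_trans (nrmD _ _) _.
  have h1 : nrm (\sum_(c < q) \sum_(j < l * D) Z (c * (l * D) + j)%N) <= q%:R * (D%:R * (eps / 2 * l%:R)).
    apply: (@nrm_sum_le _ (fun c => \sum_(j < l * D) Z (c * (l * D) + j)%N)) => c cq.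
    rewrite (sum_block (fun j => Z (c * (l * D) + j)%N)) exchange_big /=.
    apply: (@nrm_sum_le _ (fun s => \sum_(i < l) Z (c * (l * D) + (i * D + s))%N)) => s sD.
    apply: le_trans (hb c s cq sD); rewrite le_eqVlt; apply/orP; left; apply/eqP; congr nrm.
    by apply: eq_bigr => i _; congr Z; rewrite (mulnC D) -addnA (addnC s).
  have h2 : nrm (\sum_(i < N %% (l * D)) Z (q * (l * D) + i)%N) <= (N %% (l * D))%:R * 1.
    exact: (@nrm_sum_le _ (fun i => Z (q * (l * D) + i)%N)).
  have h3 : (N %% (l * D))%:R < eps / 2 * N%:R.
    by apply: lt_le_trans hl; rewrite ltr_nat mulnC (mulnC D).
  rewrite -hN.
  have h4 : q%:R * (D%:R * (eps / 2 * l%:R)) <= eps / 2 * N%:R.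
    have -> : q%:R * (D%:R * (eps / 2 * l%:R)) = eps / 2 * (q * (l * D))%N%:R by rewrite !natrM; ring.
    by rewrite ler_pM2l ?divr_gt0 // ler_nat leq_divM.
  by rewrite mulr1 in h2; lra.
by rewrite ltNge hS.
Qed.

End Exponential.

Arguments nrm : simpl never.
Arguments e : simpl never.

(** * The inverse Weyl theorem: slow phases and their differences *)

Section Inverse.
Variable R : realType.
Implicit Types (u v w : nat -> R) (N D r j k : nat).

(** Applied to level sets of monotone differences, it locates the point where the level is
    crossed. *)
Lemma prefix_split (P : pred nat) N : (forall n, (n.+1 < N)%N -> P n.+1 -> P n) ->
  exists a, [/\ (a <= N)%N, forall n, (n < a)%N -> P n & forall n, (a <= n < N)%N -> ~~ P n].
Proof.
elim: N => [|N IH] hP.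
  by exists 0%N; split => // n; rewrite ltn0 andbF.
have [a [aN h1 h2]] := IH (fun n hn => hP n (leq_trans hn (leqnSn N))).
have [pN|pN] := boolP (P N).
  have aN' : a = N.
    apply/eqP; rewrite eqn_leq aN leqNgt; apply/negP => aN'.
    case: N {IH} hP aN h2 pN aN' => // N hP aN h2 pN aN'.
    have /negP[] : ~~ P N by apply: h2; rewrite -ltnS aN' ltnSn.
    exact: hP.
  exists N.+1; split => // n.
    by rewrite ltnS leq_eqVlt => /orP[/eqP->//|nN]; apply: h1; rewrite aN'.
  by rewrite ltnS => /andP[a1]; rewrite leqNgt a1.
exists a; split => //; first exact: leqW.
move=> n /andP[an]; rewrite ltnS leq_eqVlt => /orP[/eqP->//|nN]; apply: h2; by rewrite an.
Qed.

Lemma iter_dif_shift k u r n : iter k (@dif R) (fun i => u (r + i)%N) n = iter k (@dif R) u (r + n)%N.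
Proof. by elim: k n => //= k IH n; rewrite /dif !IH addnS. Qed.

Lemma sumn_bound (s : seq nat) H : all (fun h => 0 < h <= H)%N s -> (sumn s <= size s * H)%N.
Proof. by elim: s => //= h s IH /andP[/andP[_ h1] /IH h2]; rewrite mulSn leq_add. Qed.

Lemma prod_bound (s : seq nat) H : all (fun h => 0 < h <= H)%N s ->
  (0 < \prod_(h <- s) h <= H ^ size s)%N.
Proof.
elim: s => [|h s IH] /=; first by rewrite big_nil.
by move=> /andP[/andP[h0 h1] /IH /andP[p0 p1]]; rewrite big_cons muln_gt0 h0 p0 expnS leq_mul.
Qed.

(** A unit difference along a progression of step [D] is a difference of step [D], so this is
    [difhs_ge] with all steps equal to [D]. *)
Lemma iter_dif_ap k D s v t N (A : R) :
  (forall n, (n < N)%N -> A <= iter k (@dif R) v n) -> (s + D * (t + k) < N)%N ->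
  (D ^ k)%N%:R * A <= iter k (@dif R) (fun t => v (s + D * t)%N) t.
Proof.
move=> hA ht.
have -> : iter k (@dif R) (fun t => v (s + D * t)%N) t = difhs (nseq k D) v (s + D * t)%N.
  elim: k t {hA ht} => //= k IH t.
  by rewrite /dif /difh !IH mulnS (addnC D) addnA.
have := @difhs_ge R (nseq k D) 0 v N A; rewrite size_nseq /= => /(_ hA (s + D * t)%N).
rewrite big_nseq iter_muln muln1; apply.
by rewrite sumn_nseq -addnA -mulnDr.
Qed.

Lemma iter_dif_ap_le k D s v t N (A : R) :
  (forall n, (n < N)%N -> iter k (@dif R) v n <= A) -> (s + D * (t + k) < N)%N ->
  iter k (@dif R) (fun t => v (s + D * t)%N) t <= (D ^ k)%N%:R * A.
Proof.
move=> hA ht; have : (D ^ k)%N%:R * - A <= iter k (@dif R) (fun t => - v (s + D * t)%N) t.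
  apply: (@iter_dif_ap k D s (fun i => - v i) t N) => // n hn.
  by rewrite iter_difN lerN2 hA.
by rewrite iter_difN mulrN lerN2.
Qed.

(** Monotonicity of the difference of order [j.+1] makes its level sets intervals and, after [j]
    differencings, provides the monotone increments that [slow_sum] requires. *)
Definition slowp j (eta : R) N u :=
  (forall n, (n < N)%N -> 0 <= iter j.+1 (@dif R) u n <= eta) /\
  ((forall n, (n < N)%N -> 0 <= iter j.+2 (@dif R) u n) \/
   (forall n, (n < N)%N -> iter j.+2 (@dif R) u n <= 0)).

Definition slow j (eta : R) N u := slowp j eta N u \/ slowp j eta N (fun n => - u n).

Lemma slowp_shift j eta N u r M : (r + M <= N)%N -> slowp j eta N u ->
  slowp j eta M (fun i => u (r + i)%N).
Proof.
have hlt n : (r + M <= N)%N -> (n < M)%N -> (r + n < N)%N.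
  by move=> h1 h2; apply: leq_trans h1; rewrite ltn_add2l.
move=> rM [h1 h2]; split=> [n nM|]; first by rewrite iter_dif_shift; apply/h1/hlt.
by case: h2 => h2; [left|right] => n nM; rewrite iter_dif_shift; apply/h2/hlt.
Qed.

Local Notation S u N := (\sum_(n < N) e (u n)).

Lemma nrm_sum_e N u : nrm (S u N) <= N%:R.
Proof.
by rewrite -[leRHS]mulr1; apply: (@nrm_sum_le R N (fun n => e (u n))) => n _; rewrite nrm_e.
Qed.

Lemma nrm_sum_eN N u : nrm (\sum_(n < N) e (- u n)) = nrm (S u N).
Proof.
rewrite -nrmJ rmorph_sum; congr nrm; apply: eq_bigr => i _ /=.
have h : ((e (- u i))^*)%C = e (u i) by rewrite eN conjcK.
exact: h.
Qed.

Lemma sum_e_cut N a u : (a <= N)%N -> nrm (S u N) <= nrm (S u a) + (N - a)%N%:R.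
Proof.
move=> aN; rewrite -[X in nrm (S u X) <= _](subnKC aN) big_split_ord /=.
apply: le_trans (nrmD _ _) _.
by rewrite lerD2l; apply: (nrm_sum_e (N - a) (fun i => u (a + i)%N)).
Qed.

Lemma sum_e_split N a u : (a <= N)%N ->
  nrm (S u N) <= nrm (S u a) + nrm (\sum_(i < N - a) e (u (a + i)%N)).
Proof. by move=> aN; rewrite -[X in nrm (S u X) <= _](subnKC aN) big_split_ord /=; apply: nrmD. Qed.

(* The part where [iter j.+1 dif u] is at least [C1 / N] contributes little: after [j] differencings it is a sum over a slowly varying monotone phase. *)
Lemma slow_part j (eps : R) : 0 < eps ->
  exists C1, exists2 eta, 0 < C1 /\ 0 < eta & exists L, forall N u, (L <= N)%N ->
    slowp j eta N u -> eps * N%:R <= nrm (S u N) ->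
    exists r N1, [/\ (r + N1 <= N)%N,
      forall n, (n < N1)%N -> iter j.+1 (@dif R) u (r + n)%N <= C1 / N%:R &
      eps / 2 * N%:R <= nrm (\sum_(i < N1) e (u (r + i)%N))].
Proof.
move=> eps0; have p0 := @pi_gt0 R.
have [H [eps2 e2 [L2 hv]]] := vdc_iter j (divr_gt0 eps0 (ltr0n R 2)).
(* [C1] and [eta] make each of the two terms of [slow_sum] at most [eps2 * eps / 8 * N], and the
   tail cut off costs [eps2 * eps / 16 * N]; differencing would keep at least
   [eps2 * eps / 2 * N]. *)
pose C1 := 16 / (eps2 * eps).
have C10 : 0 < C1 by rewrite divr_gt0 // mulr_gt0.
pose K := (H ^ j)%N%:R : R.
pose eta := eps2 * eps / (32 * pi * (K + 1)).
have K0 : 0 <= K by rewrite ler0n.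
have eta0 : 0 < eta by rewrite divr_gt0 ?mulr_gt0 //; lra.
pose B := L2%:R * 2 / eps + (j * H)%N%:R * 16 / (eps2 * eps).
exists C1, eta => //; exists (Num.truncn B).+1 => N u LN hu hS.
have hB : B < N%:R by apply: lt_le_trans (truncnS_gt B) _; rewrite ler_nat.
have N0 : 0 < N%:R :> R by rewrite ltr0n (leq_trans _ LN).
have hB1 : L2%:R <= eps / 2 * N%:R.
  have : L2%:R * 2 / eps <= N%:R.
    apply: le_trans (ltW hB); rewrite lerDl divr_ge0 ?mulr_ge0 //; lra.
  by rewrite ler_pdivrMr //; lra.
have hB2 : (j * H)%N%:R <= eps2 * eps / 16 * N%:R.
  have : (j * H)%N%:R * 16 / (eps2 * eps) <= N%:R.
    apply: le_trans (ltW hB); rewrite lerDr divr_ge0 ?mulr_ge0 //; lra.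
  by rewrite ler_pdivrMr ?mulr_gt0 //; lra.
have hfast r N2 : (r + N2 <= N)%N ->
   (forall n, (n < N2)%N -> C1 / N%:R <= iter j.+1 (@dif R) u (r + n)%N) ->
   nrm (\sum_(i < N2) e (u (r + i)%N)) < eps / 2 * N%:R.
  move=> rN hg; rewrite ltNge; apply/negP => hc.
  have hN2 : eps / 2 * N%:R <= N2%:R := le_trans hc (nrm_sum_e N2 (fun i => u (r + i)%N)).
  pose v i := u (r + i)%N.
  have N2N : N2%:R <= N%:R :> R by rewrite ler_nat (leq_trans (leq_addl r N2)).
  have hS2 : eps / 2 * N2%:R <= nrm (S v N2).
    by apply: le_trans hc; rewrite ler_wpM2l // divr_ge0 // ltW.
  have LN2 : (L2 <= N2)%N by rewrite -(ler_nat R) (le_trans hB1).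
  have [hs [hs1 hs2 hs3]] := hv N2 v LN2 hS2.
  have [h1 h2] := slowp_shift rN hu.
  pose b := difhs hs v; pose q := (\prod_(h <- hs) h)%N; pose s := sumn hs.
  have /andP[q1 q2] : (0 < q <= H ^ j)%N by rewrite -hs1 prod_bound.
  have sH : (s <= j * H)%N by rewrite -hs1 sumn_bound.
  have q1R : 1 <= q%:R :> R by rewrite ler1n.
  have q2R : q%:R <= K by rewrite /K ler_nat.
  have hCN : 0 < C1 / N%:R by rewrite divr_gt0.
  have hlt n : (n < N2 - s)%N -> (n + sumn hs < N2)%N by rewrite ltn_subRL addnC.
  have hsl : nrm (\sum_(n < N2 - s) e (b n)) <= 2 / (C1 / N%:R) + 4 * pi * (K * eta) * (N2 - s)%N%:R.
    apply: slow_sum => //.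
    - move=> n /hlt hn; apply/andP; split.
        apply: le_trans (_ : q%:R * (C1 / N%:R) <= _); first by rewrite ler_peMl // ltW.
        apply: (@difhs_ge R hs 1 v N2) => // m hm; rewrite add1n hs1 /v.
        by rewrite iter_dif_shift hg.
      apply: le_trans (_ : q%:R * eta <= _); last by rewrite ler_wpM2r // ltW.
      apply: (@difhs_le R hs 1 v N2) => // m hm; rewrite add1n hs1.
      by have /andP[] := h1 m hm.
    - case: h2 => h2; [left|right] => n /hlt hn.
        rewrite -(mulr0 q%:R); apply: (@difhs_ge R hs 2 v N2) => // m hm.
        by rewrite add2n hs1 h2.
      rewrite -(mulr0 q%:R); apply: (@difhs_le R hs 2 v N2) => // m hm.
      by rewrite add2n hs1 h2.
  have hcut := sum_e_cut b (leq_subr s N2).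
  have hs' : (N2 - (N2 - s))%N%:R <= (j * H)%N%:R :> R by rewrite ler_nat (leq_trans _ sH) // leq_subLR addnC -leq_subLR.
  have e1 : 2 / (C1 / N%:R) = eps2 * eps / 8 * N%:R.
    by rewrite /C1; field; rewrite !lt0r_neq0.
  have e3 : 4 * pi * (K * eta) * (N2 - s)%N%:R <= eps2 * eps / 8 * N%:R.
    have : (N2 - s)%N%:R <= N%:R :> R by apply: le_trans N2N; rewrite ler_nat leq_subr.
    have : 4 * pi * (K * eta) <= eps2 * eps / 8.
      have -> : 4 * pi * (K * eta) = eps2 * eps / 8 * (K / (K + 1)).
        by rewrite /eta; field; rewrite !lt0r_neq0 //; lra.
      rewrite ler_piMr ?divr_ge0 ?mulr_ge0 ?(ltW e2) ?(ltW eps0) //.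
      by rewrite ler_pdivrMr; lra.
    have hge : 0 <= 4 * pi * (K * eta) by exact: mulr_ge0 (mulr_ge0 (ler0n _ 4) (ltW p0)) (mulr_ge0 K0 (ltW eta0)).
    by move=> a1 a2; apply: ler_pM.
  have : eps2 * (eps / 2 * N%:R) <= eps2 * N2%:R by rewrite ler_wpM2l // ltW.
  move: hs3 hcut hsl; rewrite e1 -/b.
  have : 0 < eps2 * eps * N%:R by rewrite !mulr_gt0.
  lra.
(* [g] is monotone, so it is below the level on a prefix or on a suffix; [hfast] disposes of the
   complement. *)
pose g := iter j.+1 (@dif R) u.
pose P n := g n <= C1 / N%:R.
have [h1 h2] := hu.
case: h2 => h2.
  have [n hn Pn|a [aN ha hb]] := @prefix_split P N.
    apply: le_trans Pn; rewrite /g -subr_ge0; exact: (h2 n (ltnW hn)).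
  exists 0%N, a; split => //.
  have hf := @hfast a (N - a)%N; rewrite subnKC // leqnn in hf.
  have := hf isT _; have hs := sum_e_split u aN => hf'.
  have : nrm (\sum_(i < N - a) e (u (a + i)%N)) < eps / 2 * N%:R.
    apply: hf' => n hn; rewrite ltW // ltNge; apply: hb.
    by rewrite leq_addr /= -ltn_subRL.
  by under [X in _ -> _ <= nrm X]eq_bigr do rewrite add0n; lra.
have [n hn|a [aN ha hb]] := @prefix_split (fun n => ~~ P n) N.
  apply: contra => Pn; apply: le_trans Pn; rewrite /g -subr_le0; exact: (h2 n (ltnW hn)).
exists a, (N - a)%N; split; first by rewrite subnKC.
  move=> n hn; have := hb (a + n)%N; rewrite leq_addr /= negbK; apply.
  by rewrite -ltn_subRL.
have := @hfast 0%N a aN; have hs := sum_e_split u aN => hf'.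
have : nrm (\sum_(i < a) e (u (0 + i)%N)) < eps / 2 * N%:R.
  apply: hf' => n hn; rewrite ltW // ltNge; exact: ha.
by under [X in nrm X < _ -> _]eq_bigr do rewrite add0n; lra.
Qed.

(** * Integer polynomials and binomial phases *)

Definition evz (p : {poly int}) (x : R) : R := (map_poly intr p).[x].

Lemma evzD p q x : evz (p + q) x = evz p x + evz q x.
Proof. by rewrite /evz rmorphD hornerD. Qed.
Lemma evzM p q x : evz (p * q) x = evz p x * evz q x.
Proof. by rewrite /evz rmorphM hornerM. Qed.
Lemma evz_nat (a : nat) x : evz a%:R x = a%:R.
Proof. by rewrite /evz rmorph_nat -polyC_natr hornerC. Qed.
Lemma evzC (a : int) x : evz a%:P x = a%:~R.
Proof. by rewrite /evz map_polyC hornerC. Qed.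
Lemma evzXsub (a : int) x : evz ('X - a%:P) x = x - a%:~R.
Proof. by rewrite /evz rmorphB /= map_polyX map_polyC hornerXsubC. Qed.
Lemma evz_sum (I : Type) (s : seq I) (F : I -> {poly int}) x :
  evz (\sum_(i <- s) F i) x = \sum_(i <- s) evz (F i) x.
Proof. by rewrite /evz rmorph_sum horner_sum. Qed.
Lemma evz_exp p n x : evz (p ^+ n) x = evz p x ^+ n.
Proof. by rewrite /evz rmorphXn horner_exp. Qed.
Lemma evzE (p : {poly int}) n x : (size p <= n)%N -> evz p x = \sum_(i < n) (p`_i)%:~R * x ^+ i.
Proof.
move=> hp; rewrite /evz (horner_coef_wide _ (n := n)).
  by apply: eq_bigr => i _; rewrite coef_map.
by apply: leq_trans hp; apply: size_poly.
Qed.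
Lemma evzN p x : evz (- p) x = - evz p x.
Proof. by rewrite /evz rmorphN hornerN. Qed.

Lemma evzZ (a : int) p x : evz (a *: p) x = a%:~R * evz p x.
Proof. by rewrite -mul_polyC evzM evzC. Qed.

(** [p2] is [D^k p((X - B) / D)]: the factor [D^k] clears every denominator. *)
Lemma poly_affine (p : {poly int}) k D (B : nat) : (size p <= k.+1)%N ->
  exists2 p2 : {poly int}, (size p2 <= k.+1)%N &
    forall i : nat, evz p2 (B + D * i)%N%:R = (D ^ k)%N%:R * evz p i%:R.
Proof.
move=> hp.
exists (\sum_(a < k.+1) (p`_a *+ D ^ (k - a))%:P * ('X - (B%:Z)%:P) ^+ a).
  apply: leq_trans (size_sum _ _ _) _; apply/bigmax_leqP => a _.
  rewrite mul_polyC; apply: leq_trans (size_scale_leq _ _) _.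
  by rewrite size_exp_XsubC ltn_ord.
move=> i; rewrite (evzE _ hp) evz_sum mulr_sumr; apply: eq_bigr => a _.
rewrite evzM evzC evz_exp evzXsub natrD (_ : (Posz B)%:~R = B%:R :> R) // addrC addKr.
rewrite natrM exprMn rmorphMn /= -mulr_natl.
have -> : (D ^ k)%N = (D ^ (k - a) * D ^ a)%N by rewrite -expnD subnK // -ltnS.
by rewrite natrM !natrX; ring.
Qed.

(** The falling factorial in the variable [r + i]: the origin of the window is absorbed into the
    integer roots. *)
Lemma poly_bin j r : exists2 p : {poly int}, (size p <= j.+1)%N &
  forall i : nat, evz p (r + i)%N%:R = (j`! * 'C(i, j))%N%:R.
Proof.
exists (\prod_(k <- iota 0 j) ('X - ((r + k)%N%:Z)%:P)).
  by rewrite size_prod_XsubC size_iota.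
move=> i; rewrite mulnC bin_ffact.
elim: j => [|j IH]; first by rewrite big_nil /= ffactn0 -[1]/(1%:R) evz_nat.
rewrite -addn1 iotaD big_cat big_seq1 /= add0n addn1 evzM IH evzXsub ffactnSr natrM.
have -> : (r + i)%N%:R - ((r + j)%N%:Z)%:~R = i%:R - j%:R :> R.
  by rewrite -[X in _ - X]/((r + j)%N%:R) !natrD; ring.
have [ji|ij] := leqP j i; first by rewrite natrB.
by rewrite ffact_small // !mul0r.
Qed.

(** In Vandermonde's formula the terms other than ['C(s, j)] contain ['C(D * t, i)] with
    [0 < i <= j]. As [i * q] divides [D], the identity [i 'C(D t, i) = D t 'C(D t - 1, i - 1)] shows
    that [q] divides them. *)
Lemma bin_period s D t q j : (0 < j)%N -> (q * j`! %| D)%N ->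
  exists y, 'C(s + D * t, j) = ('C(s, j) + q * y)%N.
Proof.
move=> j0 hD.
have h i : (0 < i <= j)%N -> (q %| 'C(D * t, i))%N.
  case: i => // i /= ij.
  have h1 := mul_bin_diag (D * t) i.
  have [x hx] : exists x, (D * t = i.+1 * (q * x))%N.
    have : (i.+1 * q %| D * t)%N.
      apply: dvdn_mulr; apply: dvdn_trans hD; rewrite mulnC dvdn_mul //.
      by apply: dvdn_fact; rewrite ltnS /= (leq_trans _ ij).
    by case/dvdnP => x ->; exists x; ring.
  have : (i.+1 * 'C(D * t, i.+1) = i.+1 * (q * x * 'C((D * t).-1, i)))%N.
    by rewrite -h1 hx; ring.
  by move=> /eqP; rewrite eqn_pmul2l // => /eqP ->; rewrite -mulnA dvdn_mulr.
have : (q %| \sum_(i < j.+1 | i != ord0) 'C(D * t, i) * 'C(s, j - i))%N.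
  apply: dvdn_sum => i i0; apply: dvdn_mulr; apply: h.
  by rewrite lt0n -ltnS ltn_ord andbT.
case/dvdnP => y hy; exists y.
rewrite addnC -binomial.Vandermonde (bigD1 ord0) //= hy bin0 mul1n subn0; ring.
Qed.

Lemma iter_dif_bin j k : (k <= j)%N ->
  iter k (@dif R) (fun i => 'C(i, j)%:R) = (fun i => 'C(i, j - k)%:R).
Proof.
elim: k => [|k IH] kj; first by rewrite subn0.
rewrite /= IH ?(ltnW kj) //; apply/funext => i; rewrite /dif.
have -> : (j - k = (j - k.+1).+1)%N by rewrite subnSK.
by rewrite binS natrD; ring.
Qed.

Lemma iter_difB k u v : iter k (@dif R) (fun n => u n - v n) = (fun n => iter k (@dif R) u n - iter k (@dif R) v n).
Proof. by elim: k => //= k ->; apply/funext => n; rewrite /dif; ring. Qed.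

Lemma iter_difZ k (a : R) u : iter k (@dif R) (fun n => a * u n) = (fun n => a * iter k (@dif R) u n).
Proof. by elim: k => //= k ->; apply/funext => n; rewrite /dif; ring. Qed.


(** [Q] is at once the common denominator of the polynomial phase and the bound on the step of the
    progression, which has length at least [rho * N]. *)
Definition qapprox j (Q : nat) (C rho : R) N u :=
  exists D r N', exists2 p : {poly int}, (size p <= j.+1)%N & exists c : R,
    [/\ (0 < D <= Q)%N, rho * N%:R <= N'%:R, forall m, (m < N')%N -> (r + D * m < N)%N &
      forall m, (m < N')%N -> `|u (r + D * m)%N - evz p (r + D * m)%N%:R / Q%:R - c| <= C].

Lemma qapproxN j Q C rho N u : qapprox j Q C rho N (fun n => - u n) -> qapprox j Q C rho N u.
Proof.
move=> [D [r [N' [p hp [c [h1 h2 h3 h4]]]]]].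
exists D, r, N', (- p); first by rewrite size_polyN.
exists (- c); split => // m /h4; rewrite -normrN evzN.
by congr (`|_| <= _); ring.
Qed.

(** After [j] differencings with steps [hs] the increments of the phase are close to [q * c], with
    [q] the product of the steps, and [near_const_sum] puts [q * c] near an integer. The bound [K]
    on denominators precedes [tau] because [inverse_weyl] builds its step [D] from [K] and then
    needs a precision depending on [D]. *)
Lemma near_rational j (eps : R) : 0 < eps -> exists2 K : nat, (0 < K)%N &
  forall tau, 0 < tau -> exists2 tau1, 0 < tau1 & exists L : nat, forall l v c, (L <= l)%N ->
    (forall n, (n < l)%N -> c <= iter j.+1 (@dif R) v n <= c + tau1) ->
    eps * l%:R <= nrm (S v l) ->
    exists q, (0 < q <= K)%N /\ exists m : int, `|c - m%:~R / q%:R| <= tau.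
Proof.
move=> eps0; have p0 := @pi_gt0 R.
have [H [eps2 e2 [L2 hv]]] := vdc_iter j eps0.
exists (H ^ j).+1 => // tau tau0.
have [kap kap0 hkap] := e_near tau0.
pose K := (H ^ j)%N%:R : R.
have K0 : 0 <= K by rewrite ler0n.
pose tau1 := kap * eps2 / (8 * pi * (K + 1)).
have tau10 : 0 < tau1 by rewrite divr_gt0 ?mulr_gt0 //; lra.
pose B := (j * H)%N%:R * 2 / eps2 + 8 / (eps2 * kap).
exists tau1 => //; exists (maxn L2 (Num.truncn B).+1) => l v c; rewrite geq_max => /andP[Ll LB] hc hS.
have hB : B < l%:R by apply: lt_le_trans (truncnS_gt B) _; rewrite ler_nat.
have l0 : 0 < l%:R :> R by rewrite ltr0n (leq_trans _ LB).
have hB1 : (j * H)%N%:R <= eps2 / 2 * l%:R.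
  have : (j * H)%N%:R * 2 / eps2 <= l%:R.
    by apply: le_trans (ltW hB); rewrite lerDl divr_ge0 ?mulr_ge0 ?(ltW e2) ?(ltW kap0).
  by rewrite ler_pdivrMr //; lra.
have hB2 : 8 <= eps2 * kap * l%:R.
  have : 8 / (eps2 * kap) <= l%:R.
    by apply: le_trans (ltW hB); rewrite lerDr divr_ge0 ?mulr_ge0 ?(ltW e2).
  by rewrite ler_pdivrMr ?mulr_gt0 //; lra.
have [hs [hs1 hs2 hs3]] := hv l v Ll hS.
pose b := difhs hs v; pose q := (\prod_(h <- hs) h)%N; pose s := sumn hs.
have /andP[q1 q2] : (0 < q <= H ^ j)%N by rewrite -hs1 prod_bound.
have sH : (s <= j * H)%N by rewrite -hs1 sumn_bound.
have q0 : 0 < q%:R :> R by rewrite ltr0n.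
have q2R : q%:R <= K by rewrite /K ler_nat.
have hlt n : (n < l - s)%N -> (n + sumn hs < l)%N by rewrite ltn_subRL addnC.
exists q; split; first by rewrite q1 leqW.
have hn : nrm (S b (l - s)) * nrm (e (q%:R * c) - 1) <= 2 + 2 * pi * (K * tau1) * (l - s)%N%:R.
  apply: near_const_sum => n /hlt nl.
  have : q%:R * c <= dif b n.
    by apply: (@difhs_ge R hs 1 v l) => // m hm; rewrite add1n hs1; have /andP[] := hc m hm.
  have : dif b n <= q%:R * (c + tau1).
    by apply: (@difhs_le R hs 1 v l) => // m hm; rewrite add1n hs1; have /andP[] := hc m hm.
  have : q%:R * tau1 <= K * tau1 by rewrite ler_wpM2r // ltW.
  by move=> a1 a2 a3; rewrite ger0_norm; lra.
have hcut := sum_e_cut b (leq_subr s l).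
have hs' : (l - (l - s))%N%:R <= (j * H)%N%:R :> R.
  by rewrite ler_nat (leq_trans _ sH) // leq_subLR addnC -leq_subLR.
have hS2 : eps2 / 2 * l%:R <= nrm (S b (l - s)) by move: hs3; rewrite -/b; lra.
have hk : nrm (e (q%:R * c) - 1) <= kap.
  have h1 : 2 * pi * (K * tau1) * (l - s)%N%:R <= kap * eps2 / 4 * l%:R.
    have a1 : (l - s)%N%:R <= l%:R :> R by rewrite ler_nat leq_subr.
    have a2 : 2 * pi * (K * tau1) <= kap * eps2 / 4.
      have -> : 2 * pi * (K * tau1) = kap * eps2 / 4 * (K / (K + 1)).
        by rewrite /tau1; field; rewrite !lt0r_neq0 //; lra.
      rewrite ler_piMr ?divr_ge0 ?mulr_ge0 ?(ltW e2) ?(ltW kap0) //.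
      by rewrite ler_pdivrMr; lra.
    have hge : 0 <= 2 * pi * (K * tau1) by exact: mulr_ge0 (mulr_ge0 (ler0n _ 2) (ltW p0)) (mulr_ge0 K0 (ltW tau10)).
    by apply: ler_pM.
  have h2 : eps2 / 2 * l%:R * nrm (e (q%:R * c) - 1) <= nrm (S b (l - s)) * nrm (e (q%:R * c) - 1).
    by rewrite ler_wpM2r // nrm_ge0.
  have h3 : 0 < eps2 / 2 * l%:R by rewrite mulr_gt0 ?divr_gt0.
  rewrite -(ler_pM2l h3); lra.
have [m hm] := hkap _ hk; exists m.
have -> : c - m%:~R / q%:R = (q%:R * c - m%:~R) / q%:R by field; rewrite lt0r_neq0.
rewrite normrM normfV (ger0_norm (ltW q0)) ler_pdivrMr //.
by apply: le_trans hm _; rewrite ler_peMr ?ler1n // ltW.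
Qed.

(* Van der Corput differencing puts the [j]-th difference near a rational on a window; subtracting the matching binomial polynomial along a progression lowers the level by one. *)
Lemma inverse_weyl j (eps : R) : 0 < eps ->
  exists Q C rho, exists2 eta, [/\ (0 < Q)%N, 0 < rho & 0 < eta] & exists L, forall N u, (L <= N)%N ->
    slow j eta N u -> eps * N%:R <= nrm (S u N) -> qapprox j Q C rho N u.
Proof.
elim: j eps => [|j IH] eps eps0.
  have [C1 [eta [C10 eta0] [L hL]]] := slow_part 0 eps0.
  exists 1%N, C1, (eps / 2), eta; first by split => //; rewrite divr_gt0.
  exists L.+1 => N u LN hu hS.
  wlog hu' : u hu hS / slowp 0 eta N u.
    move=> H; case: (hu) => hu'; first exact: H.
    apply: qapproxN; apply: H => //; first by left.
    by rewrite nrm_sum_eN.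
  have [r [N1 [h1 h2 h3]]] := hL N u (ltnW LN) hu' hS.
  (* Over at most [N] increments, each in [[0, C1 / N]], the sequence moves by at most [C1], so the
     constant [u r] approximates it. *)
  exists 1%N, r, N1, 0; first by rewrite size_poly0.
  exists (u r); split => //.
  - exact: le_trans h3 (nrm_sum_e N1 (fun i => u (r + i)%N)).
  - by move=> m mN; rewrite mul1n; apply: leq_trans h1; rewrite ltn_add2l.
  have N0 : 0 < N%:R :> R by rewrite ltr0n (leq_trans _ LN).
  have hlt m : (m < N1)%N -> (r + m < N)%N by move=> ?; apply: leq_trans h1; rewrite ltn_add2l.
  have [hu1 _] := hu'.
  have hm m : (m < N1)%N -> 0 <= u (r + m)%N - u r <= m%:R * (C1 / N%:R).
    elim: m => [|m IHm] mN; first by rewrite addn0 subrr mul0r lexx.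
    have /andP[a1 a2] := IHm (ltnW mN).
    have /andP[b1 _] := hu1 _ (hlt m (ltnW mN)).
    have b2 := h2 m (ltnW mN).
    move: b1 b2; rewrite /= /dif addnS -natr1 mulrDl mul1r => b1 b2.
    by apply/andP; split; lra.
  move=> m mN; rewrite mul1n -[0]/(0%:P) evzC mul0r subr0.
  have /andP[a1 a2] := hm m mN; rewrite ger0_norm //; apply: le_trans a2 _.
  rewrite mulrCA -[leRHS]mulr1 ler_wpM2l ?(ltW C10) //.
  by rewrite ler_pdivrMr // mul1r ler_nat (leq_trans (leq_addl r m)) // ltnW // hlt.
have [C1 [eta [C10 eta0] [L1 hL1]]] := slow_part j.+1 eps0.
have eps40 : 0 < eps / 4 by rewrite divr_gt0.
have eps320 : 0 < eps / 32 by rewrite divr_gt0.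
have [K K0 hK] := near_rational j eps40.
have [Q [C [rho [eta' [Q0 rho0 eta'0] [L2 hL2]]]]] := IH _ eps320.
(* For every denominator [q <= K], [q] times the factorial of [j.+1] divides [D], so by [bin_period]
   the binomial phase with denominator [q] is constant modulo 1 along progressions of step [D]. *)
pose D := (K`! * j.+1`!)%N.
have D0 : (0 < D)%N by rewrite muln_gt0 !fact_gt0.
have D0R : 0 < D%:R :> R by rewrite ltr0n.
pose Dj := (D ^ j.+1)%N%:R : R.
have Dj0 : 0 < Dj by rewrite ltr0n expn_gt0 D0.
have t20 : 0 < eta' / (2 * Dj) by rewrite divr_gt0 // mulr_gt0.
have [tau1 tau10 [L3 hL3]] := hK _ t20.
(* On a window of length [kappa * N] the difference of order [j.+1], whose increments are at most
   [C1 / N], varies by at most [tau1] and at most half of [eta' / Dj]. The bound [eps^2 / 8] serves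
   the pigeonhole in [large_subsum]. *)
pose kappa := Num.min (eps ^+ 2 / 8) (Num.min tau1 (eta' / (2 * Dj)) / C1).
have kappa0 : 0 < kappa by rewrite lt_min !divr_gt0 ?exprn_gt0 // lt_min tau10 divr_gt0 ?mulr_gt0.
have kC : kappa * C1 <= Num.min tau1 (eta' / (2 * Dj)).
  by rewrite -ler_pdivlMr // /kappa ge_min lexx orbT.
pose Q' := (Q * D ^ j.+2)%N.
pose rho' := rho * (eps / 32) * (eps / (32 * D%:R)) * (kappa / 2).
have rho'0 : 0 < rho' by rewrite /rho' !mulr_gt0 ?invr_gt0 ?mulr_gt0.
pose M0 := (L2.+1 + j.+3)%N.
pose B1 := 32 * D%:R / eps * (j.+3)%:R + 32 * D%:R / eps * (32 / eps * M0%:R).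
pose L4 := (maxn L3 (Num.truncn B1).+2).
exists Q', C, rho', eta; first by split => //; rewrite muln_gt0 Q0 expn_gt0 D0.
exists (maxn L1 (Num.truncn (2 * L4.+1%:R / kappa)).+1) => N u.
rewrite geq_max => /andP[LN1 LN2] hu hS.
wlog hu' : u hu hS / slowp j.+1 eta N u.
  move=> H; case: (hu) => hu'; first exact: H.
  apply: qapproxN; apply: H => //; first by left.
  by rewrite nrm_sum_eN.
have N0 : 0 < N%:R :> R by rewrite ltr0n (leq_trans _ LN2).
have [r1 [N1 [h1 h2 h3]]] := hL1 N u LN1 hu' hS.
have N1N : N1%:R <= N%:R :> R by rewrite ler_nat (leq_trans (leq_addl r1 N1)).
have hN1 : eps / 2 * N%:R <= N1%:R := le_trans h3 (nrm_sum_e N1 (fun i => u (r1 + i)%N)).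
have hkN : 2 * L4.+1%:R <= kappa * N%:R.
  have : 2 * L4.+1%:R / kappa < N%:R.
    by apply: lt_le_trans (truncnS_gt _) _; rewrite ler_nat.
  by rewrite ltr_pdivrMr // => /ltW; rewrite (mulrC kappa).
pose l := Num.truncn (kappa * N%:R).
have /andP[l1 l2] : l%:R <= kappa * N%:R < l.+1%:R by apply: truncn_itv; rewrite mulr_ge0 // ltW.
have lL4 : (L4 < l)%N.
  rewrite -ltnS -(ltr_nat R); apply: le_lt_trans l2.
  by move: hkN; rewrite -natr1; have : 0 <= L4%:R :> R by []; lra.
have lk : kappa / 2 * N%:R <= l%:R.
  by move: l2 hkN; rewrite -[l.+1%:R]natr1 -[L4.+1%:R]natr1; have : 0 <= L4%:R :> R by []; lra.
have l0 : (0 < l)%N by apply: leq_trans lL4.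
have l0R : 0 < l%:R :> R by rewrite ltr0n.
have N10 : (0 < N1)%N by rewrite -(ltr0n R) (lt_le_trans _ hN1) // mulr_gt0 // divr_gt0.
have hS1 : eps / 2 * N1%:R <= nrm (\sum_(i < N1) e (u (r1 + i)%N)).
  by apply: le_trans h3; rewrite ler_wpM2l // divr_ge0 // ltW.
have ge1 a : nrm (e (a : R)) <= 1 by rewrite nrm_e.
have hl1 : (1 * l)%:R <= eps / 2 / 2 * N1%:R.
  rewrite mul1n; apply: le_trans l1 _.
  apply: le_trans (_ : eps / 4 * (eps / 2 * N%:R) <= _); last first.
    by have := ler_wpM2l (ltW eps40) hN1; lra.
  have -> : eps / 4 * (eps / 2 * N%:R) = eps ^+ 2 / 8 * N%:R by rewrite expr2; lra.
  by rewrite ler_wpM2r ?(ltW N0) // /kappa ge_min lexx.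
have [r2' hr2 hS2'] := @large_subsum R N1 1 l (fun i => e (u (r1 + i)%N)) (eps / 2) isT l0
   (fun n => ge1 _) (divr_gt0 eps0 (ltr0n R 2)) N10 hS1 hl1.
pose r2 := (r1 + r2')%N.
pose v i := u (r2 + i)%N.
have hS2 : eps / 4 * l%:R <= nrm (S v l).
  have <- : eps / 2 / 2 = eps / 4 by clear; lra.
  apply: le_trans hS2' _; rewrite le_eqVlt; apply/orP; left; apply/eqP; congr nrm.
  by apply: eq_bigr => i _; rewrite mul1n /v /r2 addnA.
have hr2' m : (m < l)%N -> (r2' + m < N1)%N by move=> /hr2; rewrite mul1n.
have hr2N m : (m < l)%N -> (r2 + m < N)%N.
  by move=> /hr2' hm; rewrite /r2 -addnA; apply: leq_trans h1; rewrite ltn_add2l.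
pose f := iter j.+1 (@dif R) v.
have hg m : (m < l)%N -> 0 <= dif f m <= C1 / N%:R.
  move=> ml; rewrite /f -[dif _]/(iter j.+2 (@dif R) v) iter_dif_shift.
  have [a _] := hu'; have /andP[-> _] := a _ (hr2N m ml) => /=.
  by rewrite /r2 -addnA; apply: h2; apply: hr2'.
pose c := f 0%N.
have hf m : (m < l)%N -> c <= f m <= c + kappa * C1.
  move=> ml; suff : 0 <= f m - c <= m%:R * (C1 / N%:R).
    move=> /andP[a1 a2]; apply/andP; split; first by move: a1; clear; lra.
    have : m%:R * (C1 / N%:R) <= kappa * C1.
      rewrite mulrCA (mulrC kappa) ler_wpM2l ?(ltW C10) // ler_pdivrMr //.
      by apply: le_trans l1; rewrite ler_nat ltnW.
    by move: a1 a2; clear; lra.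
  elim: m ml => [|m IHm] ml; first by rewrite subrr mul0r lexx.
  have /andP[a1 a2] := IHm (ltnW ml); have /andP[b1 b2] := hg m (ltnW ml).
  move: a1 a2 b1 b2; rewrite /dif -natr1 mulrDl mul1r; clear => a1 a2 b1 b2.
  by apply/andP; split; lra.
have kC1 : kappa * C1 <= tau1 by apply: le_trans kC _; rewrite ge_min lexx.
have kC2 : kappa * C1 <= eta' / (2 * Dj) by apply: le_trans kC _; rewrite ge_min lexx orbT.
have L3l : (L3 <= l)%N by rewrite (leq_trans _ (ltnW lL4)) // leq_maxl.
have hf1 n : (n < l)%N -> c <= iter j.+1 (@dif R) v n <= c + tau1.
  by move=> /hf /andP[a1 a2]; rewrite -/f a1 /= (le_trans a2) // lerD2l.
have [q [/andP[q0 qK] [m0 hm0]]] := hL3 l v c L3l hf1 hS2.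
have qD : (q * j.+1`! %| D)%N by rewrite dvdn_mul // dvdn_fact ?q0.
clearbody D; have qR : q%:R != 0 :> R by rewrite pnatr_eq0 -lt0n.
pose z := m0%:~R / q%:R : R.
(* This lowers the difference of order [j.+1] by exactly the nearby rational [z] and brings it
   within [eta' / Dj] of 0; passing to step [D] multiplies it by [Dj], leaving [eta']. *)
pose v1 i := v i - z * 'C(i, j.+1)%:R.
have hS3 (l3 : nat) : (0 < l3)%N -> (D * l3)%:R <= eps / 8 * l%:R -> exists2 s, (forall t, (t < l3)%N -> (s + D * t < l)%N) &
    eps / 8 * l3%:R <= nrm (\sum_(t < l3) e (v1 (s + D * t)%N)).
  move=> l30 hl3.
  have e2 : eps / 4 / 2 = eps / 8 by clear; lra.
  have := @large_subsum R l D l3 (fun i => e (v i)) (eps / 4) D0 l30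
   (fun n => ge1 _) eps40 l0 hS2; rewrite e2 => /(_ hl3) [s hs hs2].
  exists s => //; apply: le_trans hs2 _.
  have -> : \sum_(m < l3) e (v (s + D * m)%N) = e (z * 'C(s, j.+1)%:R) * \sum_(t < l3) e (v1 (s + D * t)%N).
    rewrite mulr_sumr; apply: eq_bigr => t _.
    have [y hy] := @bin_period s D t q j.+1 isT qD.
    rewrite -eD /v1 hy natrD natrM.
    have -> : z * 'C(s, j.+1)%:R + (v (s + D * t)%N - z * ('C(s, j.+1)%:R + q%:R * y%:R))
       = v (s + D * t)%N - (m0 * y%:Z)%:~R.
      rewrite intrM -[(Posz y)%:~R]/(y%:R); rewrite /z; field; exact: qR.
    by rewrite eB e_int conjc1 mulr1.
  by rewrite nrmM nrm_e mul1r.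
pose l3 := Num.truncn (eps / (8 * D%:R) * l%:R).
have epsD0 : 0 < eps / (8 * D%:R) by rewrite divr_gt0 // mulr_gt0.
have /andP[l31 l32] : l3%:R <= eps / (8 * D%:R) * l%:R < l3.+1%:R.
  by apply: truncn_itv; rewrite mulr_ge0 // ltW.
have hB1 : B1 + 1 <= l%:R.
  have : (Num.truncn B1).+2%:R <= l%:R :> R.
    by rewrite ler_nat; apply: leq_trans (ltnW lL4); rewrite leq_maxr.
  have := truncnS_gt B1; rewrite -[(Num.Def.trunc B1).+2%:R]natr1; clear; lra.
have hB2 : j.+3%:R + 32 / eps * M0%:R <= eps / (32 * D%:R) * l%:R.
  have -> : j.+3%:R + 32 / eps * M0%:R = eps / (32 * D%:R) * B1.
    by rewrite /B1; field; rewrite !lt0r_neq0.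
  by rewrite ler_wpM2l ?divr_ge0 ?mulr_ge0 ?(ltW eps0) //; move: hB1; clear; lra.
have hee : eps / (8 * D%:R) * l%:R = 4 * (eps / (32 * D%:R) * l%:R).
  by field; rewrite lt0r_neq0.
have ll0 : 0 < 32 / eps * M0%:R by rewrite mulr_gt0 ?divr_gt0.
have l3j : (j.+2 < l3)%N.
  rewrite -(ltr_nat R); move: l32 hB2 ll0 (ler0n R j.+2).
  by rewrite hee -[l3.+1%:R]natr1 -[j.+3%:R]natr1; clear; lra.
have l30 : (0 < l3)%N by apply: leq_trans l3j.
have hDl3 : (D * l3)%:R <= eps / 8 * l%:R.
  rewrite natrM; have -> : eps / 8 * l%:R = D%:R * (eps / (8 * D%:R) * l%:R).
    by field; rewrite lt0r_neq0.
  by rewrite ler_pM2l.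
have [s hs hS4] := hS3 l3 l30 hDl3.
pose w t := v1 (s + D * t)%N.
pose l4 := (l3 - j.+2)%N.
have l4R : l4%:R = l3%:R - j.+2%:R :> R by rewrite /l4 natrB // ltnW.
have hl4 : eps / (32 * D%:R) * l%:R <= l4%:R.
  rewrite l4R; move: l32 hB2 ll0 (ler0n R j.+2).
  by rewrite hee -[l3.+1%:R]natr1 -[j.+3%:R]natr1; clear; lra.
have hS5 : eps / 16 * l4%:R <= nrm (S w l4).
  have := sum_e_cut w (leq_subr j.+2 l3); rewrite -/l4.
  have -> : (l3 - l4)%N = j.+2 by rewrite /l4 subKn // ltnW.
  move=> hcut.
  have : j.+2%:R <= eps / 16 * l4%:R + eps / 16 * j.+2%:R.
    have hle : j.+3%:R + 32 / eps * M0%:R <= l4%:R by apply: le_trans hl4.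
    have : eps / 16 * (j.+3%:R + 32 / eps * M0%:R) <= eps / 16 * l4%:R.
      by rewrite ler_wpM2l // divr_ge0 // ltW.
    have -> : eps / 16 * (j.+3%:R + 32 / eps * M0%:R) = eps / 16 * j.+3%:R + 2 * M0%:R.
      by field; rewrite lt0r_neq0.
    have : j.+2%:R <= M0%:R :> R by rewrite ler_nat (leq_trans (leqnSn _)) // leq_addl.
    have : 0 <= M0%:R :> R by [].
    have : 0 <= eps / 16 * j.+3%:R by rewrite mulr_ge0 // divr_ge0 // ltW.
    have : 0 <= eps / 16 * j.+2%:R by rewrite mulr_ge0 // divr_ge0 // ltW.
    clear; lra.
  have hS4' : eps / 8 * l3%:R <= nrm (\sum_(n < l3) e (w n)) by exact: hS4.
  have hj0 : 0 <= eps / 16 * j.+2%:R by rewrite mulr_ge0 // divr_ge0 // ltW.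
  by move=> hj; move: hj hj0 hS4' hcut; rewrite l4R; clear; lra.
have finish r5 N5 : (r5 + N5 <= l4)%N -> slow j eta' N5 (fun i => w (r5 + i)%N) ->
    eps / 32 * l4%:R <= nrm (\sum_(i < N5) e (w (r5 + i)%N)) -> qapprox j.+1 Q' C rho' N u.
  move=> h5 hsl hS6.
  have hN5 : eps / 32 * l4%:R <= N5%:R := le_trans hS6 (nrm_sum_e N5 (fun i => w (r5 + i)%N)).
  have N5l : N5%:R <= l4%:R :> R by rewrite ler_nat (leq_trans (leq_addl r5 N5)).
  have hM0 : M0%:R <= eps / 32 * l4%:R.
    have : eps / 32 * (j.+3%:R + 32 / eps * M0%:R) <= eps / 32 * l4%:R.
      by rewrite ler_wpM2l ?(ltW eps320) // (le_trans hB2).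
    have -> : eps / 32 * (j.+3%:R + 32 / eps * M0%:R) = eps / 32 * j.+3%:R + M0%:R.
      by field; rewrite lt0r_neq0.
    by apply: le_trans; rewrite lerDr mulr_ge0 // ltW.
  have L2N5 : (L2 <= N5)%N.
    rewrite -(ler_nat R); apply: le_trans hN5; apply: le_trans hM0.
    by rewrite ler_nat /M0 addSn leqW // leq_addr.
  have hS7 : eps / 32 * N5%:R <= nrm (S (fun i => w (r5 + i)%N) N5).
    by apply: le_trans hS6; rewrite ler_wpM2l // ltW.
  have [D' [r' [N' [p' hp' [c' [/andP[D'0 D'Q] hN' hr' hap]]]]]] := hL2 N5 _ L2N5 hsl hS7.
  have /dvdnP[x hx] := qD.
  have [p2 hp2 ep2] := @poly_affine p' j.+1 D (r2 + s + D * r5)%N (leqW hp').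
  have [p3 hp3 ep3] := poly_bin j.+1 r2.
  exists (D * D')%N, (r2 + (s + D * (r5 + r')))%N, N'.
  (* Common denominator [Q' = Q D^(j+2)]: the induction hypothesis gives [p2 / (Q D^(j+1))], and
     since [D = x q (j+1)!] the binomial phase with factor [m0 / q] equals [x m0 / D] times the
     falling factorial [p3]. *)
  exists ((D%:Z) *: p2 + ((Q * D ^ j.+1 * x)%N%:Z * m0) *: p3).
    apply: leq_trans (size_polyD _ _) _; rewrite geq_max.
    by rewrite !(leq_trans (size_scale_leq _ _)).
  have eqn m : (r2 + (s + D * (r5 + r')) + D * D' * m = r2 + (s + D * (r5 + (r' + D' * m))))%N by ring.
  exists c'; split.
  - by rewrite muln_gt0 D0 D'0 /Q' mulnC leq_mul // expnS leq_pmulr // expn_gt0 D0.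
  - apply: le_trans hN'.
    have -> : rho' * N%:R = rho * (eps / 32 * (eps / (32 * D%:R) * (kappa / 2 * N%:R))).
      by rewrite /rho'; ring.
    rewrite ler_pM2l //; apply: le_trans hN5; rewrite ler_pM2l //; apply: le_trans hl4.
    by rewrite ler_pM2l ?divr_gt0 ?mulr_gt0.
  - move=> m /hr' hm; rewrite eqn; apply: hr2N; apply: hs.
    have : (r5 + (r' + D' * m) < l4)%N by apply: leq_trans h5; rewrite ltn_add2l.
    by move=> h; apply: leq_trans h (leq_subr _ _).
  move=> m mN; rewrite eqn; have := hap m mN.
  set i := (r' + D' * m)%N; congr (`|_| <= _).
  rewrite evzD !evzZ ep3.
  have -> : (r2 + (s + D * (r5 + i)) = r2 + s + D * r5 + D * i)%N by ring.
  rewrite ep2 /w /v1 /v.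
  have -> : (r2 + s + D * r5 + D * i = r2 + (s + D * (r5 + i)))%N by ring.
  set X := 'C(_, _).
  rewrite intrM -[(Posz D)%:~R]/(D%:R) -[(Posz (Q * _ * _))%:~R]/((Q * D ^ j.+1 * x)%N%:R).
  have QR : Q%:R != 0 :> R by rewrite pnatr_eq0 -lt0n.
  have xR : x%:R != 0 :> R.
    by rewrite pnatr_eq0; apply/eqP => x0; move: D0; rewrite hx x0.
  have fR : (j.+1)`!%:R != 0 :> R by rewrite pnatr_eq0 -lt0n fact_gt0.
  have DjR : (D ^ j.+1)%N%:R != 0 :> R by rewrite lt0r_neq0.
  have DR : D%:R = x%:R * (q%:R * (j.+1)`!%:R) :> R by rewrite {1}hx (natrM _ x) (natrM _ q).
  rewrite /z /Q' (expnS D j.+1) (natrM _ Q) (natrM _ D) (natrM _ (Q * _)) (natrM _ Q) (natrM _ _ X) DR; field.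
  by rewrite QR xR fR DjR qR.
have hft n : (n < l)%N -> - (eta' / Dj) <= iter j.+1 (@dif R) v1 n <= eta' / Dj.
  move=> nl; rewrite /v1 iter_difB iter_difZ iter_dif_bin // subnn bin0 mulr1 -/(f n).
  have /andP[a1 a2] := hf n nl.
  have e2 : eta' / Dj = eta' / (2 * Dj) + eta' / (2 * Dj) by field; rewrite lt0r_neq0.
  move: hm0; rewrite -/z ler_norml => /andP[b1 b2].
  move: kC2 a1 a2 b1 b2; rewrite e2; clear => ? ? ? ? ?.
  by apply/andP; split; lra.
have hDj : Dj * (eta' / Dj) = eta' by field; rewrite lt0r_neq0.
have hrange t k : (k <= j.+2)%N -> (t < l4)%N -> (s + D * (t + k) < l)%N.
  move=> kj tl; apply: hs; apply: leq_ltn_trans (_ : (t + j.+2 < l3)%N); first by rewrite leq_add2l.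
  by move: tl; rewrite /l4 ltn_subRL addnC.
pose F := iter j.+1 (@dif R) w.
have hF t : (t < l4)%N -> - eta' <= F t <= eta'.
  move=> tl; have hr := hrange t j.+1 (leqnSn _) tl.
  have := @iter_dif_ap j.+1 D s v1 t l (- (eta' / Dj)) _ hr; rewrite -/Dj mulrN hDj.
  move=> -> /=; last by move=> n /hft /andP[].
  have := @iter_dif_ap_le j.+1 D s v1 t l (eta' / Dj) _ hr; rewrite -/Dj hDj.
  by apply=> n /hft /andP[].
have hF2 t : (t < l4)%N -> 0 <= dif F t.
  move=> tl; have hr := hrange t j.+2 (leqnn _) tl.
  have := @iter_dif_ap j.+2 D s v1 t l 0 _ hr; rewrite mulr0; apply => n nl.
  rewrite /v1 iter_difB iter_difZ.
  have -> : iter j.+2 (@dif R) (fun i => 'C(i, j.+1)%:R) n = 0.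
    by rewrite [LHS]/= -[dif _]/(dif (iter j.+1 (@dif R) _)) iter_dif_bin // subnn /dif !bin0 subrr.
  by rewrite mulr0 subr0; have /andP[] := hg n nl.
(* [F] is nondecreasing between [- eta'] and [eta']; its sign change cuts the window into one piece
   slow for [- w] and one slow for [w], and one of them keeps half of the sum. *)
have [n hn Fn|a [al ha hb]] := @prefix_split (fun t => F t <= 0) l4.
  by apply: le_trans Fn; have := hF2 n (ltnW hn); rewrite /dif subr_ge0.
have hsp := sum_e_split w al.
have [hc1|hc1] := leP (eps / 32 * l4%:R) (nrm (S w a)).
  apply: (finish 0%N a) => //.
  right; split=> [n na|].
    rewrite iter_difN -/(iter j.+1 _) (_ : (fun i => w (0 + i)%N) = w) //.
    have /andP[b1 b2] := hF n (leq_trans na al).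
    by have := ha n na; rewrite -/F => b3; rewrite oppr_ge0 b3 lerNl.
  right => n na; rewrite iter_difN oppr_le0.
  exact: (hF2 n (leq_trans na al)).
apply: (finish a (l4 - a)%N); first by rewrite subnKC.
  left; split=> [n na|].
    rewrite iter_dif_shift -/F; have /andP[b1 b2] : - eta' <= F (a + n)%N <= eta'.
      by apply: hF; rewrite -ltn_subRL.
    rewrite b2 andbT ltW // ltNge; apply: hb; by rewrite leq_addr /= -ltn_subRL.
  left => n na; rewrite iter_dif_shift.
  by apply: hF2; rewrite -ltn_subRL.
move: hS5 hsp hc1 (ler0n R l4); clear; lra.
Qed.

End Inverse.

(** * Calculus near infinity *)

Section Calculus.
Variable R : realType.
Implicit Types (f g df : R -> R) (x y a b c X : R).

Definition der (f : R -> R) (x d : R) : Prop := is_derive x 1 f d.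

Lemma der_eq f x d d' : der f x d -> d = d' -> der f x d'.
Proof. by move=> h <-. Qed.

Lemma derD f g x a b : der f x a -> der g x b -> der (fun y => f y + g y) x (a + b).
Proof. by move=> h1 h2; exact: (@is_deriveD _ _ _ f g x 1 a b h1 h2). Qed.

Lemma derB f g x a b : der f x a -> der g x b -> der (fun y => f y - g y) x (a - b).
Proof. by move=> h1 h2; exact: (@is_deriveB _ _ _ f g x 1 a b h1 h2). Qed.

Lemma derZ c f x a : der f x a -> der (fun y => c * f y) x (c * a).
Proof. by move=> h1; exact: (@is_deriveZ _ _ _ f c x 1 a h1). Qed.

Lemma der_cst c x : der (fun=> c) x 0.
Proof. exact: (@is_derive_cst _ _ _ c x 1). Qed.

Lemma der_poly (p : {poly R}) x : der (horner p) x p^`().[x].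
Proof. exact: is_derive_poly. Qed.

Lemma der_xn n x : der (fun y => y ^+ n) x (n%:R * x ^+ n.-1).
Proof.
have -> : (fun y => y ^+ n) = horner ('X^n : {poly R}) by apply/funext => y; rewrite hornerXn.
by apply: der_eq (der_poly _ _) _; rewrite derivXn hornerMn hornerXn mulr_natl.
Qed.

Lemma der_shift f x s d : der f (x + s) d -> der (fun y => f (y + s)) x d.
Proof.
move=> h; have h2 : der (fun y => y + s) x 1.
  by apply: der_eq (derD (@is_derive_id _ _ x 1) (der_cst s x)) _; rewrite addr0.
by have := @is_derive1_comp R f (fun y => y + s) x d 1 h h2; rewrite mulr1.
Qed.

Lemma der_ln f x d : 0 < f x -> der f x d -> der (fun y => ln (f y)) x (d / f x).
Proof. by move=> f0 h; apply: der_eq (is_derive1_comp (is_derive1_ln f0) h) _; rewrite mulrC. Qed.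

Lemma der_cont f x d : der f x d -> {for x, continuous f}.
Proof. by move=> h; apply/differentiable_continuous/derivable1_diffP; apply: (@ex_derive _ _ _ _ _ _ _ h). Qed.

Lemma mvt X f df : (forall x, X < x -> der f x (df x)) ->
  forall a b, X < a -> a < b -> exists c, [/\ a < c, c < b & f b - f a = df c * (b - a)].
Proof.
move=> h a b Xa ab.
have hx x : x \in `]a, b[ -> is_derive x 1 f (df x).
  by rewrite in_itv /= => /andP[ax _]; apply: h; apply: lt_trans ax.
have hc : {within `[a, b], continuous f}.
  apply: continuous_in_subspaceT => x; rewrite inE /= in_itv /= => /andP[ax _].
  by apply: der_cont (h x (lt_le_trans Xa ax)).
have [c + hh] := MVT ab hx hc.
by rewrite in_itv /= => /andP[h1 h2]; exists c.
Qed.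

Lemma der_ge0_mono X f df : (forall x, X < x -> der f x (df x)) -> (forall x, X < x -> 0 <= df x) ->
  forall a b, X < a -> a <= b -> f a <= f b.
Proof.
move=> h h0 a b Xa; rewrite le_eqVlt => /orP[/eqP->//|ab].
have [c [ac cb e]] := mvt h Xa ab.
rewrite -subr_ge0 e mulr_ge0 ?subr_ge0 ?(ltW ab) //; exact: h0 (lt_trans Xa ac).
Qed.

Lemma der_le0_mono X f df : (forall x, X < x -> der f x (df x)) -> (forall x, X < x -> df x <= 0) ->
  forall a b, X < a -> a <= b -> f b <= f a.
Proof.
move=> h h0 a b Xa; rewrite le_eqVlt => /orP[/eqP->//|ab].
have [c [ac cb e]] := mvt h Xa ab.
rewrite -subr_le0 e mulr_le0_ge0 ?subr_ge0 ?(ltW ab) //; exact: h0 (lt_trans Xa ac).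
Qed.

Definition ev (P : R -> Prop) := exists X, forall x, X < x -> P x.

Lemma evT (P : R -> Prop) : (forall x, P x) -> ev P.
Proof. by move=> h; exists 0. Qed.

Lemma evW (P Q : R -> Prop) : (forall x, P x -> Q x) -> ev P -> ev Q.
Proof. by move=> h [X hX]; exists X => x /hX /h. Qed.

Lemma ev_and (P Q : R -> Prop) : ev P -> ev Q -> ev (fun x => P x /\ Q x).
Proof.
move=> [X hX] [Y hY]; exists (Num.max X Y) => x; rewrite gt_max => /andP[a b].
by split; [apply: hX|apply: hY].
Qed.

Lemma evW2 (P Q T : R -> Prop) : (forall x, P x -> Q x -> T x) -> ev P -> ev Q -> ev T.
Proof. by move=> h h1 h2; apply: evW (ev_and h1 h2) => x []; apply: h. Qed.

Lemma ev_gt a : ev (fun x => a < x).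
Proof. by exists a. Qed.

Lemma ev_all (P : nat -> R -> Prop) K : (forall j, (j <= K)%N -> ev (P j)) ->
  ev (fun x => forall j, (j <= K)%N -> P j x).
Proof.
elim: K => [|K IH] h.
  by apply: evW (h 0%N isT) => x hx j; rewrite leqn0 => /eqP->.
apply: evW2 (IH (fun j hj => h j (leqW hj))) (h K.+1 (leqnn _)) => x h1 h2 j.
by rewrite leq_eqVlt => /orP[/eqP->//|]; exact: h1.
Qed.

Lemma ev_near (P : R -> Prop) : (\forall x \near +oo_ R, P x) <-> ev P.
Proof.
split; first by case=> M [_ h]; exists M.
by case=> M h; exists M; split => //; rewrite num_real.
Qed.

Lemma ev_const (P : Prop) : ev (fun=> P) -> P.
Proof. by case=> X h; apply: (h (X + 1)); rewrite ltrDl. Qed.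

(** A monotone function crosses 0 at most once. *)
Lemma weak_sign f df : ev (fun x => der f x (df x)) ->
  ev (fun x => 0 <= df x) \/ ev (fun x => df x <= 0) ->
  ev (fun x => 0 <= f x) \/ ev (fun x => f x <= 0).
Proof.
move=> hd [] h; have [X hX] := ev_and hd h.
- have hm := der_ge0_mono (fun x hx => (hX x hx).1) (fun x hx => (hX x hx).2).
  have [[x0 [Xx0 f0]]|hn] := pselect (exists x0, X < x0 /\ 0 <= f x0).
    left; exists x0 => x x0x; exact: le_trans f0 (hm _ _ Xx0 (ltW x0x)).
  right; exists X => x Xx; rewrite leNgt; apply/negP => fx; apply: hn; exists x; split => //; exact: ltW.
- have hm := der_le0_mono (fun x hx => (hX x hx).1) (fun x hx => (hX x hx).2).
  have [[x0 [Xx0 f0]]|hn] := pselect (exists x0, X < x0 /\ f x0 <= 0).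
    right; exists x0 => x x0x; exact: le_trans (hm _ _ Xx0 (ltW x0x)) f0.
  left; exists X => x Xx; rewrite leNgt; apply/negP => fx; apply: hn; exists x; split => //; exact: ltW.
Qed.

(* [f - C x^-m] increases and [f + C x^-m] decreases, so [f] has a limit. *)
Lemma der_limit m f df C : (0 < m)%N -> 0 <= C ->
  ev (fun x => der f x (df x)) -> ev (fun x => `|df x| <= C / x ^+ m.+1) ->
  exists L, ev (fun x => `|f x - L| <= C / x ^+ m).
Proof.
move=> m0 C0 hd hb.
have [X hX] := ev_and (ev_and hd hb) (ev_gt 0).
pose Y := Num.max X 0.
have hY x : Y < x -> [/\ der f x (df x), `|df x| <= C / x ^+ m.+1 & 0 < x].
  by rewrite gt_max => /andP[/hX[[]]].
pose h x := C / x ^+ m.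
pose dh x := - (C * m%:R / x ^+ m.+1).
have hdh x : Y < x -> der h x (dh x).
  move=> /hY[_ _ x0]; have xm : x ^+ m != 0 by rewrite expf_neq0 // lt0r_neq0.
  have h1 := derZ C (@is_deriveV R (fun y => y ^+ m) x _ 1 xm (der_xn m x)).
  apply: der_eq h1 _; rewrite /dh -[(_ *: _)%R]/(_ * _)%R.
  move: x0 m0; clear; case: m => // m x0 _; rewrite !exprS /=; field; rewrite ?expf_neq0 ?lt0r_neq0 //.
have hC x : Y < x -> `|df x| <= - dh x.
  move=> /hY[_ h1 x0]; apply: le_trans h1 _; rewrite /dh opprK.
  rewrite ler_wpM2r ?invr_ge0 ?exprn_ge0 ?(ltW x0) //.
  by rewrite ler_peMr // ler1n.
have hu : forall a b, Y < a -> a <= b -> f a - h a <= f b - h b.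
  apply: (@der_ge0_mono Y (fun x => f x - h x) (fun x => df x - dh x)) => x hx.
    by apply: derB (hdh x hx); have [] := hY x hx.
  by have := hC x hx; rewrite ler_norml => /andP[]; lra.
have hv : forall a b, Y < a -> a <= b -> f b + h b <= f a + h a.
  apply: (@der_le0_mono Y (fun x => f x + h x) (fun x => df x + dh x)) => x hx.
    by apply: derD (hdh x hx); have [] := hY x hx.
  by have := hC x hx; rewrite ler_norml => /andP[]; lra.
have h0 x : Y < x -> 0 <= h x.
  by move=> /hY[_ _ x0]; rewrite /h divr_ge0 // exprn_ge0 // ltW.
have huv a b : Y < a -> Y < b -> f a - h a <= f b + h b.
  move=> Ya Yb; have [ab|/ltW ba] := leP a b.
    by apply: le_trans (hu _ _ Ya ab) _; have := h0 b Yb; lra.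
  by apply: le_trans (hv _ _ Yb ba); have := h0 a Ya; lra.
pose E := [set z : R | exists2 a, Y < a & z = f a - h a].
have Y1 : Y < Y + 1 by rewrite ltrDl.
have E0 : E !=set0 by exists (f (Y + 1) - h (Y + 1)), (Y + 1).
have ubE b : Y < b -> ubound E (f b + h b) by move=> Yb z [a Ya ->]; apply: huv.
exists (sup E); exists Y => x Yx.
have h1 : f x - h x <= sup E.
  by apply: ub_le_sup; [exists (f x + h x); apply: ubE|exists x].
have h2 : sup E <= f x + h x by apply: ge_sup => //; apply: ubE.
rewrite -/(h x) ler_norml; apply/andP; split; lra.
Qed.

Lemma der_log f df C : ev (fun x => der f x (df x)) -> ev (fun x => `|df x| <= C / x) ->
  exists C', ev (fun x => `|f x| <= C' + C * ln x).
Proof.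
move=> hd hb; have [X hX] := ev_and (ev_and hd hb) (ev_gt 1).
pose Y := Num.max X 1.
have hY x : Y < x -> [/\ der f x (df x), `|df x| <= C / x & 1 < x].
  by rewrite gt_max => /andP[/hX[[]]].
have hl x : Y < x -> der (fun y => C * ln y) x (C / x).
  move=> /hY[_ _ x0]; apply: der_eq (derZ C (is_derive1_ln (lt_trans ltr01 x0))) _; by [].
have hu : forall a b, Y < a -> a <= b -> f b - C * ln b <= f a - C * ln a.
  apply: (@der_le0_mono Y (fun x => f x - C * ln x) (fun x => df x - C / x)) => x hx.
    by apply: derB (hl x hx); have [] := hY x hx.
  by have [_ + _] := hY x hx; rewrite ler_norml => /andP[]; lra.
have hv : forall a b, Y < a -> a <= b -> f a + C * ln a <= f b + C * ln b.
  apply: (@der_ge0_mono Y (fun x => f x + C * ln x) (fun x => df x + C / x)) => x hx.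
    by apply: derD (hl x hx); have [] := hY x hx.
  by have [_ + _] := hY x hx; rewrite ler_norml => /andP[]; lra.
pose a := Y + 1; have Ya : Y < a by rewrite ltrDl.
exists (`|f a| + `|C * ln a|); exists a => x ax.
have := hu _ _ Ya (ltW ax); have := hv _ _ Ya (ltW ax).
have := ler_norm (f a); have := ler_norm (C * ln a); have := ler_norm (- f a); have := ler_norm (- (C * ln a)).
rewrite !normrN => *; rewrite ler_norml; apply/andP; split; lra.
Qed.

Definition tower (F : nat -> R -> R) K := forall j, (j <= K)%N -> ev (fun x => der (F j) x (F j.+1 x)).

(** By [der_limit] the derivative of order [K] has a limit [L] with a power rate whenever [K > 0];
    subtracting [L x^K / K!] lowers [K] by one. Only the last integration, of [C / x], produces a
    logarithm. *)
Lemma tower_log K (F : nat -> R -> R) C : 0 <= C -> tower F K ->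
  ev (fun x => `|F K.+1 x| <= C / x ^+ K.+1) ->
  exists P : {poly R}, (size P <= K.+1)%N /\ exists C', ev (fun x => `|F 0%N x - P.[x]| <= C' + C' * ln x).
Proof.
elim: K F C => [|K IH] F C C0 hF hb.
  have [C' hC'] := @der_log (F 0%N) (F 1%N) C (hF 0%N (leqnn _)) hb.
  exists 0; rewrite size_poly0; split => //; exists (Num.max C' C).
  apply: evW2 hC' (ev_gt 1) => x h x1; rewrite horner0 subr0; apply: le_trans h _.
  have l0 : 0 <= ln x by rewrite ln_ge0 // ltW.
  by apply: lerD; [rewrite le_max lexx|rewrite ler_wpM2r // le_max lexx orbT].
have [L hL] := @der_limit K.+1 (F K.+1) (F K.+2) C isT C0 (hF K.+1 (leqnn _)) hb.
pose p : {poly R} := (L / K.+1`!%:R) *: 'X^(K.+1).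
pose G j x := F j x - p^`(j).[x].
have f0 : (K.+1)`!%:R != 0 :> R by rewrite pnatr_eq0 -lt0n fact_gt0.
have hG : tower G K.
  move=> j jK; apply: evW (hF j (leqW jK)) => x hx.
  by apply: derB hx _; rewrite derivnS; apply: der_poly.
have hb2 : ev (fun x => `|G K.+1 x| <= C / x ^+ K.+1).
  apply: evW hL => x; congr (`|_ - _| <= _); rewrite /p derivnZ derivnXn subnn expr0 ffactnn.
  by rewrite hornerZ -polyC_natr hornerC divfK.
have [P [hP [C' hC']]] := IH G C C0 hG hb2.
exists (P + p); split.
  apply: leq_trans (size_polyD _ _) _; rewrite geq_max (leqW hP) /=.
  by apply: leq_trans (size_scale_leq _ _) _; rewrite size_polyXn.
exists C'; apply: evW hC' => x; congr (`|_| <= _).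
by rewrite /G derivn0 hornerD opprD addrA addrAC.
Qed.

Definition dlt (s : R) f x := f (x + s) - f x.

(** The differenced functions [G j] form a tower again, so the induction costs one mean value
    theorem. *)
Lemma dlt_mvt d (F : nat -> R -> R) X x s : (forall j, (j < d)%N -> forall y, X < y -> der (F j) y (F j.+1 y)) ->
  X < x -> 0 < s -> exists xi, [/\ x <= xi, xi <= x + d%:R * s & iter d (dlt s) (F 0%N) x = s ^+ d * F d xi].
Proof.
elim: d F => [|d IH] F hF Xx s0.
  by exists x; rewrite mul0r addr0 mul1r.
pose G j y := F j (y + s) - F j y.
have [j jd y Xy|//|//|xi [h1 h2 h3]] := IH G.
  apply: derB; last exact: hF (ltnW jd) _ Xy.
  by apply: der_shift; apply: hF (ltnW jd) _ _; apply: lt_trans Xy _; rewrite ltrDl.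
have Xxi : X < xi by apply: lt_le_trans Xx h1.
have xs : xi < xi + s by rewrite ltrDl.
have [c [c1 c2 c3]] := mvt (hF d (leqnn _)) Xxi xs.
exists c; split; first exact: le_trans h1 (ltW c1).
  by apply: le_trans (ltW c2) _; rewrite -natr1 mulrDl mul1r addrA lerD2r.
by rewrite iterSr -[dlt s (F 0%N)]/(G 0%N) h3 /G c3 addrC addKr exprSr; ring.
Qed.

Lemma dlt_bound d f x s C : (forall i, (i <= d)%N -> `|f (x + i%:R * s)| <= C) ->
  `|iter d (dlt s) f x| <= 2 ^+ d * C.
Proof.
elim: d f C => [|d IH] f C h.
  by rewrite mul1r; have := h 0%N isT; rewrite mul0r addr0.
rewrite iterSr exprSr -mulrA; apply: IH => i id; rewrite /dlt.
have h1 := h i (leqW id); have := h i.+1 id.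
rewrite -natr1 mulrDl mul1r addrA => h2.
by apply: le_trans (ler_normB _ _) _; lra.
Qed.


End Calculus.

(** * Eventual signs in a Hardy field *)

Section Hardy.
Variables (R : realType) (H : set (R -> R)).
Hypothesis hH : hardy_field H.
Implicit Types (f g u : R -> R) (x y C : R).

Lemma hardy_ext f g : (forall x, f x = g x) -> H f -> H g.
Proof. by move=> h; have -> : f = g by apply/funext. Qed.

Lemma hardy0 : H (fun=> 0).
Proof.
apply: hardy_ext (hardy_sub hH (hardy_one hH) (hardy_one hH)) => x; by rewrite subrr.
Qed.

Lemma hardyN f : H f -> H (fun x => - f x).
Proof. by move=> h; apply: hardy_ext (hardy_sub hH hardy0 h) => x; rewrite sub0r. Qed.

Lemma hardyD f g : H f -> H g -> H (fun x => f x + g x).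
Proof. by move=> h1 h2; apply: hardy_ext (hardy_sub hH h1 (hardyN h2)) => x; rewrite opprK. Qed.

Lemma hardy_nat (n : nat) : H (fun=> n%:R).
Proof.
elim: n => [|n IH]; first exact: hardy0.
by apply: hardy_ext (hardyD IH (hardy_one hH)) => x; rewrite natr1.
Qed.

Lemma hardy_der f : H f -> ev (fun x => der f x (derive1 f x)).
Proof.
move=> h; apply: evW (proj1 (ev_near _) (hardy_derivable hH h)) => x hx.
by rewrite derive1E; apply: derivableP.
Qed.

(** An inverse in the field excludes zeros far out, and continuity with the intermediate value
    theorem then excludes sign changes. *)
Lemma hardy_sign f : H f -> [\/ ev (fun x => f x = 0), ev (fun x => 0 < f x) | ev (fun x => f x < 0)].
Proof.
move=> h; have [h0|h0] := pselect (same_germ f (fun=> 0)).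
  by apply: Or31; apply: (proj1 (ev_near _) h0).
have [g hg hfg] := hardy_inv hH h h0.
have [X hX] := proj1 (ev_near _) hfg.
have [a ha] := hardy_continuous hH h.
pose Y := Num.max X a.
have hY x : Y < x -> f x != 0 /\ {for x, continuous f}.
  rewrite gt_max => /andP[/hX h1 /ha h2]; split => //.
  by apply: contra_eq_neq h1 => ->; rewrite mul0r eq_sym oner_neq0.
pose x0 := Y + 1; have Yx0 : Y < x0 by rewrite ltrDl.
have hivt x : x0 <= x -> 0 < f x0 * f x.
  move=> x0x; rewrite ltNge; apply/negP => hle.
  have hc : {within `[x0, x], continuous f}.
    apply: continuous_in_subspaceT => y; rewrite inE /= in_itv /= => /andP[ay _].
    by have [_] := hY y (lt_le_trans Yx0 ay).
  have hm : Num.min (f x0) (f x) <= 0 <= Num.max (f x0) (f x).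
    rewrite ge_min le_max; have [f0|f0] := leP (f x0) 0.
      by rewrite /= leNgt; apply/negP => fx; move: hle; rewrite leNgt; nra.
    rewrite (ltW f0) /= andbT leNgt; apply/negP => fx.
    by move: hle; rewrite leNgt mulr_gt0.
  have [c] := IVT x0x hc hm.
  rewrite in_itv /= => /andP[c1 _] fc.
  by have [] := hY c (lt_le_trans Yx0 c1); rewrite fc eqxx.
have [f0 _] := hY x0 Yx0.
have [fn|fp|fz] := ltgtP (f x0) 0.
- apply: Or33; exists x0 => x /ltW /hivt; by rewrite nmulr_rgt0.
- apply: Or32; exists x0 => x /ltW /hivt; by rewrite pmulr_rgt0.
- by rewrite fz eqxx in f0.
Qed.

(** The field is not assumed to contain the identity function, so [c x^m - g] may lie outside it and
    [hardy_sign] does not apply. Differentiating [m] times leaves a natural constant minus a member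
    of the field; [weak_sign] carries the sign back. *)
Lemma hardy_xn_sign m g (c : nat) : H g ->
  ev (fun x => 0 <= c%:R * x ^+ m - g x) \/ ev (fun x => c%:R * x ^+ m - g x <= 0).
Proof.
elim: m g c => [|m IH] g c hg.
  have hs := hardy_sub hH (hardy_nat c) hg.
  case: (hardy_sign hs) => [h|h|h]; [left|left|right];
    apply: evW h => x; rewrite mulr1; [by move=> ->|exact: ltW|exact: ltW].
have hg' := hardy_deriv hH hg.
apply: (@weak_sign R _ (fun x => (c * m.+1)%N%:R * x ^+ m - derive1 g x)); last exact: IH.
apply: evW (hardy_der hg) => x hx; apply: derB hx.
by apply: der_eq (derZ c%:R (der_xn m.+1 x)) _; rewrite natrM mulrA.
Qed.

(* The sign of [x^m - c u / f] is eventually constant. *)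
Lemma hardy_persist f u m C : H f -> H u -> ev (fun x => 0 < u x) ->
  (forall X, exists2 x, X < x & `|f x| * x ^+ m <= C * u x) ->
  exists2 C', 0 <= C' & ev (fun x => `|f x| * x ^+ m <= C' * u x).
Proof.
move=> hf hu u0 hC.
wlog fpos : f hf hC / ev (fun x => f x = 0) \/ ev (fun x => 0 < f x).
  move=> hw; case: (hardy_sign hf) => h.
  - by apply: hw => //; left.
  - by apply: hw => //; right.
  have [||C' C0 h'] := hw _ (hardyN hf).
  - by move=> X; have [x Xx hx] := hC X; exists x => //; rewrite normrN.
  - by right; apply: evW h => x; rewrite oppr_gt0.
  by exists C' => //; apply: evW h' => x; rewrite normrN.
case: fpos => [f0|f0].
  by exists 0 => //; apply: evW f0 => x ->; rewrite normr0 !mul0r.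
have fn0 : ~ same_germ f (fun=> 0).
  move=> /(proj1 (ev_near _)) h; apply: (@ev_const R).
  by apply: evW2 h f0 => x ->; rewrite ltxx.
have [g hg hfg] := hardy_inv hH hf fn0.
(* A natural number, so that [hardy_nat] places the constant in [H]. *)
pose c := (Num.truncn C).+1; have hc : C < c%:R by rewrite truncnS_gt.
have hfg' := proj1 (ev_near _) hfg.
pose h x := c%:R * (u x * g x).
have hh : H h by apply: (hardy_mul hH (hardy_nat c)); apply: (hardy_mul hH hu).
exists c%:R => //.
have hE : ev (fun x => [/\ 0 < f x, 0 < u x & f x * h x = c%:R * u x]).
  apply: evW2 (ev_and f0 u0) hfg' => x [a b] e; split => //.
  have e2 : f x * h x = c%:R * u x * (f x * g x) by rewrite /h; ring.
  by rewrite e2 e mulr1.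
case: (@hardy_xn_sign m h 1 hh) => hs.
  exfalso; have [X hX] := ev_and hE hs; have [x Xx hx] := hC X.
  have [[f1 u1 e1] h1] := hX x Xx.
  have : 0 <= f x * (1%:R * x ^+ m - h x) by rewrite mulr_ge0 // ltW.
  rewrite mulrBr e1 mul1r; move: hx; rewrite (ger0_norm (ltW f1)); nra.
apply: evW2 hE hs => x [f1 u1 e1] h1.
have : f x * (1%:R * x ^+ m - h x) <= 0 by rewrite mulr_ge0_le0 // ltW.
by rewrite mulrBr e1 mul1r (ger0_norm (ltW f1)); lra.
Qed.

End Hardy.

(* The data extracted from the Hardy field: [F j] is the [j]-th derivative, and [k] is the largest order whose derivative does not tend to 0. *)
Record hardy_growth (R : realType) (F : nat -> R -> R) (k : nat) : Prop := HardyGrowth {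
  hg_field : exists2 H, hardy_field H & forall j, H (F j);
  hg_der : forall j, ev (fun x => der (F j) x (F j.+1 x));
  hg_pos : forall j, (j <= k)%N -> exists2 c, 0 < c & ev (fun x => c <= F j x);
  hg_small : forall eps, 0 < eps -> ev (fun x => `|F k.+1 x| <= eps) }.

(** * Growth of the derivatives of [alpha] *)

Section Growth.
Variable R : realType.
Implicit Types (x y C : R).

(** If every derivative stayed above a positive constant, integrating from an order [L >= l] would
    give [alpha >= c x^L], against sub-polynomial growth. At the first failure the derivative tends
    to 0: it is not eventually above [1 / n], and staying below [- 1 / n] would make the preceding
    derivative negative; [hardy_sign] turns these negations into eventual bounds. *)
Lemma hardy_growth_exists (alpha : R -> R) : sub_polynomial alpha ->
  alpha x @[x --> +oo_ R] --> +oo_ R ->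
  exists k F, F 0%N = alpha /\ hardy_growth F k.
Proof.
move=> [[H hH ha] [l l0 hl]] hoo.
pose F j := iter j (@derive1 R R) alpha.
have hF j : H (F j) by elim: j => //= j; apply: hardy_deriv.
have hd j : ev (fun x => der (F j) x (F j.+1 x)) by apply: hardy_der (hF j).
pose P j := exists2 c, 0 < c & ev (fun x => c <= F j x).
have P0 : P 0%N.
  by exists 1 => //; apply: (proj1 (ev_near _)); apply: (proj1 (cvgryPge _) hoo).
have hstep j : P j -> ~ P j.+1 -> forall eps, 0 < eps -> ev (fun x => `|F j.+1 x| <= eps).
  move=> [c c0 hc] nP eps eps0.
  pose n := (Num.truncn eps^-1).+1; have n0 : 0 < n%:R :> R by [].
  have hn : n%:R^-1 <= eps.
    by rewrite -[leRHS]invrK lef_pV2 ?posrE ?invr_gt0 // ltW // truncnS_gt.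
  have hnF := hardy_mul hH (hardy_nat hH n) (hF j.+1).
  have h1 : ev (fun x => n%:R * F j.+1 x <= 1).
    have hE : ~ ev (fun x => 0 < n%:R * F j.+1 x - 1).
      move=> h; apply: nP; exists n%:R^-1; first by rewrite invr_gt0.
      apply: evW h => x; rewrite subr_gt0 => /ltW h; rewrite -(ler_pM2l n0).
      by rewrite mulfV ?lt0r_neq0.
    case: (hardy_sign hH (hardy_sub hH hnF (hardy_one hH))) => // h.
      by apply: evW h => x /eqP; rewrite subr_eq0 => /eqP ->.
    by apply: evW h => x; rewrite subr_lt0 => /ltW.
  have h2 : ev (fun x => -1 <= n%:R * F j.+1 x).
    have hE : ~ ev (fun x => n%:R * F j.+1 x + 1 <= 0).
      move=> h; have [X hX] := ev_and (ev_and h hc) (hd j).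
      pose a := X + 1; have Xa : X < a by rewrite ltrDl.
      pose b := a + (`|F j a| + 1) * n%:R.
      have ab : a < b by rewrite ltrDl mulr_gt0 // ltr_wpDl.
      have [xi [x1 x2 x3]] := mvt (fun x hx => (hX x hx).2) Xa ab.
      have [[y1 _] _] := hX xi (lt_trans Xa x1).
      have [[_ y2] _] := hX b (lt_trans Xa ab).
      have hba : b - a = (`|F j a| + 1) * n%:R by rewrite /b addrC addKr.
      have : F j b - F j a <= - (`|F j a| + 1).
        rewrite x3 hba mulrCA -mulrN1 ler_wpM2l ?addr_ge0 //.
        by rewrite mulrC; lra.
      have := ler_norm (F j a); lra.
    case: (hardy_sign hH (hardyD hH hnF (hardy_one hH))) => h.
    - by case: hE; apply: evW h => x ->.
    - by apply: evW h => x; lra.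
    - by case: hE; apply: evW h => x /ltW.
  apply: evW2 h1 h2 => x a1 a2; apply: le_trans hn.
  rewrite -(ler_pM2l n0) mulfV ?lt0r_neq0 // -{1}(ger0_norm (ltW n0)) -normrM.
  by rewrite ler_norml; apply/andP; split; lra.
have [hall|hnall] := pselect (forall j, P j).
  exfalso; pose L := (Num.truncn l).+1.
  have lL : l <= L%:R by rewrite ltW // truncnS_gt.
  have hpow i j : (i + j = L)%N -> exists2 c, 0 < c & ev (fun x => c * x ^+ i <= F j x).
    elim: i j => [|i IH] j ij.
      by have [c c0 hc] := hall j; exists c => //; apply: evW hc => x; rewrite mulr1.
    have [c c0 hc] := IH j.+1 ltac:(by rewrite addnS -addSn).
    have [c2 c20 hc2] := hall j.
    exists (c / 2 ^+ i.+1); first by rewrite divr_gt0 // exprn_gt0.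
    have [X hX] := ev_and (ev_and hc hc2) (hd j).
    exists (2 * Num.max X 0 + 1) => x hx.
    pose M := Num.max X 0; have M0 : 0 <= M by rewrite le_max lexx orbT.
    have XM : X <= M by rewrite le_max lexx.
    have x0 : 0 < x by move: hx; rewrite -/M; lra.
    have Xx2 : X < x / 2 by move: hx; rewrite -/M; lra.
    have xx2 : x / 2 < x by lra.
    have [xi [x1 x2 x3]] := mvt (fun x hx => (hX x hx).2) Xx2 xx2.
    have [[y1 _] _] := hX xi (lt_trans Xx2 x1).
    have [[_ y2] _] := hX _ Xx2.
    have : (x / 2) ^+ i <= xi ^+ i by rewrite lerXn2r ?nnegrE ?divr_ge0 ?(ltW x0) ?(ltW x1) // ltW // (lt_trans _ x1) // divr_gt0.
    move=> hxi; have hc3 : c * (x / 2) ^+ i <= F j.+1 xi by apply: le_trans y1; rewrite ler_pM2l.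
    have : c * (x / 2) ^+ i * (x / 2) <= F j.+1 xi * (x / 2) by rewrite ler_wpM2r // divr_ge0 // ltW.
    have -> : c / 2 ^+ i.+1 * x ^+ i.+1 = c * (x / 2) ^+ i * (x / 2).
      by rewrite -[RHS]mulrA -exprSr exprMn exprVn; ring.
    by move: x3; (have -> : x - x / 2 = x / 2 by lra); lra.
  have [c c0 hc] := hpow L 0%N (addn0 L).
  have hl2 : ev (fun t => `|0 - alpha t / t `^ l| < c).
    by apply/ev_near; move/cvgrPdist_lt : hl => /(_ c c0).
  have [X hX] := ev_and (ev_and hc hl2) (ev_gt 1).
  pose x := X + 1; have [[h1 h2] x1] := hX x ltac:(by rewrite ltrDl).
  have xl0 : 0 < x `^ l by rewrite powR_gt0 // (lt_trans ltr01).
  have hxl : x `^ l <= x ^+ L.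
    by rewrite -powR_mulrn ?(ltW (lt_trans ltr01 x1)) //; apply: ler_powR => //; exact: ltW.
  move: h2; rewrite sub0r normrN normrM normfV (gtr0_norm xl0) ltr_pdivrMr // => h2.
  have := ler_norm (alpha x).
  have : c * x `^ l <= c * x ^+ L by rewrite ler_pM2l.
  move: h1; rewrite -[F 0%N]/alpha; lra.
have [k [hk1 hk2]] : exists k, (forall j, (j <= k)%N -> P j) /\ ~ P k.+1.
  apply: contrapT => hn; apply: hnall => j.
  have : forall i, (i <= j)%N -> P i; last exact.
  elim: j => [|j IH] i; first by rewrite leqn0 => /eqP ->.
  rewrite leq_eqVlt => /orP[/eqP->|]; last exact: IH.
  by apply: contrapT => nP; apply: hn; exists j.
exists k, F; split => //; split => //; first by exists H.
exact: hstep (hk1 k (leqnn _)) hk2.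
Qed.

Section WithF.
Variables (F : nat -> R -> R) (k : nat).
Hypothesis hF : hardy_growth F k.

Lemma hg_sign j : [\/ ev (fun x => F j x = 0), ev (fun x => 0 < F j x) | ev (fun x => F j x < 0)].
Proof. by case: (hg_field hF) => H hH h; apply: hardy_sign hH _ (h j). Qed.

(** If [F k.+1 <= 0] eventually, [F k] decreases and is bounded below by a positive constant, so all
    its values are comparable. If [F k.+1 > 0], its tending to 0 forces [F k.+2 <= 0]; then [F k] is
    increasing and concave, and its slope at [x] is at most [2 F k x / x], whence [1 + 2 / rho]. *)
Lemma Fk_cmp rho : 0 < rho -> exists2 C, 0 < C & exists X, forall x y, X < x -> X < y -> rho * y <= x -> F k y <= C * F k x.
Proof.
move=> rho0.
have [c c0 hc] := hg_pos hF (leqnn k).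
have hle : ev (fun x => F k.+1 x <= 0) -> exists2 C, 0 < C & exists X, forall x y, X < x -> X < y -> rho * y <= x -> F k y <= C * F k x.
  move=> h; have [X hX] := ev_and (ev_and hc h) (hg_der hF k).
  have hm := der_le0_mono (fun x hx => (hX x hx).2) (fun x hx => (hX x hx).1.2).
  pose a := X + 1; have Xa : X < a by rewrite ltrDl.
  have [[fa _] _] := hX a Xa.
  have fa0 : 0 < F k a := lt_le_trans c0 fa.
  exists (F k a / c); first by rewrite divr_gt0.
  exists a => x y ax ay _; apply: le_trans (hm _ _ Xa (ltW ay)) _.
  have [[fx _] _] := hX x (lt_trans Xa ax).
  by rewrite mulrAC ler_pdivlMr // ler_pM2l.
case: (hg_sign k.+1) => h.
- by apply: hle; apply: evW h => x ->.
- have h2 : ev (fun x => F k.+2 x <= 0).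
    have hn : ~ ev (fun x => 0 <= F k.+2 x).
      move=> h2; have [X hX] := ev_and (ev_and h h2) (hg_der hF k.+1).
      have hm := der_ge0_mono (fun x hx => (hX x hx).2) (fun x hx => (hX x hx).1.2).
      pose a := X + 1; have Xa : X < a by rewrite ltrDl.
      have [[fa _] _] := hX a Xa.
      have fa2 : 0 < F k.+1 a / 2 by rewrite divr_gt0.
      have [Y hY] := hg_small hF fa2.
      pose x := Num.max a Y + 1.
      have ax : a < x by rewrite /x ltr_pwDr // le_max lexx.
      have Yx : Y < x by rewrite /x ltr_pwDr // le_max lexx orbT.
      have := hm a x Xa (ltW ax); have := hY x Yx; have := ler_norm (F k.+1 x); lra.
    case: (hg_sign k.+2) => h2.
    + by case: hn; apply: evW h2 => x ->.
    + by case: hn; apply: evW h2 => x /ltW.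
    + by apply: evW h2 => x /ltW.
  have [X hX] := ev_and (ev_and (ev_and (ev_and hc h) h2) (hg_der hF k)) (hg_der hF k.+1).
  pose Y := Num.max X 0; have Y0 : 0 <= Y by rewrite le_max lexx orbT.
  have XY : X <= Y by rewrite le_max lexx.
  have hm1 := der_ge0_mono (fun x hx => (hX x hx).1.2) (fun x hx => ltW (hX x hx).1.1.1.2).
  have hm2 := der_le0_mono (fun x hx => (hX x hx).2) (fun x hx => (hX x hx).1.1.2).
  exists (1 + 2 / rho); first by rewrite ltr_pwDl // divr_ge0 // ltW.
  exists (2 * Y) => x y Yx Yy hxy.
  have Xx : X < x by lra.
  have Xy : X < y by lra.
  have x0 : 0 < x by lra.
  have [[[[fx f1x] _] _] _] := hX x Xx.
  have fx0 : 0 < F k x := lt_le_trans c0 fx.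
  have r0 : 0 <= 2 / rho by rewrite divr_ge0 // ltW.
  have [yx|xy] := leP y x.
    by apply: le_trans (hm1 _ _ Xy yx) _; rewrite ler_peMl ?(ltW fx0) // lerDl.
  have [xi [x1 _ x3]] := mvt (fun x hx => (hX x hx).1.2) Xx xy.
  have Xx2 : X < x / 2 by lra.
  have xx2 : x / 2 < x by lra.
  have [xj [y1 y2 y3]] := mvt (fun x hx => (hX x hx).1.2) Xx2 xx2.
  have a1 : F k.+1 xi <= F k.+1 x := hm2 _ _ Xx (ltW x1).
  have a2 : F k.+1 x <= F k.+1 xj := hm2 _ _ (lt_trans Xx2 y1) (ltW y2).
  have [[[[fx2 _] _] _] _] := hX _ Xx2.
  have a3 : F k.+1 x * (x / 2) <= F k x.
    have : F k.+1 x * (x / 2) <= F k.+1 xj * (x / 2) by rewrite ler_wpM2r // ltW // divr_gt0.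
    by move: y3; (have -> : x - x / 2 = x / 2 by lra); lra.
  have a4 : F k y - F k x <= F k.+1 x * (x / rho).
    rewrite x3; apply: ler_pM => //; [|lra|].
    - have [[[[_ f1] _] _] _] := hX xi (lt_trans Xx x1); exact: ltW.
    - have : y <= x / rho by rewrite ler_pdivlMr // mulrC.
      lra.
  have -> : (1 + 2 / rho) * F k x = F k x + 2 / rho * F k x by ring.
  have : 2 / rho * (F k.+1 x * (x / 2)) <= 2 / rho * F k x by rewrite ler_wpM2l.
  have -> : 2 / rho * (F k.+1 x * (x / 2)) = F k.+1 x * (x / rho) by field; rewrite lt0r_neq0.
  lra.
- by apply: hle; apply: evW h => x /ltW.
Qed.

(** Downward integration by the mean value theorem, on [[x / 2, x]] for the lower bound and from a
    fixed [a] to [x] for the upper one; [Fk_cmp] replaces [F k] at the intermediate point by its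
    value at [x]. *)
Lemma F_bounds i : (i <= k)%N -> exists c C, [/\ 0 < c, 0 < C &
  ev (fun x => c * (x ^+ i * F k x) <= F (k - i)%N x <= C * (x ^+ i * F k x))].
Proof.
elim: i => [|i IH] ik.
  by exists 1, 1; split => //; apply: evT => x; rewrite subn0 !mul1r lexx.
have [c [C [c0 C0 hcC]]] := IH (ltnW ik).
set j := (k - i.+1)%N; have hj : (k - i = j.+1)%N by rewrite /j subnSK.
rewrite hj in hcC.
have jk : (j <= k)%N by rewrite leq_subr.
have [ck ck0 hck] := hg_pos hF (leqnn k).
have [cj cj0 hcj] := hg_pos hF jk.
have [C2 C20 [X2 hX2]] := Fk_cmp (ltac:(by []) : 0 < (2^-1 : R)).
have [C1 C10 [X1 hX1]] := Fk_cmp (ltr01 : 0 < (1 : R)).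
have [X hX] := ev_and (ev_and (ev_and (ev_and hcC hck) hcj) (hg_der hF j)) (ev_and (ev_gt 1) (ev_and (ev_gt X1) (ev_gt X2))).
have {}hX x : X < x -> [/\ c * (x ^+ i * F k x) <= F j.+1 x <= C * (x ^+ i * F k x), ck <= F k x, cj <= F j x,
    der (F j) x (F j.+1 x) & [/\ 1 < x, X1 < x & X2 < x]].
  by move=> /hX [[[[a b] d] f] [g [h1 h2]]]; split => //.
pose a := X + 1; have Xa : X < a by rewrite ltrDl.
exists (c / (2 ^+ i.+1 * C2)), (F j a / ck + C * C1).
have [_ _ fa _ _] := hX a Xa.
have fa0 : 0 < F j a := lt_le_trans cj0 fa.
split.
- by rewrite divr_gt0 // mulr_gt0 // exprn_gt0.
- by rewrite addr_gt0 ?divr_gt0 ?mulr_gt0.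
exists (2 * Num.max a 0) => x hx.
set M := Num.max a 0 in hx; have M0 : 0 <= M by rewrite le_max lexx orbT.
have aM : a <= M by rewrite le_max lexx.
have Xx : X < x by lra.
have [hx1 hx2 hx3 hx4 [hx5 hx6 hx7]] := hX x Xx.
have x0 : 0 < x by lra.
have fkx : 0 < F k x := lt_le_trans ck0 hx2.
apply/andP; split.
- have Xx2 : X < x / 2 by lra.
  have xx2 : x / 2 < x by lra.
  have [xi [x1 x2 x3]] := mvt (fun x hx => let: And5 _ _ _ h _ := hX x hx in h) Xx2 xx2.
  have Xxi : X < xi by lra.
  have [/andP[hx1' _] _ _ _ [hx5' hx6' hx7']] := hX xi Xxi.
  have [_ _ fx2 _ _] := hX _ Xx2.
  have b1 : F k x <= C2 * F k xi by apply: hX2 => //; lra.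
  have b2 : (x / 2) ^+ i <= xi ^+ i by rewrite lerXn2r ?nnegrE; move: x1 x0; clear; lra.
  have b3 : 0 <= (x / 2) ^+ i by rewrite exprn_ge0 // divr_ge0 // ltW.
  have -> : c / (2 ^+ i.+1 * C2) * (x ^+ i.+1 * F k x) = c * ((x / 2) ^+ i * (F k x / C2)) * (x / 2).
    rewrite exprMn exprVn !exprSr; field; rewrite lt0r_neq0 // expf_neq0 //.
  have b4 : F k x / C2 <= F k xi by rewrite ler_pdivrMr // mulrC.
  have b5 : (x / 2) ^+ i * (F k x / C2) <= xi ^+ i * F k xi.
    by apply: ler_pM => //; rewrite divr_ge0 // ltW.
  have b6 : c * ((x / 2) ^+ i * (F k x / C2)) <= F j.+1 xi by apply: le_trans hx1'; rewrite ler_pM2l.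
  have : c * ((x / 2) ^+ i * (F k x / C2)) * (x / 2) <= F j.+1 xi * (x / 2) by rewrite ler_wpM2r // divr_ge0 // ltW.
  by move: x3; (have -> : x - x / 2 = x / 2 by lra); lra.
- have ax : a < x by lra.
  have [xi [x1 x2 x3]] := mvt (fun x hx => let: And5 _ _ _ h _ := hX x hx in h) Xa ax.
  have Xxi : X < xi by lra.
  have [/andP[_ hx1'] hx2' _ _ [hx5' hx6' hx7']] := hX xi Xxi.
  have b1 : F k xi <= C1 * F k x by apply: hX1 => //; lra.
  have b2 : xi ^+ i <= x ^+ i by rewrite lerXn2r ?nnegrE; move: x2 hx5' x0; clear; lra.
  have b0 : 0 <= F k xi by rewrite (le_trans (ltW ck0)).
  have b3 : xi ^+ i * F k xi <= x ^+ i * (C1 * F k x).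
    by apply: ler_pM => //; rewrite exprn_ge0 //; lra.
  have b4 : F j.+1 xi <= C * (x ^+ i * (C1 * F k x)) by apply: le_trans hx1' _; rewrite ler_pM2l.
  have b5 : F j.+1 xi * (x - a) <= C * (x ^+ i * (C1 * F k x)) * x.
    have [_ _ _ _ [a1 _ _]] := hX a Xa.
    apply: le_trans (_ : C * (x ^+ i * (C1 * F k x)) * (x - a) <= _).
      by rewrite ler_wpM2r //; lra.
    rewrite ler_wpM2l //; last lra.
    by rewrite !mulr_ge0 ?exprn_ge0 // ltW.
  have b6 : F j a <= F j a / ck * (x ^+ i.+1 * F k x).
    rewrite mulrAC ler_pdivlMr // ler_pM2l //.
    have : 1 <= x ^+ i.+1 by rewrite exprn_ege1 // ltW.
    nra.
  have -> : (F j a / ck + C * C1) * (x ^+ i.+1 * F k x) = F j a / ck * (x ^+ i.+1 * F k x) + C * (x ^+ i * (C1 * F k x)) * x.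
    by rewrite exprSr; ring.
  lra.
Qed.

End WithF.
End Growth.

(** * Resonances force the excluded form of [alpha] *)

Section Rigidity.
Variable R : realType.
Implicit Types (x y c C : R) (q : {poly R}).

Lemma horner_derivn_top q n x : (size q <= n.+1)%N -> q^`(n).[x] = n`!%:R * q`_n.
Proof.
move=> hq; have h1 : (size q^`(n) <= 1)%N.
  rewrite -[q]addr0; apply/leq_sizeP => j j0; rewrite addr0 coef_derivn.
  by rewrite nth_default ?mul0rn // (leq_trans hq) // -addn1 leq_add2l.
by rewrite (size1_polyC h1) hornerC coef_derivn addn0 ffactnn mulr_natl.
Qed.

(** The [d]-th difference of [q] is [d! s^d] times the coefficient of degree [d], and it kills [c]
    because [d > 0]. *)
Lemma dlt_poly q d x s E c : 0 < s -> (forall i, (i <= d)%N -> `|q.[x + i%:R * s] - c| <= E) ->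
  (size q <= d.+1)%N -> (0 < d)%N -> `|q`_d| <= 2 ^+ d * E / s ^+ d.
Proof.
move=> s0 hq sq d0; pose G j y := (q - c%:P)^`(j).[y].
have hG j : (j < d)%N -> forall y, x - 1 < y -> der (G j) y (G j.+1 y).
  by move=> _ y _; rewrite /G derivnS; apply: der_poly.
have xx : x - 1 < x by rewrite ltrBlDr ltrDl.
have [xi [_ _ h]] := dlt_mvt hG xx s0.
have := @dlt_bound _ d (G 0%N) x s E; rewrite h.
have -> : G d xi = d`!%:R * q`_d.
  rewrite /G derivnB derivnC; case: d d0 {sq hq hG h} (sq) => // d _ sq.
  by rewrite subr0 horner_derivn_top.
move=> h1; have h2 : `|s ^+ d * (d`!%:R * q`_d)| <= 2 ^+ d * E.
  by apply: h1 => i id; rewrite /G derivn0 hornerD hornerN hornerC; apply: hq.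
have sd : 0 < s ^+ d by rewrite exprn_gt0.
rewrite ler_pdivlMr // mulrC; apply: le_trans h2.
rewrite !normrM (gtr0_norm sd) ler_pM2l // ler_peMl // ger0_norm // ler1n fact_gt0 //.
Qed.

(** [dlt_poly] bounds the top coefficient; its monomial is then at most [K1 * E] on [[0, N]], so
    subtracting it leaves a polynomial near [c] with error [(1 + K1) * E]. *)
Lemma poly_coef_bound k (rho : R) : 0 < rho -> exists2 K : R, 0 <= K &
  forall q x s N E c, (size q <= k.+1)%N -> 0 < N -> rho * N <= s -> 0 <= x -> x + k%:R * s <= N -> 0 <= E ->
    (forall i, (i <= k)%N -> `|q.[x + i%:R * s] - c| <= E) ->
    forall d, (0 < d <= k)%N -> `|q`_d| <= K * E / N ^+ d.
Proof.
move=> rho0; elim: k => [|k [K K0 IH]].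
  by exists 0 => // q x s N E c _ _ _ _ _ _ _ d; case: d.
pose K1 := (2 / rho) ^+ k.+1.
have K10 : 0 <= K1 by rewrite exprn_ge0 // divr_ge0 // ltW.
exists (K * (1 + K1) + K1); first by rewrite addr_ge0 // mulr_ge0 // addr_ge0.
move=> q x s N E c hq N0 hs x0 hx E0 h d /andP[d0 dk].
have s0 : 0 < s by apply: lt_le_trans hs; rewrite mulr_gt0.
have hn0 n : 0 < N ^+ n by rewrite exprn_gt0.
have htop : `|q`_k.+1| <= K1 * E / N ^+ k.+1.
  have := dlt_poly s0 h hq isT; move=> h1; apply: le_trans h1 _.
  have -> : K1 * E / N ^+ k.+1 = 2 ^+ k.+1 * E / (rho * N) ^+ k.+1.
    rewrite /K1 !exprMn exprVn; field; rewrite ?expf_neq0 ?lt0r_neq0 //.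
  rewrite ler_wpM2l ?mulr_ge0 ?exprn_ge0 // lef_pV2 ?posrE ?exprn_gt0 ?mulr_gt0 //.
  by rewrite lerXn2r ?nnegrE ?mulr_ge0 // ltW.
have hE : K * (1 + K1) * E / N ^+ d <= (K * (1 + K1) + K1) * E / N ^+ d.
  by rewrite ler_wpM2r ?invr_ge0 ?(ltW (hn0 _)) // ler_wpM2r // lerDl.
move: dk; rewrite leq_eqVlt => /orP[/eqP->|dk].
  apply: le_trans htop _; rewrite ler_wpM2r ?invr_ge0 ?(ltW (hn0 _)) // ler_wpM2r // lerDr.
  by rewrite mulr_ge0 // addr_ge0.
pose q' := q - q`_k.+1 *: 'X^(k.+1).
have sq' : (size q' <= k.+1)%N.
  apply/leq_sizeP => j; rewrite leq_eqVlt => /orP[/eqP<-|kj].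
    by rewrite coefB coefZ coefXn eqxx mulr1 subrr.
  by rewrite coefB coefZ coefXn gtn_eqF // mulr0 subr0 nth_default // (leq_trans hq).
have hq' : `|q'`_d| <= K * (E * (1 + K1)) / N ^+ d.
  apply: (IH q' x s N (E * (1 + K1)) c) => //.
  - apply: le_trans hx; rewrite lerD2l ler_wpM2r ?(ltW s0) //.
    by rewrite ler_nat.
  - by rewrite mulr_ge0 // addr_ge0.
  - move=> i ik; rewrite /q' hornerD hornerN hornerZ hornerXn.
    set y := x + _; have y0 : 0 <= y by rewrite addr_ge0 // mulr_ge0 // ltW.
    have yN : y <= N by apply: le_trans hx; rewrite lerD2l ler_wpM2r ?(ltW s0) // ler_nat leqW.
    have a1 := h i (leqW ik).
    have a2 : `|q`_k.+1 * y ^+ k.+1| <= K1 * E.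
      rewrite normrM (ger0_norm (exprn_ge0 _ y0)).
      apply: le_trans (_ : K1 * E / N ^+ k.+1 * N ^+ k.+1 <= _); last by rewrite divfK ?lt0r_neq0.
      by apply: ler_pM => //; [exact: exprn_ge0|rewrite lerXn2r // ?nnegrE // ltW].
    have -> : q.[y] - q`_k.+1 * y ^+ k.+1 - c = (q.[y] - c) - q`_k.+1 * y ^+ k.+1 by ring.
    apply: le_trans (ler_normB _ _) _; move: a1 a2; rewrite -/y; lra.
  - by rewrite d0 -ltnS.
apply: le_trans hE; apply: le_trans (_ : K * (E * (1 + K1)) / N ^+ d <= _); last first.
  by rewrite [X in _ <= X / _](_ : _ = K * (E * (1 + K1))) //; ring.
by move: hq'; rewrite coefB coefZ coefXn ltn_eqF // mulr0 subr0.
Qed.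

Lemma near_int_int (a : R) : (forall eps, 0 < eps -> exists z : int, `|a - z%:~R| <= eps) ->
  exists z : int, a = z%:~R.
Proof.
move=> h; have [z hz] := h 4^-1 ltac:(by []); exists z; apply/eqP; rewrite -subr_eq0 -normr_le0 leNgt.
apply/negP => d0; have d1 : 0 < `|a - z%:~R| / 2 by rewrite divr_gt0.
have [z' hz'] := h _ d1.
have : z = z'.
  apply/eqP; rewrite eq_le -!ltzD1 -!(ltr_int R) !intrD.
  have hz2 : `|a - z'%:~R| <= 4^-1 / 2 by lra.
  move: hz hz2; rewrite !mulr1z !ler_norml; clear => /andP[? ?] /andP[? ?].
  by apply/andP; split; lra.
move=> zz; move: hz'; rewrite -zz; lra.
Qed.

Lemma log_over_n eps : 0 < eps -> exists N0 : nat, forall N : nat, (N0 <= N)%N -> (1 + ln N%:R) / N%:R <= eps :> R.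
Proof.
move=> eps0; exists (Num.truncn (9 / eps ^+ 2)).+2 => N hN.
have hN' : 9 / eps ^+ 2 < N%:R.
  by apply: lt_le_trans (truncnS_gt _) _; rewrite ler_nat ltnW.
have N1 : 1 <= N%:R :> R by rewrite ler1n (leq_trans _ hN).
have N0 : 0 < N%:R :> R by apply: lt_le_trans N1.
pose t := Num.sqrt N%:R : R.
have tt : t ^+ 2 = N%:R by rewrite sqr_sqrtr // ltW.
have t0 : 0 < t by rewrite sqrtr_gt0.
have t1 : 1 <= t by rewrite -sqrtr1 ler_wsqrtr.
have hl : ln N%:R <= 2 * t.
  have := ln_sublinear t0; rewrite -tt lnXn //.
  by move=> h; lra.
have ht : 3 <= eps * t.
  rewrite -(@ler_pXn2r _ 2) ?nnegrE ?mulr_ge0 ?(ltW t0) ?(ltW eps0) // exprMn tt.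
  move: hN'; rewrite ltr_pdivrMr ?exprn_gt0 // => /ltW; rewrite (mulrC N%:R).
  by rewrite (_ : 3 ^+ 2 = 9) // -natrX.
have e2 : eps * N%:R = eps * t * t by rewrite -tt expr2 mulrA.
have e3 : 3 * t <= eps * t * t by rewrite ler_wpM2r // ltW.
by rewrite ler_pdivrMr // e2; move: e3 hl t1; clear; lra.
Qed.

Lemma int_norm_ge1 (z : int) : z != 0 -> 1 <= `|z%:~R| :> R.
Proof. by move=> z0; rewrite -intr_norm ler1z -gtz0_ge1 normr_gt0. Qed.

Section WithF.
Variables (F : nat -> R -> R) (k : nat).
Hypotheses (hF : hardy_growth F k) (k0 : (0 < k)%N).

(** What a large sum at frequency [lam] yields, reduced to [k.+2] equally spaced points, as many as
    differences of order [k] and [k.+1] require. *)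
Definition resonant (kap rho : R) (Q : nat) (C : R) (N : nat) (lam : R) (r s : nat) (p : {poly int}) (c : R) :=
  [/\ [/\ `|lam| <= 2 & kap <= `|lam| * F 1%N N%:R], (size p <= k.+1)%N,
      [/\ rho * N%:R <= r%:R, rho * N%:R <= s%:R & (r + k.+1 * s <= N)%N] &
      forall i, (i <= k.+1)%N -> `|lam * F 0%N (r + i * s)%N%:R - evz p (r + i * s)%N%:R / Q%:R - c| <= C].

(** Differences of the approximation become derivatives by [dlt_mvt]: order [k] sees only the
    coefficient [p_k], order [k.+1] sees nothing of [p]. As the spacing is at least [rho * N], the
    error [C] shrinks to [O(N^-k)] and [O(N^-(k+1))]. *)
Lemma resonant_taylor kap rho Q C : 0 < rho -> rho <= 1 -> 0 <= C -> (0 < Q)%N ->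
  exists2 C1, 0 <= C1 & exists N0 : nat, forall N lam r s p c, (N0 <= N)%N -> resonant kap rho Q C N lam r s p c ->
  exists xi xi', [/\ rho * N%:R <= xi, xi <= N%:R, rho * N%:R <= xi', xi' <= N%:R &
    `|lam * F k xi - k`!%:R * (p`_k)%:~R / Q%:R| <= C1 / N%:R ^+ k /\ `|lam * F k.+1 xi'| <= C1 / N%:R ^+ k.+1].
Proof.
move=> rho0 rho1 C0 Q0; pose C1 := 2 ^+ k.+1 * C / rho ^+ k.+1.
have C10 : 0 <= C1 by rewrite divr_ge0 ?mulr_ge0 ?exprn_ge0 // ltW.
have [X hX] := ev_all (fun j (_ : (j <= k)%N) => hg_der hF j).
exists C1 => //; exists (Num.truncn (`|X| / rho)).+1 => N lam r s p c hN [_ sp [hr hs hrs] hp].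
have N0 : 0 < N%:R :> R by rewrite ltr0n (leq_trans _ hN).
have Xr : X < r%:R.
  apply: lt_le_trans hr; apply: le_lt_trans (ler_norm X) _.
  have : `|X| / rho < N%:R by apply: lt_le_trans (truncnS_gt _) _; rewrite ler_nat.
  by rewrite ltr_pdivrMr // mulrC.
have s0 : 0 < s%:R :> R by apply: lt_le_trans hs; rewrite mulr_gt0.
pose P : {poly R} := Q%:R^-1 *: map_poly intr p + c%:P.
have sP : (size P <= k.+1)%N.
  apply: leq_trans (size_polyD _ _) _; rewrite geq_max (leq_trans (size_scale_leq _ _)) /=; last first.
    exact: leq_trans (size_poly _ _) sp.
  by rewrite (leq_trans (size_polyC_leq1 _)).
pose G j y := lam * F j y - P^`(j).[y].
have hG d : (d <= k.+1)%N -> forall j, (j < d)%N -> forall y, X < y -> der (G j) y (G j.+1 y).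
  move=> dk j jd y Xy; rewrite /G derivnS; apply: derB; last exact: der_poly.
  by apply: derZ; apply: hX Xy _ _; rewrite -ltnS (leq_trans jd).
have hmain d : (d <= k.+1)%N -> (k <= d)%N -> exists xi, [/\ rho * N%:R <= xi, xi <= N%:R & `|G d xi| <= C1 / N%:R ^+ d].
  move=> dk kd; have [xi [h1 h2 h3]] := dlt_mvt (hG d dk) Xr s0.
  exists xi; split; first exact: le_trans hr h1.
    apply: le_trans h2 _; rewrite -natrM -natrD ler_nat; apply: leq_trans hrs.
    by rewrite leq_add2l leq_mul2r dk orbT.
  have := @dlt_bound _ d (G 0%N) r%:R s%:R C; rewrite h3 => h4.
  have h5 : `|s%:R ^+ d * G d xi| <= 2 ^+ d * C.
    apply: h4 => i id; rewrite /G derivn0 -natrM -natrD hornerD hornerC hornerZ opprD addrA.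
    have := hp i (leq_trans id dk); rewrite /evz.
    by congr (`|_| <= _); ring.
  have sd : 0 < s%:R ^+ d :> R by rewrite exprn_gt0.
  move: h5; rewrite normrM (gtr0_norm sd) -ler_pdivlMl // => h5; apply: le_trans h5 _.
  rewrite mulrC; apply: le_trans (_ : 2 ^+ k.+1 * C / s%:R ^+ d <= _).
    by rewrite ler_wpM2r ?invr_ge0 ?(ltW sd) // ler_wpM2r // ler_weXn2l // ler1n.
  rewrite /C1 -!mulrA ler_wpM2l ?exprn_ge0 // ler_wpM2l // -invfM lef_pV2 ?posrE ?mulr_gt0 ?exprn_gt0 //.
  apply: le_trans (_ : (rho * N%:R) ^+ d <= _); last first.
    by rewrite lerXn2r ?nnegrE ?mulr_ge0 ?(ltW rho0) // ltW.
  rewrite exprMn ler_wpM2r ?exprn_ge0 // ?(ltW N0) // ler_wiXn2l // ltW //.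
have [xi [a1 a2 a3]] := hmain k (leqnSn _) (leqnn _).
have [xi' [b1 b2 b3]] := hmain k.+1 (leqnn _) (leqnSn _).
exists xi, xi'; split => //; split.
  move: a3; rewrite /G horner_derivn_top // /P coefD coefC gtn_eqF // addr0 coefZ coef_map /=.
  by rewrite [Q%:R^-1 * _]mulrC mulrA.
by move: b3; rewrite /G derivn_poly0 // horner0 subr0.
Qed.


(** With [p_k = 0], [|lam| F k] would be [O(N^-k)]; as [F 1 N] is of order [N^(k-1) F k N],
    [|lam| F 1 N] would be [O(1 / N)], below [kap]. *)
Lemma resonant_lead kap rho Q C : 0 < kap -> 0 < rho -> rho <= 1 -> 0 <= C -> (0 < Q)%N ->
  exists N0 : nat, forall N lam r s p c, (N0 <= N)%N -> resonant kap rho Q C N lam r s p c -> p`_k != 0.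
Proof.
move=> kap0 rho0 rho1 C0 Q0.
have [C1 C10 [N1 hN1]] := resonant_taylor kap rho0 rho1 C0 Q0.
have [C2 C20 [X2 hX2]] := Fk_cmp hF rho0.
have k1k : (k.-1 <= k)%N by apply: leq_pred.
have [c3 [C3 [c30 C30 [X3 hX3]]]] := F_bounds hF k1k.
have hk1 : (k - k.-1 = 1)%N by case: (k) k0 => // k' _; rewrite /= subSnn.
rewrite hk1 in hX3.
pose X := Num.max (Num.max X2 X3) 1.
exists (maxn N1 (Num.truncn (Num.max (X / rho) (C3 * C2 * C1 / kap))).+1) => N lam r s p c.
rewrite geq_max => /andP[hN hNX] hres; apply/eqP => p0.
have [xi [xi' [x1 x2 _ _ [+ _]]]] := hN1 N lam r s p c hN hres.
rewrite p0 mulr0 mul0r subr0 => h.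
have [[_ hkap] _ _ _] := hres.
have : Num.max (X / rho) (C3 * C2 * C1 / kap) < N%:R by apply: lt_le_trans (truncnS_gt _) _; rewrite ler_nat.
rewrite gt_max => /andP[hX hC].
have XN : X < rho * N%:R by rewrite mulrC -ltr_pdivrMr.
have X1 : 1 <= X by rewrite le_max lexx orbT.
have [XX2 XX3] : X2 <= X /\ X3 <= X by rewrite /X !le_max !lexx !orbT.
have Xn : X < N%:R by apply: lt_le_trans (lt_le_trans XN x1) x2.
have n0 : 0 < N%:R :> R by lra.
have hF1 : `|lam| * F 1%N N%:R <= C3 * C2 * C1 / N%:R.
  have /andP[_ a1] := hX3 N%:R (le_lt_trans XX3 Xn).
  have a2 : F k N%:R <= C2 * F k xi by apply: hX2 => //; lra.
  have a3 : `|lam| * F k xi <= C1 / N%:R ^+ k.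
    by apply: le_trans h; rewrite normrM ler_wpM2l // ler_norm.
  apply: le_trans (_ : `|lam| * (C3 * (N%:R ^+ k.-1 * (C2 * F k xi))) <= _).
    rewrite ler_wpM2l //; apply: le_trans a1 _; rewrite ler_pM2l // ler_pM2l // exprn_gt0 //.
  have -> : `|lam| * (C3 * (N%:R ^+ k.-1 * (C2 * F k xi))) = C3 * C2 * N%:R ^+ k.-1 * (`|lam| * F k xi) by ring.
  apply: le_trans (_ : C3 * C2 * N%:R ^+ k.-1 * (C1 / N%:R ^+ k) <= _).
    by rewrite ler_wpM2l // !mulr_ge0 ?exprn_ge0 // ltW.
  rewrite -(prednK k0) exprS; set m := N%:R ^+ _; have m0 : m != 0 by rewrite expf_neq0 // lt0r_neq0.
  rewrite le_eqVlt; apply/orP; left; apply/eqP; rewrite -/m; field.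
  by rewrite m0 lt0r_neq0.
have : C3 * C2 * C1 / N%:R < kap by rewrite ltr_pdivrMr // (mulrC kap) -ltr_pdivrMr.
by move=> h2; have := le_lt_trans hF1 h2; rewrite ltNge hkap.
Qed.

(** A nonzero integer [p_k] keeps [|lam| F k] above [1 / (2 Q)], which eliminates [lam]:
    [|F k.+1| x^(k+1) <= C F k] at arbitrarily large points, hence eventually by [hardy_persist].
    Then [ln (F k)] has derivative [O(x^-(k+1))], integrable as [k > 0], so [F k] is bounded. *)
Lemma resonant_derivative kap rho Q C : 0 < kap -> 0 < rho -> rho <= 1 -> 0 <= C -> (0 < Q)%N ->
  (forall N0 : nat, exists N lam r s p c, (N0 <= N)%N /\ resonant kap rho Q C N lam r s p c) ->
  exists2 C4, 0 <= C4 & ev (fun x => `|F k.+1 x| <= C4 / x ^+ k.+1).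
Proof.
move=> kap0 rho0 rho1 C0 Q0 hbad.
have [C1 C10 [N1 hN1]] := resonant_taylor kap rho0 rho1 C0 Q0.
have [N2 hN2] := resonant_lead kap0 rho0 rho1 C0 Q0.
have [C2 C20 [X2 hX2]] := Fk_cmp hF rho0.
have [H hH hHF] := hg_field hF.
have [ck ck0 [Xc hXc]] := hg_pos hF (leqnn k).
have QR : 0 < Q%:R :> R by rewrite ltr0n.
have Fpos : ev (fun x => 0 < F k x) by exists Xc => x /hXc; apply: lt_le_trans.
have hinf : forall X, exists2 x, X < x & `|F k.+1 x| * x ^+ k.+1 <= 2 * Q%:R * C1 * C2 * F k x.
  move=> X; pose Y := Num.max (Num.max X X2) (Num.max Xc 1).
  have [N [lam [r [s [p [c [hN hres]]]]]]] := hbad (maxn (maxn N1 N2) (Num.truncn (Num.max (Y / rho) (2 * Q%:R * C1))).+1).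
  move: hN; rewrite !geq_max => /andP[/andP[hNa hNb] hNX].
  have [xi [xi' [x1 x2 x3 x4 [h1 h2]]]] := hN1 N lam r s p c hNa hres.
  have p0 := hN2 N lam r s p c hNb hres.
  have : Num.max (Y / rho) (2 * Q%:R * C1) < N%:R by apply: lt_le_trans (truncnS_gt _) _; rewrite ler_nat.
  rewrite gt_max => /andP[hY hC].
  have YN : Y < rho * N%:R by rewrite mulrC -ltr_pdivrMr.
  have [XY [X2Y [XcY Y1]]] : X <= Y /\ X2 <= Y /\ Xc <= Y /\ 1 <= Y.
    by rewrite /Y !le_max !lexx !orbT.
  have Yxi' : Y < xi' := lt_le_trans YN x3.
  have Yxi : Y < xi := lt_le_trans YN x1.
  have n1 : 1 <= N%:R :> R by lra.
  have n0 : 0 < N%:R :> R by lra.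
  exists xi'; first lra.
  have fxi : 0 < F k xi by apply: lt_le_trans ck0 (hXc _ _); lra.
  have hfact : Q%:R^-1 <= `|k`!%:R * (p`_k)%:~R / Q%:R| :> R.
    rewrite normrM normfV (gtr0_norm QR) ler_peMl ?invr_ge0 ?(ltW QR) // normrM.
    apply: le_trans (int_norm_ge1 p0) _; rewrite ler_peMl // ger0_norm //.
    by rewrite ler1n fact_gt0.
  have hC1 : C1 / N%:R ^+ k <= (2 * Q%:R)^-1.
    rewrite ler_pdivrMr ?exprn_gt0 // mulrC ler_pdivlMr ?mulr_gt0 //.
    apply: le_trans (_ : N%:R <= _); first by rewrite mulrC ltW.
    by rewrite -{1}[N%:R]expr1 ler_weXn2l.
  have hlam : (2 * Q%:R)^-1 <= `|lam| * F k xi.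
    rewrite -(gtr0_norm fxi) -normrM.
    have := ler_distD 0 (k`!%:R * (p`_k)%:~R / Q%:R) (lam * F k xi).
    have := ler_normB (lam * F k xi) (lam * F k xi - k`!%:R * (p`_k)%:~R / Q%:R).
    rewrite subKr => h3 _.
    have h4 : Q%:R^-1 = (2 * Q%:R)^-1 + (2 * Q%:R)^-1 :> R by field; rewrite lt0r_neq0.
    move: h3 h4 hfact h1 hC1; set A := _ / Q%:R; set B := lam * _; clear; lra.
  have hx4 : xi' ^+ k.+1 <= N%:R ^+ k.+1.
    by rewrite lerXn2r ?nnegrE ?(ltW n0) //; move: Yxi' Y1; clear; lra.
  have hx0 : 0 <= xi' ^+ k.+1 by rewrite exprn_ge0 //; lra.
  have hN0 : 0 < N%:R ^+ k.+1 :> R by rewrite exprn_gt0.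
  have a1 : `|lam| * (`|F k.+1 xi'| * xi' ^+ k.+1) <= C1.
    rewrite mulrA -normrM; apply: le_trans (_ : C1 / N%:R ^+ k.+1 * N%:R ^+ k.+1 <= _).
      by apply: ler_pM.
    by rewrite divfK ?lt0r_neq0.
  have a2 : C1 <= C1 * (2 * Q%:R * (`|lam| * F k xi)).
    rewrite ler_peMr // mulrC -ler_pdivrMr ?mulr_gt0 // mul1r //.
  have lam0 : 0 < `|lam|.
    rewrite lt_neqAle normr_ge0 andbT eq_sym; apply/eqP => l0; move: hlam; rewrite l0 mul0r.
    by apply/negP; rewrite -ltNge invr_gt0 mulr_gt0.
  have a3 : F k xi <= C2 * F k xi'.
    apply: hX2; [exact: le_lt_trans Yxi'|exact: le_lt_trans Yxi|].
    exact: le_trans (ler_wpM2l (ltW rho0) x2) x3.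
  rewrite -(ler_pM2l lam0); apply: le_trans a1 _; apply: le_trans a2 _.
  have -> : C1 * (2 * Q%:R * (`|lam| * F k xi)) = `|lam| * (2 * Q%:R * C1 * F k xi) by ring.
  rewrite ler_pM2l // -[leRHS]mulrA ler_wpM2l // !mulr_ge0 // ltW //.
have [C3 C30 hC3] := hardy_persist hH (hHF k.+1) (hHF k) Fpos hinf.
have hdl : ev (fun x => der (fun y => ln (F k y)) x (F k.+1 x / F k x)).
  by apply: evW2 Fpos (hg_der hF k) => x f0 hx; apply: der_ln.
have hbl : ev (fun x => `|F k.+1 x / F k x| <= C3 / x ^+ k.+1).
  apply: evW2 (ev_and hC3 Fpos) (ev_gt 0) => x [h f0] x0.
  rewrite normrM normfV (gtr0_norm f0) ler_pdivrMr // mulrAC ler_pdivlMr ?exprn_gt0 //.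
have [L hL] := der_limit k0 C30 hdl hbl.
pose B := expR (L + C3).
have hB : ev (fun x => F k x <= B).
  apply: evW2 (ev_and hL Fpos) (ev_gt 1) => x [h f0] x1.
  rewrite -[leLHS]lnK ?posrE // /B ler_expR.
  have : C3 / x ^+ k <= C3.
    by rewrite ler_pdivrMr ?exprn_gt0 ?(lt_trans ltr01) // ler_peMr // exprn_ege1 // ltW.
  by have := ler_norm (ln (F k x) - L); lra.
exists (C3 * B); first by rewrite mulr_ge0 // expR_ge0.
apply: evW2 (ev_and hC3 hB) (ev_gt 0) => x [h fB] x0.
by rewrite ler_pdivlMr ?exprn_gt0 //; apply: le_trans h _; rewrite ler_wpM2l.
Qed.

(** Otherwise [F k] tends to some [L > 0] and [F 0 = P + O(log x)] with [P] real; the point is that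
    [P - P_0] is a real multiple of a rational polynomial. Both [lam] and [p] vary with [N], but
    [p_k] stays bounded, and the integer [w = W / p_k] brings [lam * w] within [O(N^-k)] of a fixed
    [ls]. Comparing two approximations of [ls * F 0] shows that [Q ls P] has integer coefficients in
    positive degrees. *)
Lemma no_resonance kap rho Q C : 0 < kap -> 0 < rho -> rho <= 1 -> 0 <= C -> (0 < Q)%N ->
  (forall (p : {poly rat}) (c : R), `|F 0%N x - c * (map_poly ratr p).[x]| / ln x @[x --> +oo_ R] --> +oo_ R) ->
  exists N0 : nat, forall N lam r s p c, (N0 <= N)%N -> ~ resonant kap rho Q C N lam r s p c.
Proof.
move=> kap0 rho0 rho1 C0 Q0 hgrowth; apply: contrapT => hn.
have hbad (N0 : nat) : exists N lam r s p c, (N0 <= N)%N /\ resonant kap rho Q C N lam r s p c.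
  apply: contrapT => hn2; apply: hn; exists N0 => N lam r s p c hN hres; apply: hn2.
  by exists N, lam, r, s, p, c.
have [C1 C10 [N1 hN1]] := resonant_taylor kap rho0 rho1 C0 Q0.
have [N2 hN2] := resonant_lead kap0 rho0 rho1 C0 Q0.
have [C4 C40 hC4] := resonant_derivative kap0 rho0 rho1 C0 Q0 hbad.
have [L [XL hL]] := der_limit k0 C40 (hg_der hF k) hC4.
have [ck ck0 [Xc hXc]] := hg_pos hF (leqnn k).
have L0 : 0 < L.
  pose x := Num.max (Num.max XL Xc) (Num.max 1 (2 * C4 / ck)) + 1.
  have [xa [xb [x1 xc]]] : XL < x /\ Xc < x /\ 1 < x /\ 2 * C4 / ck < x.
    by rewrite /x; split; [|split; [|split]]; rewrite ltr_pwDr // !le_max lexx ?orbT.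
  have := hXc x xb; have := hL x xa.
  have : C4 / x ^+ k <= ck / 2.
    rewrite ler_pdivrMr ?exprn_gt0 ?(lt_trans ltr01) //.
    have : x <= x ^+ k by rewrite -{1}[x]expr1 ler_weXn2l // ltW.
    move: xc; rewrite ltr_pdivrMr // => xc xk.
    have : ck / 2 * x <= ck / 2 * x ^+ k by rewrite ler_wpM2l // divr_ge0 // ltW.
    by move: xc; clear; lra.
  by move=> a1 a2 a3; have := ler_norm (F k x - L); move: a1 a2 a3 ck0; clear; lra.
have [P [sP [C6' hC6']]] := tower_log C40 (fun j (_ : (j <= k)%N) => hg_der hF j) hC4.
pose C6 := `|C6'|; have C60 : 0 <= C6 by rewrite /C6.
have [X6 hX6] : ev (fun x => `|F 0%N x - P.[x]| <= C6 * (1 + ln x)).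
  apply: evW2 hC6' (ev_gt 1) => x h x1; apply: le_trans h _.
  have l0 : 0 <= ln x by rewrite ln_ge0 // ltW.
  by rewrite mulrDr mulr1 lerD // /C6 ?ler_wpM2r // ler_norm.
have [c0 [C8' [c00 C80' [X8 hX8']]]] := F_bounds hF (leqnn k).
rewrite subnn in hX8'.
pose Bk := L + C4.
have Bk0 : 0 <= Bk by rewrite addr_ge0 // ltW.
have hBk x : XL < x -> 1 <= x -> `|F k x| <= Bk.
  move=> /hL h x1; have : C4 / x ^+ k <= C4.
    by rewrite ler_pdivrMr ?exprn_gt0 ?(lt_le_trans ltr01) // ler_peMr // exprn_ege1.
  have := ler_normD (F k x - L) L; rewrite subrK (gtr0_norm L0) /Bk; move: h; clear; lra.
pose C8 := C8' * Bk.
have C80 : 0 <= C8 by rewrite mulr_ge0 // ltW.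
have QR : 0 < Q%:R :> R by rewrite ltr0n.
pose B := (Num.truncn (Q%:R * (2 * Bk + C1))).+1.
(* [B] bounds [|p_k|] in all resonances far enough out, so [p_k] divides [W] whatever [N] is. *)
pose W := B`!.
have W0 : 0 < W%:R :> R by rewrite ltr0n fact_gt0.
(* The limit of [lam * w]: [lam * L] is close to [k! p_k / Q], and [w * p_k = W]. *)
pose ls := k`!%:R * W%:R / (Q%:R * L) : R.
have ls0 : 0 < ls by rewrite divr_gt0 ?mulr_gt0 // ltr0n fact_gt0.
pose C7 := C1 + 2 * C4 / rho ^+ k.
have C70 : 0 <= C7 by rewrite addr_ge0 // divr_ge0 ?mulr_ge0 // exprn_ge0 // ltW.
pose C9 := ls * C6 + W%:R / L * C7 * C8 + W%:R * C.
have WL0 : 0 <= W%:R / L by rewrite divr_ge0 // ltW.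
have C90 : 0 <= C9.
  apply: addr_ge0 (mulr_ge0 (ltW W0) C0); apply: addr_ge0 (mulr_ge0 (ltW ls0) C60) _.
  exact: mulr_ge0 (mulr_ge0 WL0 C70) C80.
have [K K0 hK] := poly_coef_bound k rho0.
have hnear d : (0 < d <= k)%N -> exists z : int, Q%:R * ls * P`_d = z%:~R.
  move=> hd; apply: near_int_int => eps eps0.
  have eps1 : 0 < eps / (Q%:R * (K * C9 + 1)).
    by rewrite divr_gt0 // mulr_gt0 // ltr_wpDl // mulr_ge0.
  have [N3 hN3] := log_over_n eps1.
  pose Y := Num.max (Num.max XL X6) (Num.max X8 (Num.max Xc 1)).
  have [N [lam [r [s [p [c [hN hres]]]]]]] := hbad (maxn (maxn N1 N2) (maxn N3 (Num.truncn (Y / rho)).+1)).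
  move: hN; rewrite !geq_max => /andP[/andP[hNa hNb] /andP[hNc hNX]].
  have [xi [xi' [x1 x2 x3 x4 [h1 h2]]]] := hN1 N lam r s p c hNa hres.
  have p0 := hN2 N lam r s p c hNb hres.
  have [[hl2 _] sp [hr hs hrs] hp] := hres.
  have hY : Y / rho < N%:R by apply: lt_le_trans (truncnS_gt _) _; rewrite ler_nat.
  have YN : Y < rho * N%:R by rewrite mulrC -ltr_pdivrMr.
  have [XLY [X6Y [X8Y [XcY Y1]]]] : XL <= Y /\ X6 <= Y /\ X8 <= Y /\ Xc <= Y /\ 1 <= Y.
    by rewrite /Y !le_max !lexx !orbT.
  have Yxi : Y < xi := lt_le_trans YN x1.
  have n1 : 1 <= N%:R :> R by move: x1 x2 YN Y1; clear; lra.
  have n0 : 0 < N%:R :> R by apply: lt_le_trans n1.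
  have nk0 : 0 < N%:R ^+ k :> R by rewrite exprn_gt0.
  have hxiL : XL < xi := le_lt_trans XLY Yxi.
  have xi1 : 1 <= xi := le_trans Y1 (ltW Yxi).
  have fB := hBk xi hxiL xi1.
  have pB : `|(p`_k)%:~R| <= Q%:R * (2 * Bk + C1) :> R.
    have a1 : `|lam * F k xi| <= 2 * Bk by rewrite normrM ler_pM.
    have a2 : C1 / N%:R ^+ k <= C1 by rewrite ler_pdivrMr // ler_peMr // exprn_ege1.
    have a3 : `|k`!%:R * (p`_k)%:~R / Q%:R| <= 2 * Bk + C1.
      have := ler_normB (lam * F k xi) (lam * F k xi - k`!%:R * (p`_k)%:~R / Q%:R).
      rewrite subKr; move: h1 a1 a2; clear; lra.
    rewrite -ler_pdivrMl // mulrC; apply: le_trans a3.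
    rewrite !normrM normfV (gtr0_norm QR) ler_wpM2r ?invr_ge0 ?(ltW QR) //.
    by rewrite ler_peMl // ger0_norm // ler1n fact_gt0.
  have pB' : (absz (p`_k)%R <= B)%N.
    rewrite -(ler_nat R) natr_absz; apply: le_trans (ltW (truncnS_gt _)).
    by rewrite intr_norm.
  have [w hw] : exists w : int, w * p`_k = W%:Z.
    have : (absz (p`_k)%R %| W)%N by rewrite dvdn_fact // pB' lt0n absz_eq0 p0.
    case/dvdnP => y hy; exists (y%:Z * sgz p`_k).
    by rewrite -mulrA -normrEsg -abszE -PoszM -hy.
  have wW : `|w%:~R| <= W%:R :> R.
    rewrite -[W%:R]/((W%:Z)%:~R) -hw intrM; have -> : w%:~R * (p`_k)%:~R = (w * p`_k)%:~R :> R by rewrite intrM.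
    rewrite hw -[leRHS](ger0_norm (ler0n R W)) -[W%:R]/((W%:Z)%:~R) -hw intrM normrM ler_peMr //.
    exact: int_norm_ge1.
  have hlw : `|ls - lam * w%:~R| <= W%:R / L * C7 / N%:R ^+ k.
    have e1 : ls - lam * w%:~R = - (w%:~R / L) * (lam * L - k`!%:R * (p`_k)%:~R / Q%:R).
      rewrite /ls -[W%:R]/((W%:Z)%:~R) -hw intrM; field.
      by rewrite !lt0r_neq0.
    have e2 : `|lam * L - k`!%:R * (p`_k)%:~R / Q%:R| <= C7 / N%:R ^+ k.
      have a1 : `|lam * (F k xi - L)| <= 2 * (C4 / (rho ^+ k * N%:R ^+ k)).
        rewrite normrM ler_pM //; apply: le_trans (hL xi hxiL) _.
        rewrite ler_wpM2l // lef_pV2 ?posrE ?mulr_gt0 ?exprn_gt0 // -?exprMn ?(lt_le_trans _ xi1) //.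
        by rewrite lerXn2r // nnegrE ?(mulr_ge0 (ltW rho0) (ltW n0)) // (le_trans _ xi1).
      have -> : C7 / N%:R ^+ k = C1 / N%:R ^+ k + 2 * (C4 / (rho ^+ k * N%:R ^+ k)).
        by rewrite /C7; field; rewrite !lt0r_neq0 ?exprn_gt0.
      have -> : lam * L - k`!%:R * (p`_k)%:~R / Q%:R = (lam * F k xi - k`!%:R * (p`_k)%:~R / Q%:R) - lam * (F k xi - L) by ring.
      by apply: le_trans (ler_normB _ _) _; exact: lerD.
    rewrite e1 normrM normrN normrM normfV (gtr0_norm L0) -(mulrA (W%:R / L)).
    by apply: ler_pM => //; rewrite ?ler_wpM2r ?mulr_ge0 ?invr_ge0 // ltW.
  pose q : {poly R} := ls *: P - (w%:~R / Q%:R) *: map_poly intr p.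
  have sq : (size q <= k.+1)%N.
    apply: leq_trans (size_polyD _ _) _; rewrite size_polyN geq_max.
    rewrite (leq_trans (size_scale_leq _ _) sP) /=.
    by rewrite (leq_trans (size_scale_leq _ _)) // (leq_trans (size_poly _ _)).
  have s0 : 0 <= s%:R :> R by [].
  have l1 : 0 <= ln N%:R :> R by rewrite ln_ge0.
  (* Three errors: [P] for [F 0], which grows like [log N]; [ls] for [lam * w], of size [N^-k]
     against [F 0 = O(N^k)]; and the bounded error of the resonance. *)
  have hq i : (i <= k)%N -> `|q.[r%:R + i%:R * s%:R] - w%:~R * c| <= C9 * (1 + ln N%:R).
    move=> ik; rewrite -natrM -natrD; set y := (r + i * s)%N.
    have yN : (y <= N)%N.
      by apply: leq_trans hrs; rewrite leq_add2l leq_mul2r leqW ?orbT.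
    have ry : Y < y%:R.
      by apply: lt_le_trans YN _; apply: le_trans hr _; rewrite ler_nat leq_addr.
    have y0 : 0 < y%:R :> R by apply: lt_trans (lt_le_trans ltr01 Y1) ry.
    have yNR : y%:R <= N%:R :> R by rewrite ler_nat.
    have b1 : `|F 0%N y%:R - P.[y%:R]| <= C6 * (1 + ln N%:R).
      apply: le_trans (hX6 _ (le_lt_trans X6Y ry)) _; rewrite ler_wpM2l // lerD2l.
      by rewrite ler_ln ?posrE.
    have b2 : `|F 0%N y%:R| <= C8 * N%:R ^+ k.
      have /andP[c1 c2] := hX8' _ (le_lt_trans X8Y ry).
      have fk0 : `|F k y%:R| <= Bk by apply: hBk; [exact: le_lt_trans ry|exact: le_trans (ltW ry)].
      have fk1 : 0 <= F k y%:R by apply: le_trans (ltW ck0) (hXc _ (le_lt_trans XcY ry)).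
      have yk : 0 <= y%:R ^+ k :> R by rewrite exprn_ge0.
      have f0 : 0 <= F 0%N y%:R by apply: le_trans c1; rewrite mulr_ge0 ?mulr_ge0 // ltW.
      rewrite (ger0_norm f0); apply: le_trans c2 _.
      rewrite /C8 -mulrA ler_pM2l // mulrC; apply: ler_pM => //.
        by apply: le_trans fk0; apply: ler_norm.
      by rewrite lerXn2r ?nnegrE.
    have b3 := hp i (leqW ik); rewrite -/y in b3.
    have -> : q.[y%:R] - w%:~R * c = - (ls * (F 0%N y%:R - P.[y%:R])) + (ls - lam * w%:~R) * F 0%N y%:R
        + w%:~R * (lam * F 0%N y%:R - evz p y%:R / Q%:R - c).
      by rewrite /q hornerD hornerN !hornerZ /evz; field; rewrite lt0r_neq0.
    have d1 : `|ls * (F 0%N y%:R - P.[y%:R])| <= ls * C6 * (1 + ln N%:R).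
      by rewrite normrM (gtr0_norm ls0) -mulrA ler_wpM2l // ltW.
    have d2 : `|(ls - lam * w%:~R) * F 0%N y%:R| <= W%:R / L * C7 * C8.
      rewrite normrM; apply: le_trans (_ : W%:R / L * C7 / N%:R ^+ k * (C8 * N%:R ^+ k) <= _).
        by apply: ler_pM.
      by rewrite le_eqVlt; apply/orP; left; apply/eqP; field; rewrite !lt0r_neq0.
    have d3 : `|w%:~R * (lam * F 0%N y%:R - evz p y%:R / Q%:R - c)| <= W%:R * C by rewrite normrM ler_pM.
    have d4 : 0 <= W%:R / L * C7 * C8 * ln N%:R by exact: mulr_ge0 (mulr_ge0 (mulr_ge0 WL0 C70) C80) l1.
    have d5 : 0 <= W%:R * C * ln N%:R by exact: mulr_ge0 (mulr_ge0 (ltW W0) C0) l1.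
    apply: le_trans (ler_normD _ _) _; apply: le_trans (lerD (ler_normD _ _) (lexx _)) _.
    rewrite normrN /C9; move: d1 d2 d3 d4 d5.
    set T1 := `|ls * _|; set T2 := `|(ls - _) * _|; set T3 := `|w%:~R * _|.
    by clear; lra.
  have hE : 0 <= C9 * (1 + ln N%:R) by rewrite mulr_ge0 // addr_ge0.
  have hrs' : r%:R + k%:R * s%:R <= N%:R :> R.
    by rewrite -natrM -natrD ler_nat; apply: leq_trans hrs; rewrite leq_add2l leq_mul2r leqnSn orbT.
  have := hK q r%:R s%:R N%:R _ _ sq n0 hs (ler0n _ _) hrs' hE hq d hd.
  rewrite /q coefB !coefZ coef_map /= => hqd.
  exists (w * p`_d).
  have -> : Q%:R * ls * P`_d - (w * p`_d)%:~R = Q%:R * (ls * P`_d - w%:~R / Q%:R * (p`_d)%:~R).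
    by rewrite intrM; field; rewrite lt0r_neq0.
  rewrite normrM (gtr0_norm QR) mulrC -ler_pdivlMr //; apply: le_trans hqd _.
  have /andP[d0 _] := hd.
  apply: le_trans (_ : K * C9 * ((1 + ln N%:R) / N%:R) <= _).
    rewrite -!mulrA ler_wpM2l // ler_wpM2l // ler_wpM2l ?addr_ge0 // lef_pV2 ?posrE ?exprn_gt0 //.
    by rewrite -{1}[N%:R]expr1 ler_weXn2l.
  apply: le_trans (_ : K * C9 * (eps / (Q%:R * (K * C9 + 1))) <= _).
    by rewrite ler_wpM2l ?mulr_ge0 // hN3.
  have KC : 0 < K * C9 + 1 by rewrite ltr_wpDl // mulr_ge0.
  have -> : K * C9 * (eps / (Q%:R * (K * C9 + 1))) = eps / Q%:R * (K * C9 / (K * C9 + 1)).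
    by field; rewrite !lt0r_neq0.
  by rewrite ler_piMr ?divr_ge0 ?(ltW eps0) // ler_pdivrMr // mul1r lerDl.
(* [hnear] covers positive degrees only; the omitted constant is absorbed by [O(log x)]. *)
pose p0 : {poly rat} := \poly_(d < k.+1) (if d == 0%N then 0 else (Num.floor (Q%:R * ls * P`_d))%:~R).
pose cc := (Q%:R * ls)^-1.
have QL0 : 0 < Q%:R * ls by rewrite mulr_gt0.
have hp0 x : cc * (map_poly ratr p0).[x] = P.[x] - P`_0.
  rewrite (horner_coef_wide _ (n := k.+1)); last exact: leq_trans (size_poly _ _) (size_poly _ _).
  rewrite [P.[x]](horner_coef_wide x sP) [in RHS]big_ord_recl expr0 mulr1 [RHS]addrC addKr big_ord_recl.
  rewrite coef_map coef_poly /= rmorph0 mul0r add0r mulr_sumr; apply: eq_bigr => i _.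
  rewrite /bump /= add1n coef_map coef_poly ltnS (ltn_ord i) /= ratr_int.
  have [z hz] := hnear i.+1 (ltn_ord i); rewrite hz intrKfloor -hz mulrA mulrA mulVf ?mul1r //.
  by rewrite lt0r_neq0.
have hinf : ev (fun x => `|P`_0| + 2 * C6 + 1 <= `|F 0%N x - cc * (map_poly ratr p0).[x]| / ln x).
  by apply/ev_near; move/cvgryPge : (hgrowth p0 cc) => /(_ (`|P`_0| + 2 * C6 + 1)).
have [X hX] := ev_and hinf (ev_and (ev_gt X6) (ev_gt (expR 1))).
have [h1 [h2 h3]] := hX (X + 1) ltac:(by rewrite ltrDl).
set x := X + 1 in h1 h2 h3.
have x0 : 0 < x by apply: lt_trans (expR_gt0 _) h3.
have l1 : 1 <= ln x by rewrite -[leLHS](expRK 1) ler_ln ?posrE ?expR_gt0 // ltW.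
have := hX6 x h2; move: h1; rewrite hp0 ler_pdivlMr; last lra.
have := ler_normD (F 0%N x - P.[x]) P`_0.
have -> : F 0%N x - P.[x] + P`_0 = F 0%N x - (P.[x] - P`_0) by ring.
have : 0 <= `|P`_0| by [].
move: C60 l1; set A := `|P`_0|; set D := `|_ - (_ - _)|; set E := `|_ - _|; clear; nra.
Qed.


Lemma iter_dif_der d (lam : R) a n X : (forall j, (j < d)%N -> forall y, X < y -> der (F j) y (F j.+1 y)) ->
  X < (a + n)%N%:R -> exists xi, [/\ (a + n)%N%:R <= xi &
    iter d (@dif R) (fun i => lam * F 0%N (a + i)%N%:R) n = lam * F d xi].
Proof.
move=> hd hX; pose G j y := lam * F j y.
have hG j : (j < d)%N -> forall y, X < y -> der (G j) y (G j.+1 y).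
  by move=> jd y Xy; apply: derZ; apply: hd.
have [xi [h1 _ h2]] := dlt_mvt hG hX ltr01.
exists xi; split => //; move: h2; rewrite expr1n mul1r /G => <-.
elim: d n {hd hX xi h1 hG} => //= d IH n.
by rewrite /dif /dlt !IH addnS -natr1.
Qed.

(** Differences of [lam * F 0] are values of derivatives ([iter_dif_der]), and these keep their
    signs far out whatever [lam] is; the half of [eta] pays for [|lam| <= 2]. *)
Lemma slow_eventually eta : 0 < eta -> exists A : nat, forall a M (lam : R), (A <= a)%N -> `|lam| <= 2 ->
  slow k eta M (fun i => lam * F 0%N (a + i)%N%:R).
Proof.
move=> eta0; have e2 : 0 < eta / 2 by rewrite divr_gt0.
have [X1 hX1] := hg_small hF e2.
have hs j : exists sg : bool, ev (fun x => 0 <= (-1) ^+ sg * F j x).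
  case: (hg_sign hF j) => h; [exists false|exists false|exists true]; apply: evW h => x.
  - by move=> ->; rewrite mulr0.
  - by move=> /ltW; rewrite mul1r.
  - by move=> /ltW; rewrite mulN1r oppr_ge0.
have [s1 [Y1 hY1]] := hs k.+1; have [s2 [Y2 hY2]] := hs k.+2.
have [X hX] := ev_all (fun j (_ : (j <= k.+2)%N) => hg_der hF j).
pose Z := Num.max (Num.max X X1) (Num.max Y1 Y2).
exists (Num.truncn Z).+1 => a M lam ha hlam.
have Za n : Z < (a + n)%N%:R.
  by apply: lt_le_trans (truncnS_gt _) _; rewrite ler_nat (leq_trans ha) // leq_addr.
have [XZ [X1Z [Y1Z Y2Z]]] : X <= Z /\ X1 <= Z /\ Y1 <= Z /\ Y2 <= Z.
  by rewrite /Z !le_max !lexx !orbT.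
wlog hpos : lam hlam / 0 <= lam * (-1) ^+ s1.
  move=> hw; have [h|h] := leP 0 (lam * (-1) ^+ s1); first exact: hw.
  have [||h'|h'] := hw (- lam).
  - by rewrite normrN.
  - by rewrite mulNr oppr_ge0 ltW.
  - by right; rewrite (_ : (fun n => _) = (fun i => - lam * F 0%N (a + i)%N%:R)) //; apply/funext => n; rewrite mulNr.
  - by left; move: h'; rewrite (_ : (fun n => - (- lam * _)) = (fun i => lam * F 0%N (a + i)%N%:R)) //; apply/funext => n; rewrite mulNr opprK.
have hd d : (d <= k.+3)%N -> forall j, (j < d)%N -> forall y, X < y -> der (F j) y (F j.+1 y).
  by move=> dk j jd y Xy; apply: hX => //; rewrite -ltnS (leq_trans jd).
left; split.
  move=> n _; have [xi [h1 ->]] := @iter_dif_der k.+1 lam a n X (hd _ (leqW (leqnSn _))) (le_lt_trans XZ (Za n)).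
  have Zxi : Z < xi := lt_le_trans (Za n) h1.
  have -> : lam * F k.+1 xi = lam * (-1) ^+ s1 * ((-1) ^+ s1 * F k.+1 xi).
    by rewrite mulrA -(mulrA lam) -signr_addb addbb mulr1.
  rewrite mulr_ge0 ?hY1 ?(le_lt_trans Y1Z) //=.
  apply: le_trans (ler_norm _) _; rewrite !normrM !normr_sign mulr1 mul1r.
  have := hX1 xi (le_lt_trans X1Z Zxi) => h2.
  have -> : eta = 2 * (eta / 2) by field.
  by apply: ler_pM.
have [hl|hl] := leP 0 (lam * (-1) ^+ s2).
- left => n _; have [xi [h1 ->]] := @iter_dif_der k.+2 lam a n X (hd _ (leqnSn _)) (le_lt_trans XZ (Za n)).
  have Zxi : Z < xi := lt_le_trans (Za n) h1.
  have -> : lam * F k.+2 xi = lam * (-1) ^+ s2 * ((-1) ^+ s2 * F k.+2 xi).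
    by rewrite mulrA -(mulrA lam) -signr_addb addbb mulr1.
  by rewrite mulr_ge0 ?hY2 ?(le_lt_trans Y2Z).
- right => n _; have [xi [h1 ->]] := @iter_dif_der k.+2 lam a n X (hd _ (leqnSn _)) (le_lt_trans XZ (Za n)).
  have Zxi : Z < xi := lt_le_trans (Za n) h1.
  have -> : lam * F k.+2 xi = lam * (-1) ^+ s2 * ((-1) ^+ s2 * F k.+2 xi).
    by rewrite mulrA -(mulrA lam) -signr_addb addbb mulr1.
  by rewrite mulr_le0_ge0 ?(ltW hl) ?hY2 ?(le_lt_trans Y2Z).
Qed.

(** A larger sum would produce a resonance. About [eps / 4 * N] initial terms are dropped to make
    the first node proportional to [N]; the nodes are equally spaced terms of the progression given
    by [inverse_weyl]. *)
Lemma uniform_weyl (eps kap : R) : 0 < eps -> 0 < kap ->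
  (forall (p : {poly rat}) (c : R), `|F 0%N x - c * (map_poly ratr p).[x]| / ln x @[x --> +oo_ R] --> +oo_ R) ->
  exists N0 : nat, forall N N' (lam : R), (N0 <= N)%N -> (N' <= N)%N -> `|lam| <= 2 -> kap <= `|lam| * F 1%N N%:R ->
    nrm (\sum_(n < N') e (lam * F 0%N n%:R)) <= eps * N%:R.
Proof.
move=> eps0 kap0 hgrowth.
have eps2 : 0 < eps / 2 by rewrite divr_gt0.
have [Q [C [rho [eta [Q0 rho0 eta0] [L hL]]]]] := inverse_weyl k eps2.
have [A hA] := slow_eventually eta0.
pose C' := `|C|; have C'0 : 0 <= C' by rewrite /C'.
pose rho1 := Num.min 1 (Num.min (eps / 4) (rho * (eps / 2) / (2 * k.+1%:R))).
have rho10 : 0 < rho1.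
  by rewrite !lt_min ltr01 !divr_gt0 // mulr_gt0.
have rho11 : rho1 <= 1 by rewrite ge_min lexx.
have [rho12 rho13] : rho1 <= eps / 4 /\ rho1 <= rho * (eps / 2) / (2 * k.+1%:R).
  by rewrite /rho1 !ge_min !lexx !orbT.
have [N0 hN0] := no_resonance kap0 rho10 rho11 C'0 Q0 hgrowth.
pose B := Num.max (Num.max (4 / eps * A%:R) (4 / eps)) (Num.max (2 / eps * L%:R) (2 * k.+1%:R / (rho * (eps / 2)))).
exists (maxn N0 (Num.truncn B).+1) => N N' lam; rewrite geq_max => /andP[hNa hNB] N'N hlam hkap.
rewrite leNgt; apply/negP => hS.
have hB : B < N%:R by apply: lt_le_trans (truncnS_gt _) _; rewrite ler_nat.
have n0 : 0 < N%:R :> R by rewrite ltr0n (leq_trans _ hNB).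
have rr : 0 < rho * (eps / 2) by rewrite mulr_gt0.
move: hB; rewrite /B !gt_max => /andP[/andP[b1 b2] /andP[b3 b4]].
have {b1} b1 : A%:R <= eps / 4 * N%:R.
  by move: b1; rewrite mulrAC ltr_pdivrMr //; lra.
have {b2} b2 : 1 <= eps / 4 * N%:R.
  by move: b2; rewrite ltr_pdivrMr //; lra.
have {b3} b3 : L%:R <= eps / 2 * N%:R.
  by move: b3; rewrite mulrAC ltr_pdivrMr //; lra.
have {b4} b4 : 2 * k.+1%:R <= rho * (eps / 2) * N%:R.
  by move: b4; rewrite ltr_pdivrMr // (mulrC N%:R) => /ltW.
pose a := (Num.truncn (eps / 4 * N%:R)).+1.
have a1 : eps / 4 * N%:R < a%:R by apply: truncnS_gt.
have a2 : a%:R <= eps / 2 * N%:R.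
  have /andP[h _] : (Num.truncn (eps / 4 * N%:R))%:R <= eps / 4 * N%:R < (Num.truncn (eps / 4 * N%:R)).+1%:R.
    by apply: truncn_itv; rewrite mulr_ge0 ?divr_ge0 // ltW.
  by rewrite /a -natr1; move: h b2; lra.
have aA : (A <= a)%N by rewrite -(ler_nat R) (le_trans b1) // ltW.
pose u n := lam * F 0%N n%:R.
have aN' : (a <= N')%N.
  rewrite leqNgt; apply/negP => N'a.
  have h1 : N'%:R <= a%:R :> R by rewrite ler_nat ltnW.
  have h2 := nrm_sum_e N' u.
  by move: hS h1 h2 a2 (mulr_gt0 eps0 n0); rewrite /u; lra.
pose M := (N' - a)%N.
have hsp := sum_e_split u aN'.
have hsa := nrm_sum_e a u.
have hSM : eps / 2 * N%:R <= nrm (\sum_(i < M) e (u (a + i)%N)).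
  by move: hS hsp hsa a2; rewrite /u -/M; lra.
have MN : M%:R <= N%:R :> R by rewrite ler_nat /M (leq_trans (leq_subr _ _)).
have MN2 : eps / 2 * N%:R <= M%:R := le_trans hSM (nrm_sum_e M (fun i => u (a + i)%N)).
have LM : (L <= M)%N by rewrite -(ler_nat R) (le_trans b3).
have hSM2 : eps / 2 * M%:R <= nrm (\sum_(i < M) e (u (a + i)%N)).
  by apply: le_trans hSM; rewrite ler_wpM2l // ltW.
have [D [r [M' [p sp [c [/andP[D0 DQ] hM' hr hp]]]]]] := hL M (fun i => u (a + i)%N) LM (hA a M lam aA hlam) hSM2.
(* [k.+1] jumps of [q] terms stay among the [M'] terms of the progression; [s] is the same jump
   measured in [n]. *)
pose q := (M'.-1 %/ k.+1)%N; pose s := (D * q)%N.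
have hM'2 : rho * (eps / 2) * N%:R <= M'%:R.
  by apply: le_trans hM'; rewrite -mulrA ler_pM2l.
have M'0 : (0 < M')%N.
  rewrite -(ltr0n R); apply: lt_le_trans hM'2; exact: mulr_gt0.
have hq : (M' <= q.+1 * k.+1)%N.
  by rewrite -(prednK M'0) /q ltn_ceil.
have hqR : rho * (eps / 2) / (2 * k.+1%:R) * N%:R <= q%:R.
  have h1 : M'%:R <= (q%:R + 1) * k.+1%:R :> R by rewrite natr1 -natrM ler_nat.
  have kk : 0 < 2 * k.+1%:R :> R by rewrite mulr_gt0.
  rewrite mulrAC ler_pdivrMr //; move: h1 hM'2 b4; lra.
have hiq i : (i <= k.+1)%N -> (i * q < M')%N.
  move=> ik; rewrite -(prednK M'0) ltnS; apply: leq_trans (leq_divM M'.-1 k.+1).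
  by rewrite mulnC leq_mul2l ik orbT.
have [p2 sp2 ep2] := @poly_affine R p k 1 a sp.
have eqi i : (a + r + i * s = a + (r + D * (i * q)))%N by rewrite /s; ring.
apply: (hN0 N lam (a + r)%N s p2 c hNa); split => //.
- split.
  + apply: le_trans (_ : a%:R <= _); last by rewrite ler_nat leq_addr.
    by apply: le_trans (ltW a1); rewrite ler_wpM2r // ltW.
  + apply: le_trans (_ : q%:R <= _); last by rewrite ler_nat /s leq_pmull.
    by apply: le_trans hqR; rewrite ler_wpM2r // ltW.
  + rewrite eqi; have := hr _ (hiq k.+1 (leqnn _)) => h.
    by apply: leq_trans N'N; rewrite -leq_subRL // ltnW.
- move=> i ik; apply: le_trans (ler_norm C); rewrite eqi.
  have := hp _ (hiq i ik); have := ep2 (r + D * (i * q))%N.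
  by rewrite mul1n exp1n mul1r => ->.
Qed.

End WithF.
End Rigidity.

(** * Weighted equidistribution of the values of [alpha] below [M] *)

Section Equidistribution.
Variable R : realType.
Implicit Types (x y c C lam eps : R) (a : nat -> R).

(* A Riemann sum for the integral of [e (lam t)] over [0, M], which vanishes. *)
Lemma riemann_exp a (L : nat) lam (M wm : R) : lam != 0 -> e (lam * M) = 1 ->
  (forall i, (i < L)%N -> 0 <= dif a i <= wm) ->
  nrm (\sum_(i < L) ((dif a i)%:C)%C * e (lam * a i)) <=
    `|a L - M| + `|a 0%N| + 4 * pi * (`|lam| * wm) * (a L - a 0%N).
Proof.
move=> l0 hM hw.
pose c : R[i] := (0 +i* (2 * pi * lam))%C.
have pl : 0 < 2 * pi * `|lam| by rewrite !mulr_gt0 ?pi_gt0 ?normr_gt0.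
have hc : nrm c = 2 * pi * `|lam|.
  by rewrite nrm_def /= expr0n add0r sqrtr_sqr !normrM (ger0_norm (pi_ge0 R)) (ger0_norm (ler0n R 2)).
pose r i := e (lam * dif a i) - 1 - (0 +i* (2 * pi * (lam * dif a i)))%C.
have hterm i : c * (((dif a i)%:C)%C * e (lam * a i)) = (e (lam * a i.+1) - e (lam * a i)) - e (lam * a i) * r i.
  have -> : lam * a i.+1 = lam * a i + lam * dif a i by rewrite /dif; ring.
  rewrite eD /r.
  have -> : (0 +i* (2 * pi * (lam * dif a i)))%C = c * ((dif a i)%:C)%C.
    by apply/eqP; rewrite eq_complex /=; apply/andP; split; apply/eqP; ring.
  ring.
have hsum : c * (\sum_(i < L) ((dif a i)%:C)%C * e (lam * a i)) =
    (e (lam * a L) - e (lam * a 0%N)) - \sum_(i < L) e (lam * a i) * r i.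
  rewrite mulr_sumr (eq_bigr _ (fun (i : 'I_L) _ => hterm i)) sumrB; congr (_ - _).
  by rewrite -(big_mkord xpredT (fun i => e (lam * a i.+1) - e (lam * a i))) telescope_sumr.
have hda : \sum_(i < L) dif a i = a L - a 0%N.
  by rewrite -(big_mkord xpredT (fun i => dif a i)) telescope_sumr.
have hr : nrm (\sum_(i < L) e (lam * a i) * r i) <= 2 * pi * `|lam| * (4 * pi * (`|lam| * wm) * (a L - a 0%N)).
  apply: le_trans (nrm_sum _ _ _) _.
  rewrite -hda !mulr_sumr; apply: ler_sum => i _; rewrite nrmM nrm_e mul1r.
  apply: le_trans (e_taylor _) _.
  have /andP[w0 w1] := hw i (ltn_ord i).
  have -> : 2 * (2 * pi * (lam * dif a i)) ^+ 2 = 2 * pi * `|lam| * (4 * pi * `|lam| * (dif a i * dif a i)).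
    rewrite exprMn (exprMn _ lam) -(real_normK (num_real lam)); ring.
  rewrite ler_pM2l //.
  have -> : 4 * pi * (`|lam| * wm) * dif a i = 4 * pi * `|lam| * (wm * dif a i) by ring.
  by rewrite ler_wpM2l ?ler_wpM2r // !mulr_ge0 // pi_ge0.
have hb : nrm (e (lam * a L) - e (lam * a 0%N)) <= 2 * pi * `|lam| * (`|a L - M| + `|a 0%N|).
  have -> : e (lam * a L) - e (lam * a 0%N) = (e (lam * a L) - e (lam * M)) - (e (lam * a 0%N) - e 0).
    by rewrite hM e0; ring.
  apply: le_trans (nrmB _ _) _; rewrite mulrDr; apply: lerD.
    by apply: le_trans (e_lip2 _ _) _; rewrite -mulrBr normrM mulrA.
  by apply: le_trans (e_lip2 _ _) _; rewrite subr0 normrM mulrA.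
rewrite -(ler_pM2l pl) -[in leLHS]hc -nrmM hsum mulrDr.
by apply: le_trans (nrmB _ _) _; apply: lerD.
Qed.

Section WithF.
Variables (F : nat -> R -> R) (k : nat).
Hypotheses (hF : hardy_growth F k) (hoo : forall C, ev (fun x => C <= F 0%N x)).
Hypothesis hgrowth : forall (p : {poly rat}) (c : R),
  `|F 0%N x - c * (map_poly ratr p).[x]| / ln x @[x --> +oo_ R] --> +oo_ R.

Lemma F1_ge0 : ev (fun x => 0 <= F 1%N x).
Proof.
have hneg : ~ ev (fun x => F 1%N x <= 0).
  move=> h; have [X hX] := ev_and (hg_der hF 0) h.
  have hm := der_le0_mono (fun x hx => (hX x hx).1) (fun x hx => (hX x hx).2).
  have Xa : X < X + 1 by rewrite ltrDl.
  have [Y hY] := ev_and (hoo (F 0%N (X + 1) + 1)) (ev_gt (X + 1)).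
  have [h1 h2] := hY (Y + 1) ltac:(by rewrite ltrDl).
  by have := hm _ _ Xa (ltW h2); move: h1; lra.
case: (hg_sign hF 1) => h.
- by case: hneg; apply: evW h => x ->.
- by apply: evW h => x /ltW.
- by case: hneg; apply: evW h => x /ltW.
Qed.

(** By [F_bounds], [F 1] is of order [x^(k-1) F k], hence nondecreasing up to a constant, and [F 0]
    is of order [x^k F k]. *)
Lemma F1_cmp : (0 < k)%N -> exists C1 C2 X, [/\ 0 < C1, 0 < C2,
  forall x y, X < y -> y <= x -> F 1%N y <= C1 * F 1%N x & forall x, X < x -> x * F 1%N x <= C2 * F 0%N x].
Proof.
move=> k0.
have [c [C [c0 C0 h1]]] := F_bounds hF (leq_pred k).
have [c' [C' [c'0 C'0 h2]]] := F_bounds hF (leqnn k).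
have [D D0 [Y hY]] := Fk_cmp hF ltr01.
have [ck ck0 h3] := hg_pos hF (leqnn k).
have kk : (k - k.-1 = 1)%N by rewrite -{1}(prednK k0) subSnn.
rewrite kk in h1; rewrite subnn in h2.
have [X hX] := ev_and (ev_and h1 h2) (ev_and h3 (ev_and (ev_gt Y) (ev_gt 0))).
exists (C * D / c), (C / c'), X; split; try by rewrite divr_gt0 ?mulr_gt0.
- move=> x y Xy yx.
  have [[/andP[a1 a2] _] [a3 [a4 a5]]] := hX y Xy.
  have [[/andP[b1 b2] _] [b3 [b4 b5]]] := hX x (lt_le_trans Xy yx).
  rewrite mulrAC ler_pdivlMr //.
  have d1 : F k y <= D * F k x by apply: hY => //; rewrite mul1r.
  have d2 : y ^+ k.-1 <= x ^+ k.-1 by rewrite lerXn2r ?nnegrE ?(ltW a5) ?(ltW b5).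
  have d3 : y ^+ k.-1 * F k y <= x ^+ k.-1 * (D * F k x).
    by apply: ler_pM => //; rewrite ?exprn_ge0 ?(ltW a5) ?(le_trans (ltW ck0) a3).
  apply: le_trans (_ : C * (x ^+ k.-1 * (D * F k x)) * c <= _).
    by rewrite ler_wpM2r ?(ltW c0) //; apply: le_trans a2 _; rewrite ler_pM2l.
  have -> : C * (x ^+ k.-1 * (D * F k x)) * c = C * D * (c * (x ^+ k.-1 * F k x)) by ring.
  by rewrite ler_wpM2l // mulr_ge0 // ltW.
- move=> x Xx; have [[/andP[a1 a2] /andP[a1' _]] [a3 [a4 a5]]] := hX x Xx.
  rewrite mulrAC ler_pdivlMr //.
  apply: le_trans (_ : x * (C * (x ^+ k.-1 * F k x)) * c' <= _).
    by rewrite ler_wpM2r ?(ltW c'0) // ler_wpM2l // ltW.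
  have -> : x * (C * (x ^+ k.-1 * F k x)) * c' = C * (c' * (x * x ^+ k.-1 * F k x)) by ring.
  by rewrite -exprS (prednK k0) ler_wpM2l // ltW.
Qed.

(** Weighted by their increments the values imitate Lebesgue measure on [[0, M)]. The condition
    [e (lam * M) = 1] selects the frequencies of the circle of length [M], and [|lam| <= 2] covers
    the degree of the kernel. *)
Definition balanced_weights eps (M n0 L : nat) := let a i := F 0%N (n0 + i)%N%:R in
  [/\ (0 < n0)%N, forall i, (i < L)%N -> 0 <= a i < M%:R, forall i, (i < L)%N -> 0 <= dif a i,
    M%:R / 2 <= \sum_(i < L) dif a i &
    forall lam, lam != 0 -> `|lam| <= 2 -> e (lam * M%:R) = 1 ->
      nrm (\sum_(i < L) ((dif a i)%:C)%C * e (lam * a i)) <= eps * M%:R].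

Lemma start_point (X : R) : exists n0 : nat, (0 < n0)%N /\ forall i, X < (n0 + i)%N%:R.
Proof.
exists (Num.truncn X).+1; split => // i.
by apply: lt_le_trans (truncnS_gt _) _; rewrite ler_nat leq_addr.
Qed.

Lemma first_passage a (M : nat) : (forall i, 0 <= dif a i) -> (forall C, exists i, C <= a i) -> a 0%N < M%:R ->
  exists L, (forall i, (i < L.+1)%N -> a i < M%:R) /\ M%:R <= a L.+1.
Proof.
move=> ha hoo' h0; have [[|L] hL hmin] := ex_minnP (hoo' M%:R); first by move: hL; rewrite leNgt h0.
exists L; split => //.
by move=> i iL; rewrite ltNge; apply: contraTN iL => /hmin; rewrite -leqNgt.
Qed.

(** Low frequencies, with [|lam| * wm <= eps / (16 pi)], are settled by [riemann_exp]: each end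
    costs [eps / 4 * M] and the Taylor error [eps / 2 * M]. The other frequencies are left to the
    last hypothesis. *)
Lemma balanced_of_small eps (M n0 L : nat) (wm : R) (a := fun i => F 0%N (n0 + i)%N%:R) :
  0 < eps -> (0 < n0)%N -> (forall i, (i < L.+1)%N -> 0 <= a i) -> (forall i, (i < L.+1)%N -> 0 <= dif a i <= wm) ->
  (forall i, (i < L.+1)%N -> a i < M%:R) -> M%:R <= a L.+1 ->
  wm <= eps / 4 * M%:R -> wm <= M%:R -> a 0%N <= eps / 4 * M%:R -> a 0%N <= M%:R / 2 ->
  (forall lam, lam != 0 -> `|lam| <= 2 -> e (lam * M%:R) = 1 -> eps / (16 * pi) < `|lam| * wm ->
      nrm (\sum_(i < L.+1) ((dif a i)%:C)%C * e (lam * a i)) <= eps * M%:R) ->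
  balanced_weights eps M n0 L.+1.
Proof.
move=> eps0 n00 ha hd hM hL w1 w2 a1 a2 hl.
have aL : a L.+1 - M%:R <= wm.
  have := hM L (leqnn _); have /andP[_] := hd L (leqnn _); rewrite /dif; lra.
split => //.
- by move=> i iL; rewrite ha ?hM.
- by move=> i /hd /andP[].
- rewrite -(big_mkord xpredT (fun i => dif a i)) telescope_sumr //; lra.
move=> lam l0 l2 hlM; have [h|h] := leP (`|lam| * wm) (eps / (16 * pi)); last exact: hl.
apply: le_trans (riemann_exp l0 hlM hd) _.
rewrite (ger0_norm (_ : 0 <= a L.+1 - M%:R)) ?subr_ge0 // (ger0_norm (ha _ _)) //.
have a00 := ha 0%N isT.
have M0 : 0 <= M%:R :> R by [].
have wm0 : 0 <= wm by have /andP[q1 q2] := hd 0%N isT; apply: le_trans q2.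
have : 4 * pi * (`|lam| * wm) * (a L.+1 - a 0%N) <= 4 * pi * (eps / (16 * pi)) * (2 * M%:R).
  apply: ler_pM; rewrite ?ler_wpM2l ?mulr_ge0 ?pi_ge0 //; lra.
have -> : 4 * pi * (eps / (16 * pi)) * (2 * M%:R) = eps / 2 * M%:R.
  by move: (@pi R) (lt0r_neq0 (pi_gt0 R)) => q q0; field.
lra.
Qed.

(** For [k = 0] the increments tend to 0, and [eta] is so small that every [|lam| <= 2] is a low
    frequency. For [k > 0] the increments are at most [wm = C1 * F 1 y] at the end point [y]; a
    frequency that is not low satisfies the hypothesis of [uniform_weyl], and summation by parts
    costs [wm] times [eps2 * y], where [y * wm = O(M)]. *)
Lemma balanced_weights_exist eps : 0 < eps ->
  exists M0 : nat, forall M, (M0 <= M)%N -> exists n0 L, balanced_weights eps M n0 L.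
Proof.
move=> eps0.
have [X0 hX0] := ev_and (ev_and (hg_der hF 0) F1_ge0) (hoo 0).
have hunb n0 C : exists i, C <= F 0%N (n0 + i)%N%:R.
  have [X hX] := hoo C; have [i [_ hi]] := start_point X.
  by exists i; apply: hX; rewrite addnC.
have hmvt x : X0 < x -> exists xi, [/\ x < xi, xi < x + 1 & F 0%N (x + 1) - F 0%N x = F 1%N xi].
  move=> hx; have [xi [h1 h2 h3]] := mvt (fun x hx => (hX0 x hx).1.1) hx (ltac:(by rewrite ltrDl) : x < x + 1).
  by exists xi; split => //; rewrite h3; ring.
have hmono x y : X0 < x -> x <= y -> F 0%N x <= F 0%N y.
  by apply: der_ge0_mono => z hz; [exact: (hX0 z hz).1.1|exact: (hX0 z hz).1.2].
case: (posnP k) => [k0|k0].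
- have hs := hg_small hF; rewrite k0 in hs.
  have [eta heta eta0] : exists2 eta, eta = eps / (32 * pi) & 0 < eta.
    by exists (eps / (32 * pi)) => //; rewrite divr_gt0 // mulr_gt0 // pi_gt0.
  have [X1 hX1] := hs _ eta0.
  have [n0 [n00 hn0]] := start_point (Num.max X0 X1).
  pose a i := F 0%N (n0 + i)%N%:R.
  have hn i : X0 < (n0 + i)%N%:R by have := hn0 i; rewrite gt_max => /andP[].
  have hd i : 0 <= dif a i <= eta.
    have [xi [x1 x2 x3]] := hmvt _ (hn i).
    rewrite /dif /a addnS -natr1 x3.
    have xX0 := lt_trans (hn i) x1.
    rewrite (hX0 _ xX0).1.2 /= (le_trans (ler_norm _)) // hX1 //.
    by have := hn0 i; rewrite gt_max => /andP[_ /lt_trans]; apply.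
  exists (Num.truncn (Num.max (Num.max (4 * eta / eps) eta) (Num.max (4 * a 0%N / eps) (2 * a 0%N)))).+1 => M hM.
  have : Num.max (Num.max (4 * eta / eps) eta) (Num.max (4 * a 0%N / eps) (2 * a 0%N)) < M%:R.
    by apply: lt_le_trans (truncnS_gt _) _; rewrite ler_nat.
  rewrite !gt_max !ltr_pdivrMr // => /andP[/andP[b1 b2] /andP[b3 b4]].
  have a00 : 0 <= a 0%N by apply: (hX0 _ (hn 0%N)).2.
  have [L [hL1 hL2]] := @first_passage a M (fun i => let: conj h _ := andP (hd i) in h) (hunb n0) ltac:(lra).
  exists n0, L.+1; apply: (balanced_of_small (wm := eta)) => //; try lra.
  + by move=> i _; apply: (hX0 _ (hn i)).2.
  + by rewrite -/(a 0%N); lra.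
  + by rewrite -/(a 0%N); lra.
  + move=> lam _ l2 _; rewrite ltNge; have : `|lam| * eta <= 2 * eta by rewrite ler_wpM2r // ltW.
    have -> : eps / (16 * pi) = 2 * eta by rewrite heta; move: (@pi R) (lt0r_neq0 (pi_gt0 R)) => q q0; field.
    by move=> ->.
have [C1 [C2 [X1 [C10 C20 hC1 hC2]]]] := F1_cmp k0.
have [sg [X2 hX2]] : exists sg : bool, ev (fun x => der (F 1%N) x (F 2%N x) /\ 0 <= (-1) ^+ sg * F 2%N x).
  case: (hg_sign hF 2) => h; [exists false|exists false|exists true]; apply: (evW2 _ (hg_der hF 1) h) => x hx hs; split => //.
  - by rewrite hs mulr0.
  - by rewrite mul1r ltW.
  - by rewrite mulN1r oppr_ge0 ltW.
have [n0 [n00 hn0]] := start_point (Num.max X0 (Num.max X1 X2)).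
pose a i := F 0%N (n0 + i)%N%:R.
have hn i : [/\ X0 < (n0 + i)%N%:R, X1 < (n0 + i)%N%:R & X2 < (n0 + i)%N%:R].
  by have := hn0 i; rewrite !gt_max => /and3P[].
have hdx i : exists xi, [/\ (n0 + i)%N%:R < xi, xi < (n0 + i.+1)%N%:R & dif a i = F 1%N xi].
  have [h0 _ _] := hn i; have [xi [x1 x2 x3]] := hmvt _ h0.
  by exists xi; rewrite /dif /a addnS -natr1 x3.
have hd0 i : 0 <= dif a i.
  have [xi [x1 x2 ->]] := hdx i; have [h0 _ _] := hn i.
  by apply: (hX0 _ (lt_trans h0 x1)).1.2.
have hdm : (forall i, dif a i <= dif a i.+1) \/ (forall i, dif a i.+1 <= dif a i).
  case: sg hX2 => hX2; [right|left] => i.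
    have [xi [x1 x2 ->]] := hdx i; have [yi [y1 y2 ->]] := hdx i.+1; have [_ _ h0] := hn i.
    apply: (der_le0_mono (X := X2) (fun z hz => (hX2 z hz).1)); first by move=> z /hX2[_]; rewrite mulN1r oppr_ge0.
      exact: lt_trans x1.
    exact: ltW (lt_trans x2 y1).
  have [xi [x1 x2 ->]] := hdx i; have [yi [y1 y2 ->]] := hdx i.+1; have [_ _ h0] := hn i.
  apply: (der_ge0_mono (X := X2) (fun z hz => (hX2 z hz).1)); first by move=> z /hX2[_]; rewrite mul1r.
    exact: lt_trans x1.
  exact: ltW (lt_trans x2 y1).
pose kap := eps / (16 * pi) / C1.
have kap0 : 0 < kap by rewrite !divr_gt0 // mulr_gt0 // pi_gt0.
(* Since [y * wm <= 2 C1 C2 M], the final bound [4 * eps2 * (y * wm)] is at most [eps * M]. *)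
pose eps2 := eps / (8 * C1 * C2).
have eps20 : 0 < eps2 by rewrite divr_gt0 // !mulr_gt0.
have [N0 hN0] := uniform_weyl hF k0 eps20 kap0 hgrowth.
pose B := Num.max (2 * C1 * C2) (8 * C1 * C2 / eps).
pose N1 := maxn N0 (Num.truncn B).+1.
pose B2 := Num.max (Num.max (F 0%N (n0 + N1)%N%:R) 1) (Num.max (4 * a 0%N / eps) (2 * a 0%N)).
exists (Num.truncn B2).+1 => M hM.
have : B2 < M%:R by apply: lt_le_trans (truncnS_gt _) _; rewrite ler_nat.
rewrite /B2 !gt_max !ltr_pdivrMr // => /andP[/andP[b1 b2] /andP[b3 b4]].
have ha i : 0 <= a i by have [h0 _ _] := hn i; exact: (hX0 _ h0).2.
have a00 := ha 0%N.
have [L [hL1 hL2]] := @first_passage a M hd0 (hunb n0) ltac:(lra).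
pose N := (n0 + L.+1)%N; pose y : R := N%:R.
have [hy0 hy1 hy2] := hn L.+1; rewrite -/N -/y in hy0 hy1 hy2.
have NN1 : (N1 <= N)%N.
  rewrite leqNgt; apply/negP => NN.
  have : a L.+1 <= F 0%N (n0 + N1)%N%:R.
    by apply: hmono => //; rewrite ler_nat (leq_trans (ltnW NN)) // leq_addl.
  by lra.
have hB : B < y.
  by apply: lt_le_trans (truncnS_gt _) _; rewrite ler_nat (leq_trans _ NN1) // leq_maxr.
move: hB; rewrite /B gt_max ltr_pdivrMr // => /andP[hB1 hB2].
have y0 : 0 < y by apply: lt_trans hB1; rewrite !mulr_gt0.
have hyC : y * F 1%N y <= C2 * a L.+1 by apply: hC2.
have F1y : 0 <= F 1%N y := (hX0 _ hy0).1.2.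
pose wm := C1 * F 1%N y.
have wm0 : 0 <= wm by rewrite mulr_ge0 // ltW.
have hd i : (i < L.+1)%N -> 0 <= dif a i <= wm.
  move=> iL; rewrite hd0 /=; have [xi [x1 x2 ->]] := hdx i; have [_ h1 _] := hn i.
  apply: hC1; first exact: lt_trans x1.
  by apply: le_trans (ltW x2) _; rewrite ler_nat leq_add2l.
(* The first value beyond [M] overshoots by at most [wm], which is at most half of that value. *)
have haL : a L.+1 <= 2 * M%:R.
  have h1 : a L.+1 <= M%:R + wm.
    by have /andP[_] := hd L (leqnn _); have := hL1 L (leqnn _); rewrite /dif; lra.
  have h2 : wm <= a L.+1 / 2.
    rewrite -(ler_pM2l y0) /wm; apply: le_trans (_ : C1 * (C2 * a L.+1) <= _).
      by rewrite mulrCA ler_pM2l.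
    have : 2 * C1 * C2 * a L.+1 <= y * a L.+1 by rewrite ler_wpM2r // ltW.
    lra.
  lra.
have hyM : y * F 1%N y <= C2 * (2 * M%:R) by apply: le_trans hyC _; rewrite ler_pM2l.
have hywm : y * wm <= C1 * C2 * 2 * M%:R.
  by rewrite /wm mulrCA -!mulrA ler_pM2l.
have M0 : 0 <= M%:R :> R by [].
have h3 : a 0%N <= eps / 4 * M%:R by lra.
have h4 : a 0%N <= M%:R / 2 by lra.
exists n0, L.+1; apply: (balanced_of_small (wm := wm)) => //.
- by move=> i _; exact: ha.
- rewrite -(ler_pM2l y0); apply: le_trans hywm _.
  have : 8 * C1 * C2 * M%:R <= y * eps * M%:R by rewrite ler_wpM2r // ltW.
  lra.
- rewrite -(ler_pM2l y0); apply: le_trans hywm _.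
  have : 2 * C1 * C2 * M%:R <= y * M%:R by rewrite ler_wpM2r // ltW.
  lra.
move=> lam l0 l2 _ hlam.
have hlam' : kap <= `|lam| * F 1%N y.
  by rewrite /kap ler_pdivrMr //; move: hlam; rewrite /wm; lra.
pose u n := e (lam * F 0%N n%:R).
pose Z i := \sum_(n < n0 + i) u n - \sum_(n < n0) u n.
have hZ i : ((dif a i)%:C)%C * e (lam * a i) = ((dif a i)%:C)%C * (Z i.+1 - Z i).
  by rewrite /Z addnS big_ord_recr /=; congr (_ * _); rewrite /u /a; ring.
rewrite (eq_bigr _ (fun (i : 'I_L.+1) _ => hZ i)).
have hS N' : (N' <= N)%N -> nrm (\sum_(n < N') u n) <= eps2 * y.
  by move=> N'N; apply: hN0 => //; apply: leq_trans NN1; exact: leq_maxl.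
apply: le_trans (@abel_sum _ L.+1 (dif a) Z wm (2 * (eps2 * y)) _ hd _ _ wm0) _.
- exact: mulr_ge0 (ler0n _ _) (mulr_ge0 (ltW eps20) (ltW y0)).
- move=> i iL; apply: le_trans (nrmB _ _) _; rewrite (mulr_natl _ 2) mulr2n lerD // hS ?leq_add2l //.
  exact: leq_addr.
- by case: hdm => h; [left|right] => i _; exact: h.
have -> : 2 * wm * (2 * (eps2 * y)) = 4 * eps2 * (y * wm) by ring.
apply: le_trans (_ : 4 * eps2 * (C1 * C2 * 2 * M%:R) <= _).
  by rewrite ler_pM2l // mulr_gt0.
rewrite le_eqVlt; apply/orP; left; apply/eqP; rewrite /eps2; field.
by rewrite !lt0r_neq0.
Qed.
End WithF.
End Equidistribution.

(** * Fourier analysis on the circle of length [M] and the kernel *)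

Section Kernel.
Variable R : realType.
Implicit Types (x y v lam eps : R) (z : R[i]).

Lemma conj_real x : ((x%:C)^*)%C = (x%:C)%C.
Proof. by apply/eqP; rewrite eq_complex /= oppr0 !eqxx. Qed.

Lemma conjM z (t : R[i]) : ((z * t)^*)%C = (z^*)%C * (t^*)%C.
Proof. exact: (rmorphM (@conjc R)). Qed.

Lemma conj_sum (I : Type) (r : seq I) (P : pred I) (F : I -> R[i]) :
  ((\sum_(i <- r | P i) F i)^*)%C = \sum_(i <- r | P i) ((F i)^*)%C.
Proof. exact: (rmorph_sum (@conjc R)). Qed.

Lemma ReD z (t : R[i]) : complex.Re (z + t) = complex.Re z + complex.Re t.
Proof. by case: z; case: t. Qed.

Lemma e_muln lam s : e (s%:R * lam) = e lam ^+ s.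
Proof.
elim: s => [|s IH]; first by rewrite mul0r e0.
by rewrite -natr1 mulrDl mul1r eD IH exprSr.
Qed.

Lemma e_neq1 x : 0 < `|x| -> `|x| < 1 -> e x != 1.
Proof.
move=> x0 x1; apply/eqP => h.
have : cos (2 * pi * x) = 1 by move: h; rewrite /e => /eqP; rewrite eq_complex => /andP[/eqP].
have := @one_sub_cos R (2 * pi * x); have -> : 2 * pi * x / 2 = pi * x by field.
move=> h1 h2; have : sin (pi * x) ^+ 2 = 0 by move: h1; rewrite h2; lra.
have -> : sin (pi * x) ^+ 2 = sin (pi * `|x|) ^+ 2.
  by case: (ger0P x) => // _; rewrite mulrN sinN sqrrN.
move=> /eqP; rewrite sqrf_eq0 => /eqP h3.
have : 0 < sin (pi * `|x|).
  by apply: sin_gt0_pi; rewrite mulr_gt0 ?pi_gt0 //= -[ltRHS]mulr1 ltr_pM2l ?pi_gt0.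
by rewrite h3 ltxx.
Qed.

Lemma sum_roots (n : nat) x : (0 < n)%N -> 0 < `|x| -> `|x| < 1 -> e (n%:R * x) = 1 -> \sum_(s < n) e (s%:R * x) = 0.
Proof.
move=> n0 x0 x1 hn.
have h : (e x - 1) * \sum_(s < n) e (s%:R * x) = 0.
  by rewrite (eq_bigr (fun s : 'I_n => e x ^+ s)) => [|s _]; rewrite ?e_muln // -subrX1 -e_muln hn subrr.
by move/eqP: h; rewrite mulf_eq0 subr_eq0 (negbTE (e_neq1 x0 x1)) /= => /eqP.
Qed.

(** Orthogonality over two full periods in [s], the range of the coefficients of [dker]. The
    unimodular [c] accommodates translated frequencies. *)
Lemma parseval (M : nat) (P : pred 'I_M) (c : 'I_M -> R[i]) : (0 < M)%N -> (forall i, nrm (c i) = 1) ->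
  \sum_(s < 2 * M) nrm (\sum_(i < M | P i) c i * e (s%:R * (i%:R / M%:R))) ^+ 2 = 2 * M%:R * #|P|%:R.
Proof.
move=> M0 hc; have MR : M%:R != 0 :> R by rewrite pnatr_eq0 -lt0n.
have MR0 : 0 < M%:R :> R by rewrite ltr0n.
suff : ((\sum_(s < 2 * M) nrm (\sum_(i < M | P i) c i * e (s%:R * (i%:R / M%:R))) ^+ 2)%:C)%C = ((2 * M%:R * #|P|%:R)%:C)%C :> R[i].
  by move=> /(congr1 (@complex.Re R)).
rewrite rmorph_sum /=.
under eq_bigr => s _ do rewrite -mulJ_nrm conj_sum mulr_suml.
rewrite exchange_big /=.
have hx i : P i -> \sum_(s < 2 * M) c i * e (s%:R * (i%:R / M%:R)) * (\sum_(j < M | P j) (c j * e (s%:R * (j%:R / M%:R)))^*%C) = ((2 * M%:R)%:C)%C.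
  move=> Px.
  under eq_bigr => s _ do rewrite mulr_sumr.
  rewrite exchange_big /= (bigD1 i) //= [X in _ + X]big1 => [|j /andP[_ yx]]; last first.
    have hs (s : nat) : c i * e (s%:R * (i%:R / M%:R)) * (c j * e (s%:R * (j%:R / M%:R)))^*%C = c i * (c j)^*%C * e (s%:R * ((i%:R - j%:R) / M%:R)).
      have -> : s%:R * ((i%:R - j%:R) / M%:R) = s%:R * (i%:R / M%:R) - s%:R * (j%:R / M%:R) :> R by ring.
      by rewrite eB conjM; ring.
    under eq_bigr => s _ do rewrite hs.
    rewrite -mulr_sumr sum_roots ?mulr0 ?muln_gt0 //.
    - by rewrite normr_gt0 mulf_neq0 ?invr_neq0 // subr_eq0 eqr_nat eq_sym.
    - rewrite normrM normfV (gtr0_norm MR0) ltr_pdivrMr // mul1r ltr_norml.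
      have hx : i%:R < M%:R :> R by rewrite ltr_nat.
      have hy : j%:R < M%:R :> R by rewrite ltr_nat.
      have x0 : 0 <= i%:R :> R by [].
      have y0 : 0 <= j%:R :> R by [].
      by apply/andP; split; lra.
    - have -> : (2 * M)%:R * ((i%:R - j%:R) / M%:R) = (2 * i)%:R - (2 * j)%:R :> R by rewrite !natrM; field.
      by rewrite eB !e_nat rmorph1 mulr1.
  rewrite addr0 (eq_bigr (fun=> 1)) => [|s _].
    by rewrite sumr_const card_ord -natrM rmorph_nat.
  by rewrite mulJ_nrm nrmM nrm_e hc mulr1 expr1n.
have hn (t : R) n : ((t%:C)%C : R[i]) *+ n = ((t *+ n)%:C)%C.
  by elim: n => [|n IH]; rewrite ?mulr0n // !mulrS IH -rmorphD.
by rewrite (eq_bigr _ hx) sumr_const hn (mulr_natr (2 * M%:R : R)).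
Qed.

Section Fejer.
Variable M : nat.
Hypothesis M0 : (0 < M)%N.
(** The sines [d] solve the eigenvector recurrence [d_rec] and vanish at 0 and [2 * M]; this leaves
    only boundary terms in [dker_partial]. *)
Let a : R := pi / (2 * M%:R).
Let d (s : nat) : R := sin (s%:R * a).
Definition dker v : R[i] := \sum_(s < 2 * M) ((d s)%:C)%C * e (s%:R * (v / M%:R)).

Let MR0 : 0 < M%:R :> R. Proof. by rewrite ltr0n. Qed.

Lemma d_end s : (s <= 2 * M)%N -> d (2 * M - s) = d s.
Proof.
move=> sM; rewrite /d natrB // mulrBl.
have -> : (2 * M)%:R * a = pi.
  by rewrite /a natrM; move: (lt0r_neq0 MR0); set m : R := M%:R => m0; move: (@pi R) => q; field.
by rewrite sinB sinpi cospi; ring.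
Qed.

Lemma d_rec s : d s.+2 + d s = 2 * cos a * d s.+1.
Proof.
rewrite /d.
have -> : s.+2%:R * a = s.+1%:R * a + a by rewrite -[s.+2%:R]natr1; ring.
have -> : s%:R * a = s.+1%:R * a - a by rewrite -[s.+1%:R]natr1; ring.
by rewrite sinD sinB; ring.
Qed.

(** The coefficient of frequency 0 in [|dker v|^2]. *)
Lemma d_sqr : \sum_(s < 2 * M) d s ^+ 2 = M%:R.
Proof.
have h (s : nat) : d s ^+ 2 = 2^-1 - 2^-1 * complex.Re (e (s%:R * (1 / (2 * M%:R)))).
  rewrite /= /d; have := @one_sub_cos R (2 * pi * (s%:R * (1 / (2 * M%:R)))).
  have -> : 2 * pi * (s%:R * (1 / (2 * M%:R))) / 2 = s%:R * a :> R.
    by rewrite /a; move: (lt0r_neq0 MR0); set m : R := M%:R => m0; move: (@pi R) => q; field.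
  lra.
under eq_bigr => s _ do rewrite h.
have hs : \sum_(s < 2 * M) e (s%:R * (1 / (2 * M%:R))) = 0 :> R[i].
  have M2 : 0 < 2 * M%:R :> R by rewrite mulr_gt0.
  have M1 : 1 <= M%:R :> R by rewrite ler1n.
  apply: sum_roots; rewrite ?muln_gt0 //.
  - by rewrite normr_gt0 mulf_neq0 ?invr_neq0 ?oner_neq0 // lt0r_neq0.
  - rewrite gtr0_norm ?divr_gt0 // ltr_pdivrMr //; lra.
  - by rewrite natrM mul1r divff ?lt0r_neq0 // e1.
rewrite sumrB sumr_const card_ord -mulr_sumr -(raddf_sum (@complex.Re R)) hs /= mulr0 subr0.
by rewrite -[LHS]mulr_natr (natrM _ 2 M) mulrA mulVf ?mul1r // pnatr_eq0.
Qed.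

Let z v := e (v / M%:R) : R[i].

(** As the conjugate of [z] is its inverse, the factor applies [d_rec] to the coefficients, which
    cancels all interior terms. *)
Lemma dker_partial v n : (z v + (z v)^*%C - 2 * ((cos a)%:C)%C) * (\sum_(s < n.+1) ((d s)%:C)%C * e (s%:R * (v / M%:R))) =
  ((sin a)%:C)%C - ((d n.+1)%:C)%C * e (n%:R * (v / M%:R)) + ((d n)%:C)%C * e (n.+1%:R * (v / M%:R)).
Proof.
have hz : z v * (z v)^*%C = 1 by rewrite mulJ_nrm nrm_e expr1n.
elim: n => [|n IH].
  by rewrite big_ord_recl big_ord0 /d !mul0r sin0 mul1r e0; ring.
rewrite big_ord_recr /= mulrDr IH !e_muln -/(z v).
have -> : d n.+2 = 2 * cos a * d n.+1 - d n by have := d_rec n; lra.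
rewrite rmorphB !rmorphM /= (rmorph_nat _ 2) !exprS.
have -> : (z v + (z v)^*%C - 2 * ((cos a)%:C)%C) * (((d n.+1)%:C)%C * (z v * z v ^+ n)) =
  (z v * z v + z v * (z v)^*%C - 2 * ((cos a)%:C)%C * z v) * (((d n.+1)%:C)%C * z v ^+ n) by ring.
rewrite hz; ring.
Qed.

(** At full length the boundary terms are [sin a (1 + e (2 M v / M))]. The symmetry [d_end] says
    that this exponential times the conjugate of [dker v] is [dker v], so multiplying by the
    conjugate gives twice the asserted identity. *)
Lemma dker_id v : (cos (2 * pi * (v / M%:R)) - cos a) * nrm (dker v) ^+ 2 = sin a * complex.Re (dker v).
Proof.
have hM : (2 * M = (2 * M).-1.+1)%N by rewrite prednK // muln_gt0.
have d2M : d (2 * M) = 0 by rewrite -(subn0 (2 * M)%N) d_end // /d mul0r sin0.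
have d2M1 : d (2 * M).-1 = sin a by rewrite -subn1 d_end ?muln_gt0 // /d mul1r.
have h1 : (z v + (z v)^*%C - 2 * ((cos a)%:C)%C) * dker v = ((sin a)%:C)%C * (1 + e ((2 * M)%:R * (v / M%:R))).
  have -> : dker v = \sum_(s < (2 * M).-1.+1) ((d s)%:C)%C * e (s%:R * (v / M%:R)) by rewrite /dker -hM.
  rewrite dker_partial -hM d2M d2M1 mul0r; ring.
have h2 : e ((2 * M)%:R * (v / M%:R)) * (dker v)^*%C = dker v.
  have ext (f : nat -> R[i]) : \sum_(s < 2 * M) ((d s)%:C)%C * f s = \sum_(s < (2 * M).+1) ((d s)%:C)%C * f s.
    by rewrite big_ord_recr /= d2M mul0r addr0.
  rewrite /dker conj_sum mulr_sumr.
  have ht (s : nat) : e ((2 * M)%:R * (v / M%:R)) * (((d s)%:C)%C * e (s%:R * (v / M%:R)))^*%C =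
      ((d s)%:C)%C * e (((2 * M)%:R - s%:R) * (v / M%:R)).
    rewrite mulrBl eB conjM conj_real; ring.
  under eq_bigr => s _ do rewrite ht.
  rewrite (ext (fun s => e (((2 * M)%:R - s%:R) * (v / M%:R)))) (ext (fun s => e (s%:R * (v / M%:R)))).
  rewrite (reindex_inj rev_ord_inj) /=; apply: eq_bigr => s _.
  have sM : (s <= 2 * M)%N by rewrite -ltnS.
  by rewrite subSS d_end // natrB // opprB addrC subrK.
have h3 : (z v + (z v)^*%C - 2 * ((cos a)%:C)%C) * (dker v * (dker v)^*%C) = ((sin a)%:C)%C * ((dker v)^*%C + dker v).
  by rewrite mulrA h1 -mulrA mulrDl mul1r h2.
have := congr1 (@complex.Re R) h3.
rewrite mulJ_nrm /z /e; case: (dker v) => p q /=.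
set nn := nrm _; rewrite !(mul0r, mulr0, subr0, addr0, oppr0, add0r); lra.
Qed.

(* By [dker_id], [(cos (2 pi v / M) - cos 2a) |D v|^2 = (cos a - cos 2a) |D v|^2 + sin a Re (D v)], a trigonometric polynomial
   with frequencies below [2M] and positive constant term, which is positive only for [v] within [1/2] of [M Z]. *)
Lemma kernel_positivity (J : finType) (P : pred J) (w v : J -> R) (G : R -> R[i]) : (4 <= M)%N ->
  (forall j, P j -> 0 <= w j) -> (forall j, P j -> cos (2 * pi * (v j / M%:R)) <= cos (pi / M%:R)) ->
  (forall lam, G lam = \sum_(j | P j) ((w j)%:C)%C * e (lam * (v j / M%:R))) ->
  M%:R * \sum_(j | P j) w j <=
    \sum_(s < 2 * M) \sum_(t < 2 * M | t != s) nrm (G (s%:R - t%:R)) + 2 * M%:R * \sum_(s < 2 * M | (0 < s)%N) nrm (G s%:R).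
Proof.
move=> M4 hw hv hG.
set E1 := \sum_(s < 2 * M) _; set E2 := \sum_(s < 2 * M | _) _; set W := \sum_(j | P j) w j.
have M4R : 4 <= M%:R :> R by rewrite ler_nat.
have aM : a * M%:R = pi / 2 by rewrite /a; move: (lt0r_neq0 MR0); set m : R := M%:R => m0; move: (@pi R) => q; field.
have [a1 a2] : 1 <= a * M%:R /\ a <= 2^-1.
  rewrite aM; split; first exact: pihalf_ge1.
  have := @pihalf_lt2 R; rewrite -aM => h; nra.
have a0 : 0 < a by rewrite -(pmulr_lgt0 _ MR0); lra.
have [s1 s2] : a / 2 <= sin a /\ sin a <= 1.
  split; last exact: sin_le1.
  by have := sin_taylor a; rewrite ler_norml => /andP[h _]; move: h; nra.
have c1 : 0 <= cos a by have := cos_abs a; rewrite (ger0_norm (ltW a0)) ler_norml => /andP[h _]; lra.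
have ca1 : cos a <= 1 := cos_le1 a.
set c0 := cos a - cos (pi / M%:R).
have a2E : pi / M%:R = a *+ 2.
  by rewrite /a mulr2n; move: (lt0r_neq0 MR0); set m : R := M%:R => m0; move: (@pi R) => q; field.
have hc0 : sin a ^+ 2 <= c0.
  rewrite /c0 a2E cos_mulr2n; have := cos2Dsin2 a.
  have : 0 <= cos a * (1 - cos a) by rewrite mulr_ge0 ?subr_ge0.
  by move: (cos a) (sin a) => q q'; lra.
have c00 : 0 < c0 by apply: lt_le_trans hc0; rewrite exprn_gt0 //; lra.
(* This lets [c0] cancel at the end: [2 M sin a >= a M = pi / 2 >= 1], hence
   [sin a <= 2 M (sin a)^2 <= 2 M c0]. *)
have hs : sin a <= 2 * M%:R * c0.
  apply: le_trans (_ : 2 * M%:R * sin a ^+ 2 <= _); last by rewrite ler_wpM2l // mulr_ge0 ?ltW.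
  have sa0 : 0 <= sin a by lra.
  have : 1 <= 2 * M%:R * sin a by nra.
  rewrite expr2; nra.
have dle s : `|d s| <= 1 := sin_max _.
have hD2 : \sum_(j | P j) w j * nrm (dker (v j)) ^+ 2 = complex.Re (\sum_(s < 2 * M) \sum_(t < 2 * M) ((d s * d t)%:C)%C * G (s%:R - t%:R)).
  suff <- : ((\sum_(j | P j) w j * nrm (dker (v j)) ^+ 2)%:C)%C = (\sum_(s < 2 * M) \sum_(t < 2 * M) ((d s * d t)%:C)%C * G (s%:R - t%:R)) by [].
  rewrite rmorph_sum /=.
  have -> : \sum_(s < 2 * M) \sum_(t < 2 * M) ((d s * d t)%:C)%C * G (s%:R - t%:R) =
     \sum_(j | P j) \sum_(s < 2 * M) \sum_(t < 2 * M) ((d s * d t)%:C)%C * (((w j)%:C)%C * e ((s%:R - t%:R) * (v j / M%:R))).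
    rewrite [RHS]exchange_big /=; apply: eq_bigr => s _; rewrite [RHS]exchange_big /=; apply: eq_bigr => t _.
    by rewrite hG mulr_sumr.
  apply: eq_bigr => j _; rewrite rmorphM /= -mulJ_nrm /dker conj_sum mulr_suml mulr_sumr.
  apply: eq_bigr => s _; rewrite !mulr_sumr; apply: eq_bigr => t _.
  rewrite conjM conj_real.
  have -> : ((d s * d t)%:C)%C = ((d s)%:C)%C * ((d t)%:C)%C :> R[i] by rewrite -rmorphM.
  by rewrite mulrBl eB; ring.
have hD1 : \sum_(j | P j) w j * complex.Re (dker (v j)) = complex.Re (\sum_(s < 2 * M) ((d s)%:C)%C * G s%:R).
  have -> : \sum_(s < 2 * M) ((d s)%:C)%C * G s%:R = \sum_(j | P j) ((w j)%:C)%C * dker (v j).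
    under eq_bigr => s _ do rewrite hG mulr_sumr.
    rewrite exchange_big /=; apply: eq_bigr => j _; rewrite /dker mulr_sumr; apply: eq_bigr => s _; ring.
  rewrite raddf_sum; apply: eq_bigr => j _.
  by case: (dker (v j)) => p q /=; rewrite mul0r subr0.
have b1 : M%:R * W - E1 <= \sum_(j | P j) w j * nrm (dker (v j)) ^+ 2.
  rewrite hD2 -d_sqr mulr_suml /E1 -sumrB raddf_sum /=; apply: ler_sum => s _.
  rewrite [X in complex.Re X](bigD1 s) //= ReD subrr.
  have -> : complex.Re (((d s * d s)%:C)%C * G 0) = d s ^+ 2 * W.
    have -> : G 0 = ((W%:C)%C : R[i]).
      by rewrite hG /W rmorph_sum /=; apply: eq_bigr => j _; rewrite mul0r e0 mulr1.
    by rewrite /= mulr0 subr0 expr2.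
  rewrite lerD2l lerNl; apply: le_trans (ler_norm _) _; rewrite normrN; apply: le_trans (Re_le_nrm _) _.
  apply: le_trans (nrm_sum _ _ _) _; apply: ler_sum => t _.
  rewrite nrmM nrmC ler_piMl ?nrm_ge0 // normrM mulr_ile1 //.
have b2 : - E2 <= \sum_(j | P j) w j * complex.Re (dker (v j)).
  rewrite hD1 lerNl; apply: le_trans (ler_norm _) _; rewrite normrN; apply: le_trans (Re_le_nrm _) _.
  apply: le_trans (nrm_sum _ _ _) _; rewrite /E2 [leRHS]big_mkcond /=; apply: ler_sum => s _.
  case: posnP => [->|_]; first by rewrite nrmM nrmC /d mul0r sin0 normr0 mul0r.
  by rewrite nrmM nrmC ler_piMl ?nrm_ge0.
have b3 : c0 * (\sum_(j | P j) w j * nrm (dker (v j)) ^+ 2) + sin a * (\sum_(j | P j) w j * complex.Re (dker (v j))) <= 0.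
  rewrite !mulr_sumr -big_split /= sumr_le0 // => j Pj.
  have -> : c0 * (w j * nrm (dker (v j)) ^+ 2) + sin a * (w j * complex.Re (dker (v j))) =
    w j * ((cos (2 * pi * (v j / M%:R)) - cos (pi / M%:R)) * nrm (dker (v j)) ^+ 2).
    by rewrite (mulrCA (sin a)) -dker_id /c0; ring.
  by rewrite mulr_ge0_le0 ?hw // mulr_le0_ge0 ?sqr_ge0 // subr_le0 hv.
have E20 : 0 <= E2 by rewrite sumr_ge0 // => s _; exact: nrm_ge0.
rewrite -(ler_pM2l c00).
have b4 : c0 * (M%:R * W - E1) <= c0 * (\sum_(j | P j) w j * nrm (dker (v j)) ^+ 2) by rewrite ler_pM2l.
have b5 : sin a * (- E2) <= sin a * (\sum_(j | P j) w j * complex.Re (dker (v j))) by rewrite ler_wpM2l //; lra.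
have b6 : sin a * E2 <= 2 * M%:R * c0 * E2 by rewrite ler_wpM2r.
move: b3 b4 b5 b6.
set Q1 := \sum_(j | P j) w j * nrm _ ^+ 2; set Q2 := \sum_(j | P j) w j * complex.Re _; lra.
Qed.
End Fejer.

(** The cosine condition puts [v] within 1/2 of a multiple of [M], and the bound on [|v|] leaves
    only the multiple 0. *)
Lemma cos_near (M : nat) v : (0 < M)%N -> `|v| <= M%:R - 2^-1 ->
  cos (pi / M%:R) < cos (2 * pi * (v / M%:R)) -> `|v| < 2^-1.
Proof.
move=> M0; have MR0 : 0 < M%:R :> R by rewrite ltr0n.
have M1 : 1 <= M%:R :> R by rewrite ler1n.
move=> hv; have -> : cos (2 * pi * (v / M%:R)) = cos (2 * pi * (`|v| / M%:R)).
  by case: (ger0P v) => // _; rewrite mulNr mulrN cosN.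
set b := pi / M%:R; set f := 2 * pi * _ => h.
have bE : f = 2 * `|v| * b by rewrite /f /b; ring.
have b0 : 0 < b by rewrite divr_gt0 // pi_gt0.
have bM : b * M%:R = pi by rewrite /b divfK // lt0r_neq0.
have bpi : b <= pi by rewrite -bM; nra.
rewrite ltNge; apply/negP => v2.
have fb : b <= f by rewrite bE; nra.
have f2 : f <= 2 * pi - b by rewrite bE -bM; nra.
have [fpi|fpi] := leP f pi.
  by move: h; rewrite ltr_cos ?in_itv /= ?bpi ?fpi ?(ltW b0) ?(le_trans (ltW b0) fb) // ltNge fb.
have hf : cos f = cos (2 * pi - f).
  have -> : 2 * pi - f = - f + pi *+ 2 by rewrite mulr2n; ring.
  by rewrite mulr2n addrA !cosDpi opprK cosN.
move: h; rewrite hf ltr_cos ?in_itv /= ?bpi ?(ltW b0) //; [lra|].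
by apply/andP; split; lra.
Qed.

Lemma floor_near v (n : nat) : `|v - n%:R - 2^-1| < 2^-1 -> Num.floor v = n%:Z.
Proof.
rewrite ltr_norml => /andP[h1 h2]; apply/floor_def.
by rewrite intrD -!pmulrn; apply/andP; split; lra.
Qed.

(** * Sums from two large sets meet the values of [a] *)

Section SumsetMeets.
Variables (a : nat -> R) (L M : nat) (A B : {set 'I_M}).
Let w i := dif a i.

Definition rep_sum lam := \sum_(j : 'I_L * ('I_M * 'I_M) | (j.2.1 \in A) && (j.2.2 \in B))
  ((w j.1)%:C)%C * e (lam * ((a j.1 - (j.2.1 + j.2.2)%N%:R - 2^-1) / M%:R)).
Let ft (S : {set 'I_M}) lam := \sum_(i in S) e (- (lam * (i%:R / M%:R))) : R[i].

(** The phase is additive in [a i], [x] and [y], so the triple sum factors; the shift by 1/2 is a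
    unimodular factor. *)
Lemma nrm_rep_sum lam : nrm (rep_sum lam) =
  nrm (\sum_(i < L) ((w i)%:C)%C * e (lam / M%:R * a i)) * (nrm (ft A lam) * nrm (ft B lam)).
Proof.
suff -> : rep_sum lam = \sum_(i < L) ((w i)%:C)%C * e (lam / M%:R * a i) * (ft A lam * (ft B lam * e (- (lam * (2^-1 / M%:R))))).
  by rewrite -mulr_suml !nrmM nrm_e mulr1.
rewrite /rep_sum -(pair_big xpredT (fun p : 'I_M * 'I_M => (p.1 \in A) && (p.2 \in B))
  (fun (i : 'I_L) (p : 'I_M * 'I_M) => ((w i)%:C)%C * e (lam * ((a i - (p.1 + p.2)%N%:R - 2^-1) / M%:R)))) /=.
apply: eq_bigr => i _.
rewrite -(pair_big (mem A) (mem B) (fun x y : 'I_M => ((w i)%:C)%C * e (lam * ((a i - (x + y)%N%:R - 2^-1) / M%:R)))) /=.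
rewrite /ft mulr_suml mulr_sumr; apply: eq_bigr => x _.
rewrite mulr_suml !mulr_sumr; apply: eq_bigr => y _.
have -> : lam * ((a i - (x + y)%N%:R - 2^-1) / M%:R) =
    lam / M%:R * a i + (- (lam * (x%:R / M%:R)) + (- (lam * (y%:R / M%:R)) + - (lam * (2^-1 / M%:R)))).
  by rewrite natrD; ring.
by rewrite !eD; ring.
Qed.

Hypothesis M4 : (4 <= M)%N.
Let MR0 : 0 < M%:R :> R. Proof. by rewrite ltr0n (leq_trans _ M4). Qed.

(** The translation by [s] goes into the unimodular coefficients of [parseval]. *)
Lemma ft_shift S (s : nat) : \sum_(t < 2 * M) nrm (ft S (s%:R - t%:R)) ^+ 2 <= 2 * M%:R * M%:R.
Proof.
apply: le_trans (_ : 2 * M%:R * #|S|%:R <= _); last first.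
  by rewrite ler_wpM2l ?mulr_ge0 // ler_nat -[leqRHS]card_ord max_card.
have M0 : (0 < M)%N by apply: leq_trans M4.
rewrite -(@parseval M (mem S) (fun i => e (- (s%:R * (i%:R / M%:R)))) M0) => [|i]; last by rewrite nrm_e.
apply: ler_sum => t _; rewrite le_eqVlt; apply/orP; left; apply/eqP; congr (nrm _ ^+ 2).
by apply: eq_bigr => i _; rewrite -eD; congr e; ring.
Qed.

Lemma ft_sum S : \sum_(t < 2 * M) nrm (ft S t%:R) ^+ 2 <= 2 * M%:R * M%:R.
Proof.
apply: le_trans (ft_shift S 0); apply: ler_sum => t _.
rewrite sub0r le_eqVlt; apply/orP; left; apply/eqP; congr (_ ^+ 2).
rewrite -nrmJ conj_sum; congr nrm; apply: eq_bigr => i _.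
by rewrite -eN; congr e; ring.
Qed.

(** If no sum is hit, every [v] avoids the window and [kernel_positivity] applies. Its main term is
    at least [kap^2 M^4 / 2]. Each nonzero frequency is at most [eps M] times a product of two
    transforms; by [p q <= (p^2 + q^2) / 2] and Parseval they total at most [8 eps M^4], less than
    the main term as [16 eps < kap^2]. *)
Lemma sumset_meets eps (kap : R) : (forall i, (i < L)%N -> 0 <= a i < M%:R) -> (forall i, (i < L)%N -> 0 <= dif a i) ->
  M%:R / 2 <= \sum_(i < L) dif a i ->
  (forall lam, lam != 0 -> `|lam| <= 2 -> e (lam * M%:R) = 1 ->
      nrm (\sum_(i < L) ((dif a i)%:C)%C * e (lam * a i)) <= eps * M%:R) ->
  0 < eps -> 0 < kap -> 16 * eps < kap ^+ 2 -> kap * M%:R <= #|A|%:R -> kap * M%:R <= #|B|%:R ->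
  (forall x : 'I_M, x \in A -> (2 * x + 2 <= M)%N) -> (forall x : 'I_M, x \in B -> (2 * x + 2 <= M)%N) ->
  exists i (x y : 'I_M), [/\ (i < L)%N, x \in A, y \in B & (x + y)%N%:Z = Num.floor (a i)].
Proof.
move=> ha hd hW hT eps0 kap0 hke hA hB xA xB; apply: contrapT => hno.
pose P (j : 'I_L * ('I_M * 'I_M)) := (j.2.1 \in A) && (j.2.2 \in B).
pose v (j : 'I_L * ('I_M * 'I_M)) := a j.1 - (j.2.1 + j.2.2)%N%:R - 2^-1.
have M0 : (0 < M)%N by apply: leq_trans M4.
have hcos j : P j -> cos (2 * pi * (v j / M%:R)) <= cos (pi / M%:R).
  case: j => i [x y] /andP[/= x1 y1]; rewrite leNgt; apply/negP => h; apply: hno.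
  exists i, x, y; split => //; apply/esym/floor_near; rewrite -/(v (i, (x, y))).
  (* [x + y <= M - 2] and [0 <= a i < M] prevent wrapping around the circle. *)
  apply: cos_near h => //; rewrite /v /=.
  have /andP[q1 q2] := ha i (ltn_ord i).
  have hx : (2 * x + 2)%N%:R <= M%:R :> R by rewrite ler_nat xA.
  have hy : (2 * y + 2)%N%:R <= M%:R :> R by rewrite ler_nat xB.
  have x0 : 0 <= x%:R :> R by []. have y0 : 0 <= y%:R :> R by [].
  rewrite (natrD _ (2 * x) 2) (natrM _ 2 x) in hx; rewrite (natrD _ (2 * y) 2) (natrM _ 2 y) in hy; rewrite (natrD _ x y).
  by rewrite ler_norml; apply/andP; split; lra.
have := @kernel_positivity M M0 _ P (fun j => w j.1) v rep_sum M4 (fun j _ => hd _ (ltn_ord j.1)) hcos (fun lam => erefl).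
have hG lam : lam != 0 -> `|lam| <= 2 * M%:R -> e lam = 1 ->
    nrm (rep_sum lam) <= eps * M%:R / 2 * (nrm (ft A lam) ^+ 2 + nrm (ft B lam) ^+ 2).
  move=> l0 l1 l2; rewrite nrm_rep_sum.
  apply: le_trans (_ : eps * M%:R * (nrm (ft A lam) * nrm (ft B lam)) <= _).
    rewrite ler_wpM2r ?mulr_ge0 ?nrm_ge0 // hT //.
    - by rewrite mulf_neq0 ?invr_neq0 // lt0r_neq0.
    - by rewrite normrM normfV (gtr0_norm MR0) ler_pdivrMr.
    - by rewrite divfK // lt0r_neq0.
  move: (nrm (ft A lam)) (nrm (ft B lam)) => p q.
  have -> : eps * M%:R / 2 * (p ^+ 2 + q ^+ 2) = eps * M%:R * ((p ^+ 2 + q ^+ 2) / 2) by ring.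
  by rewrite ler_wpM2l ?mulr_ge0 ?(ltW eps0) //; have := sqr_ge0 (p - q); rewrite sqrrB; lra.
have eM : 0 <= eps * M%:R / 2 by rewrite divr_ge0 // mulr_ge0 // ltW.
have b1 (s : nat) : (s < 2 * M)%N -> \sum_(t < 2 * M | t != s :> nat) nrm (rep_sum (s%:R - t%:R)) <= eps * M%:R / 2 * (4 * M%:R * M%:R).
  move=> sM; apply: le_trans (_ : \sum_(t < 2 * M) eps * M%:R / 2 * (nrm (ft A (s%:R - t%:R)) ^+ 2 + nrm (ft B (s%:R - t%:R)) ^+ 2) <= _).
    rewrite big_mkcond /=; apply: ler_sum => t _; case: eqP => [_|/eqP ts] /=.
      by rewrite mulr_ge0 ?addr_ge0 ?sqr_ge0.
    apply: hG.
    - by rewrite subr_eq0 eqr_nat eq_sym.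
    - have s1 : s%:R <= (2 * M)%:R :> R by rewrite ler_nat ltnW.
      have t1 : t%:R <= (2 * M)%:R :> R by rewrite ler_nat ltnW.
      have s0 : 0 <= s%:R :> R by []. have t0 : 0 <= t%:R :> R by [].
      by move: s1 t1; rewrite (natrM _ 2) ler_norml => s1 t1; apply/andP; split; lra.
    - by rewrite eB !e_nat rmorph1 mulr1.
  rewrite -mulr_sumr ler_wpM2l // big_split /=.
  by have := ft_shift A s; have := ft_shift B s; lra.
have b2 : \sum_(s < 2 * M | (0 < s)%N) nrm (rep_sum s%:R) <= eps * M%:R / 2 * (4 * M%:R * M%:R).
  apply: le_trans (_ : \sum_(t < 2 * M) eps * M%:R / 2 * (nrm (ft A t%:R) ^+ 2 + nrm (ft B t%:R) ^+ 2) <= _).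
    rewrite big_mkcond /=; apply: ler_sum => t _; case: posnP => [_|t0] /=.
      by rewrite mulr_ge0 ?addr_ge0 ?sqr_ge0.
    apply: hG; rewrite ?e_nat // ?pnatr_eq0 -?lt0n //.
    by rewrite ger0_norm // -(natrM _ 2) ler_nat ltnW.
  rewrite -mulr_sumr ler_wpM2l // big_split /=.
  by have := ft_sum A; have := ft_sum B; lra.
have b3 : \sum_(s < 2 * M) \sum_(t < 2 * M | t != s) nrm (rep_sum (s%:R - t%:R)) <= 2 * M%:R * (eps * M%:R / 2 * (4 * M%:R * M%:R)).
  apply: le_trans (ler_sum _ (fun (s : 'I_(2 * M)) _ => b1 s (ltn_ord s))) _.
  by rewrite sumr_const card_ord -(natrM _ 2 M) [leRHS]mulr_natl.
have b4 : \sum_(j | P j) w j.1 = (\sum_(i < L) dif a i) * (#|A|%:R * #|B|%:R).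
  rewrite -(pair_big xpredT (fun p : 'I_M * 'I_M => (p.1 \in A) && (p.2 \in B)) (fun (i : 'I_L) (p : 'I_M * 'I_M) => w i)) /= mulr_suml; apply: eq_bigr => i _.
  rewrite -(pair_big (mem A) (mem B) (fun x y : 'I_M => w i)) /=.
  by rewrite !sumr_const -mulrnA -[LHS]mulr_natr natrM mulrC -mulrA mulrC -mulrA mulrCA mulrC /w; ring.
rewrite b4 => h.
have h1 : kap * M%:R * (kap * M%:R) <= #|A|%:R * #|B|%:R.
  by apply: ler_pM => //; rewrite mulr_ge0 // ltW.
have h2 : M%:R / 2 * (kap * M%:R * (kap * M%:R)) <= (\sum_(i < L) dif a i) * (#|A|%:R * #|B|%:R).
  by apply: ler_pM => //; rewrite -expr2 sqr_ge0.
have h3 : M%:R * (M%:R / 2 * (kap * M%:R * (kap * M%:R))) <= 2 * (2 * M%:R * (eps * M%:R / 2 * (4 * M%:R * M%:R))).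
  apply: le_trans (_ : M%:R * ((\sum_(i < L) dif a i) * (#|A|%:R * #|B|%:R)) <= _); first by rewrite ler_pM2l.
  apply: le_trans h _; rewrite [leRHS]mulr_natl mulr2n lerD //.
  by rewrite ler_wpM2l // mulr_ge0.
have M40 : 0 < M%:R ^+ 4 :> R by rewrite exprn_gt0.
have : 16 * eps * M%:R ^+ 4 < kap ^+ 2 * M%:R ^+ 4 by rewrite ltr_pM2r.
move: h3; set m : R := M%:R; rewrite !expr2 !exprS expr0; lra.
Qed.

End SumsetMeets.
End Kernel.

(** * From upper density to disjoint finite sets *)

Section Density.
Variable R : realType.

Lemma joint_upper_density_gt0 (A1 A2 : set nat) : (0 < joint_upper_density R A1 A2)%E ->
  exists2 del : R, 0 < del & forall N1, exists N, [/\ (N1 <= N)%N,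
    del * N%:R <= (count_upto A1 N)%:R & del * N%:R <= (count_upto A2 N)%:R].
Proof.
move=> h; apply: contrapT => hno; move: h; apply/negP; rewrite -leNgt.
apply/lee_addgt0Pr => del del0; rewrite add0e.
have [N1 hN1] : exists N1, forall N, (N1 <= N)%N ->
    ~ (del * N%:R <= (count_upto A1 N)%:R /\ del * N%:R <= (count_upto A2 N)%:R).
  apply: contrapT => h; apply: hno; exists del => // N1; apply: contrapT => h1; apply: h.
  by exists N1 => N hN [q1 q2]; apply: h1; exists N.
rewrite /joint_upper_density /limn_esup /limf_esup.
apply: le_trans (_ : (ereal_sup _ <= _)%E).
  (* Starting at 1 keeps the denominators [N] positive. *)
  apply: ereal_inf_lbound; exists [set N | (maxn N1 1 <= N)%N]; last by [].
  by exists (maxn N1 1).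
apply: ge_ereal_sup => _ [N /= hN <-]; rewrite lee_fin leNgt lt_min; apply/negP => /andP[q1 q2].
move: hN; rewrite geq_max => /andP[a1 a2].
have N0 : 0 < N%:R :> R by rewrite ltr0n.
apply: (hN1 N a1); move: q1 q2; rewrite !ltr_pdivlMr // => q1 q2.
by split; exact: ltW.
Qed.

Definition initial_part (A : set nat) (N M : nat) : {set 'I_M} := [set x : 'I_M | `[< A x >] && (1 <= x <= N)%N]%SET.

Lemma count_upto_le (A : set nat) (N M : nat) : (N < M)%N -> (count_upto A N <= #|initial_part A N M|)%N.
Proof.
move=> NM; rewrite cardE -(size_map val) /count_upto.
have fin : finite_set (A `&` [set k | (1 <= k <= N)%N]).
  apply: (@sub_finite_set _ _ `I_N.+1); last exact: finite_II.
  by move=> x [_ /= /andP[_]]; rewrite ltnS.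
apply: uniq_leq_size; first exact: fset_uniq.
move=> x; rewrite in_fset_set // inE => -[Ax /= hx].
have xM : (x < M)%N by case/andP: hx => _ h; exact: leq_ltn_trans h NM.
apply/mapP; exists (Ordinal xM) => //.
by rewrite mem_enum inE /= hx andbT; apply/asboolP.
Qed.

(** Removing from [Y] just [m] elements chosen in [X] leaves at least [m]; disjointness is what
    makes [x] and [y] distinct. *)
Lemma disjoint_split (T : finType) (X Y : {set T}) (m : nat) : (2 * m <= #|X|)%N -> (2 * m <= #|Y|)%N ->
  exists A B : {set T}, [/\ A \subset X, B \subset Y, (A :&: B)%SET = finset.set0, (m <= #|A|)%N & (m <= #|B|)%N].
Proof.
move=> hX hY.
pose A : {set T} := [set x in take m (enum X)]%SET.
have cA : #|A| = m.
  rewrite cardsE (card_uniqP _) ?take_uniq ?enum_uniq // size_takel // -cardE.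
  by apply: leq_trans hX; rewrite leq_pmull.
exists A, (Y :\: A)%SET; split.
- by apply/fintype.subsetP => x; rewrite inE => /mem_take; rewrite mem_enum.
- exact: finset.subsetDl.
- by apply/setP => x; rewrite !inE; case: (x \in take _ _); rewrite ?andbF.
- by rewrite cA.
have := cardsID A Y; have : (#|Y :&: A| <= m)%N by rewrite -cA subset_leq_card // finset.subsetIr.
by move: hY; clear; lia.
Qed.

End Density.

Theorem theorem1p11 (R : realType) (alpha : R -> R)
    (halpha : sub_polynomial alpha)
    (halpha_oo : alpha x @[x --> +oo_ R] --> +oo_ R)
    (hgrowth : forall (p : {poly rat}) (c : R),
      `|alpha x - c * (map_poly ratr p).[x]| / ln x @[x --> +oo_ R]
        --> +oo_ R)
    (A1 A2 : set nat)
    (hA1 : A1 `<=` [set k | (1 <= k)%N])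
    (hA2 : A2 `<=` [set k | (1 <= k)%N])
    (hdens : (0 < joint_upper_density R A1 A2)%E) :
  exists n x y : nat,
    [/\ (1 <= n)%N, A1 x, A2 y, x <> y &
        (x + y)%:Z = Num.floor (alpha n%:R)].
Proof.
have [k [F [F0 hF]]] := hardy_growth_exists halpha halpha_oo.
have hoo C : ev (fun x => C <= F 0%N x).
  by rewrite F0; apply/ev_near; move/cvgryPge : halpha_oo => /(_ C).
rewrite -F0 in hgrowth.
have [del del0 hdel] := joint_upper_density_gt0 hdens.
(* The disjoint sets have at least [m > del N / 4 - 1 > del N / 8] elements, as [del N > 8], and
   [M <= 4 N]; this gives the proportion [del / 32]. *)
pose kap := del / 32; have kap0 : 0 < kap by rewrite divr_gt0.
pose eps := kap ^+ 2 / 32; have eps0 : 0 < eps by rewrite divr_gt0 // exprn_gt0.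
have [M0 hM0] := balanced_weights_exist hF hoo hgrowth eps0.
have [N [hN c1 c2]] := hdel (maxn M0 (Num.truncn (8 / del)).+1).
move: hN; rewrite geq_max => /andP[hN1 hN2].
have hN3 : 8 < del * N%:R.
  rewrite mulrC -ltr_pdivrMr //; apply: lt_le_trans (truncnS_gt _) _.
  by rewrite ler_nat.
have N0 : (0 < N)%N by apply: leq_trans hN2.
have N1 : 1 <= N%:R :> R by rewrite ler1n.
(* Elements up to [N] then satisfy [2 x + 2 <= M], as [sumset_meets] requires. *)
pose M := (2 * N + 2)%N.
have [NM M4 M0M] : [/\ (N < M)%N, (4 <= M)%N & (M0 <= M)%N] by rewrite /M; move: N0 hN1; clear; split; lia.
have [n0 [L [n00 ha hd hW hT]]] := hM0 M M0M.
pose m := Num.truncn (del * N%:R / 4).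
have hm1 : m%:R <= del * N%:R / 4 < m.+1%:R.
  by apply: truncn_itv; rewrite divr_ge0 // mulr_ge0 // ltW.
have hm2 A : del * N%:R <= (count_upto A N)%:R :> R -> (2 * m <= #|initial_part A N M|)%N.
  move=> h; apply: leq_trans (count_upto_le _ NM); rewrite -(ler_nat R) (natrM _ 2 m).
  by case/andP: hm1 => h1 _; lra.
have [A [B [AX BY dAB cA cB]]] := disjoint_split (hm2 _ c1) (hm2 _ c2).
have hkM (S : {set 'I_M}) : (m <= #|S|)%N -> kap * M%:R <= #|S|%:R.
  rewrite -(ler_nat R); apply: le_trans.
  move: hm1 => /andP[_]; rewrite -(natr1 m) /kap /M natrD (natrM _ 2 N).
  have : del <= del * N%:R by rewrite ler_peMr // ltW.
  lra.
have hsub (S : {set 'I_M}) A' : S \subset initial_part A' N M -> forall x, x \in S -> A' x /\ (2 * x + 2 <= M)%N.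
  move=> /fintype.subsetP h x /h; rewrite inE => /andP[/asboolP q1 /andP[_ q2]].
  by split => //; rewrite /M leq_add2r leq_mul2l q2 orbT.
have heps : 16 * eps < kap ^+ 2.
  have : 0 < kap ^+ 2 by rewrite exprn_gt0.
  by rewrite /eps; lra.
have [i [x [y [iL xA yB hxy]]]] := sumset_meets M4 ha hd hW hT eps0 kap0 heps (hkM _ cA) (hkM _ cB)
  (fun x hx => (hsub _ _ AX x hx).2) (fun x hx => (hsub _ _ BY x hx).2).
exists (n0 + i)%N, x, y; split.
- by rewrite (leq_trans n00) // leq_addr.
- exact: (hsub _ _ AX x xA).1.
- exact: (hsub _ _ BY y yB).1.
- by move=> /ord_inj exy; move/setP/(_ x) : dAB; rewrite !inE xA exy yB.
- by rewrite -F0.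
Qed.
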